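(* Let $P$ be a poset, $\mathbf{k}$ a field, $\varphi:P\times P\to P$ an order-preserving map. Let $(K,d^K)$ be a positive complex and $(L,d^L)$ a negative complex of persistence modules indexed by $P$. Suppose that $K$ and its subcomplex of boundaries have all terms projective persistence modules. Then for all $n\ge 0$ there is a natural short exact sequence $$0\to \prod_{i+j=n-1}\mathbf{Ext}^1_{\varphi}(H_i(K),H_{j}(L))\to H^n(\mathscr{H}om^{\varphi}(K, L))\to\prod_{i+j=n} \mathscr{H}om^{\varphi}(H_i(K),H_{j}(L))\to 0.$$ If in addition the complex $L$ and its subcomplex of boundaries have all terms injective, then the short exact sequence splits, although not naturally.
   Context: A poset $P$ is viewed as a category $\mathbf{P}$ with a unique morphism $p\to q$ iff $p\le q$. A persistence module is a functor $M:\mathbf{P}\to\mathbf{Vect}_{\mathbf{k}}$; they form the abelian category $\mathbf{k}^{\mathbf{P}}$ (exactness is pointwise), which has enough projectives and injectives. $P\times P$ has the product order with projections $\pi_1,\pi_2$. For order-preserving $f:P\to Q$: $(f^{-1}G)_p=G_{f(p)}$ and $(f_*F)_q=\lim_{q\le f(p)}F_p$. For a poset $Q$, $\mathscr{H}om_{\mathbf{Q}}(M,N)_q=\mathrm{Hom}_{\mathbf{k}^{\mathbf{U}_q}}(M|_{\mathbf{U}_q},N|_{\mathbf{U}_q})$, $U_q=\{q'\in Q:q\le q'\}$, with restriction maps as structure maps. The $\varphi$-internal hom is $$\mathscr{H}om^{\varphi}(M,N)=\pi_{2*}\mathscr{H}om_{\mathbf{P}\times\mathbf{P}}(\pi_1^{-1}M,\varphi^{-1}N).$$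 It is contravariant left exact in $M$ and covariant left exact in $N$; $\mathbf{Ext}^i_\varphi$ denotes its right derived functors. In the claim $\mathbf{Ext}^1_\varphi(M,N)=H^1(\mathscr{H}om^\varphi(Q_\bullet,N))$ for a projective resolution $Q_\bullet\to M$. A positive complex has $K_n=0$ for $n<0$ and differentials $d^K_n:K_n\to K_{n-1}$. A negative complex $L$ has $L_n=0$ for $n>0$ and differentials lowering degree; equivalently, re-indexing $n\mapsto -n$, it is a positive cochain complex $L^q:=L_{-q}$, $q\ge 0$, with differentials $L^q\to L^{q+1}$. In the claim the degree $j$ of $L$ is this cochain degree, so $H_j(L)$ is the cohomology at $L^j$. The subcomplex of boundaries consists of the images of the differentials. $\mathscr{H}om^\varphi(K,L)$ is the total cochain complex $\mathscr{H}om^\varphi(K,L)^n=\prod_{p+q=n}\mathscr{H}om^\varphi(K_p,L^q)$, with differential the product of the maps $(-1)^{p+q+1}(d^K_{p+1})^*:\mathscr{H}om^\varphi(K_p,L^q)\to\mathscr{H}om^\varphi(K_{p+1},L^q)$ and the maps $\mathscr{H}om^\varphi(K_p,L^q)\to\mathscr{H}om^\varphi(K_p,L^{q+1})$ induced by the differential of $L$. *)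

(* Defs.v *)
From HB Require Import structures.
From mathcomp Require Import all_boot all_order all_algebra ring_quotient.
From mathcomp Require Import boolp.
From mathcomp.multinomials Require Import freeg.

Set Implicit Arguments.
Unset Strict Implicit.
Unset Printing Implicit Defensive.

Import Order.TTheory GRing.Theory.
Local Open Scope ring_scope.

Section Linear.
Context (k : fieldType).
Implicit Types U V W : lmodType k.

Definition mklin U V (f : U -> V) (h : linear f) : {linear U -> V} :=
  HB.pack f (GRing.isLinear.Build k U V _ f h).

End Linear.

Section DProd.
Context (k : fieldType) (I : Type) (V : I -> lmodType k).

Definition dprod : Type := forall i, V i.

HB.instance Definition _ := gen_eqMixin dprod.
HB.instance Definition _ := gen_choiceMixin dprod.

Definition dprod_zero : dprod := fun=> 0.
Definition dprod_opp (f : dprod) : dprod := fun i => - f i.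
Definition dprod_add (f g : dprod) : dprod := fun i => f i + g i.
Definition dprod_scale (a : k) (f : dprod) : dprod := fun i => a *: f i.

Fact dprod_addA : associative dprod_add.
Proof. by move=> f g h; apply: functional_extensionality_dep => i; exact: addrA. Qed.
Fact dprod_addC : commutative dprod_add.
Proof. by move=> f g; apply: functional_extensionality_dep => i; exact: addrC. Qed.
Fact dprod_add0 : left_id dprod_zero dprod_add.
Proof. by move=> f; apply: functional_extensionality_dep => i; exact: add0r. Qed.
Fact dprod_addN : left_inverse dprod_zero dprod_opp dprod_add.
Proof. by move=> f; apply: functional_extensionality_dep => i; exact: addNr. Qed.

HB.instance Definition _ := GRing.isZmodule.Build dprod
  dprod_addA dprod_addC dprod_add0 dprod_addN.

Fact dprod_scaleA a b f :
  dprod_scale a (dprod_scale b f) = dprod_scale (a * b) f.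
Proof. by apply: functional_extensionality_dep => i; exact: scalerA. Qed.
Fact dprod_scale1 : left_id 1 dprod_scale.
Proof. by move=> f; apply: functional_extensionality_dep => i; exact: scale1r. Qed.
Fact dprod_scaleDr : right_distributive dprod_scale +%R.
Proof. by move=> a f g; apply: functional_extensionality_dep => i; exact: scalerDr. Qed.
Fact dprod_scaleDl f : {morph dprod_scale^~ f : a b / a + b}.
Proof. by move=> a b; apply: functional_extensionality_dep => i; exact: scalerDl. Qed.

HB.instance Definition _ := GRing.Zmodule_isLmodule.Build k dprod
  dprod_scaleA dprod_scale1 dprod_scaleDr dprod_scaleDl.

End DProd.

Section Subspace.
Context (k : fieldType) (V : lmodType k).

Record subspace := Subspace {
  sp_mem :> V -> Prop;
  sp_zero : sp_mem 0;
  sp_lin : forall a u v, sp_mem u -> sp_mem v -> sp_mem (a *: u + v) }.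

Definition sp_pred (S : subspace) : V -> bool := fun x => `[< S x >].

Fact sp_pred_closed (S : subspace) : submod_closed (sp_pred S).
Proof.
split; first exact/asboolP/sp_zero.
by move=> a u v /asboolP Su /asboolP Sv; exact/asboolP/sp_lin.
Qed.

HB.instance Definition _ (S : subspace) :=
  GRing.isSubmodClosed.Build k V (sp_pred S) (sp_pred_closed S).

Definition subsp (S : subspace) : Type := {x : V | x \in sp_pred S}.

HB.instance Definition _ (S : subspace) := SubChoice.on (subsp S).
HB.instance Definition _ (S : subspace) :=
  [SubChoice_isSubLmodule of subsp S by <:].

Definition insubsp (S : subspace) (x : V) (h : S x) : subsp S :=
  exist _ x (introT (asboolP _) h).

Lemma subspP (S : subspace) (x : subsp S) : S (val x).
Proof. by case: x => x /= /asboolP. Qed.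

Definition sp_zmod (S : subspace) : zmodClosed V :=
  GRing.ZmodClosed.clone V (sp_pred S) _.

Definition quotv (S : subspace) : Type := Quotient.quot (sp_zmod S).

HB.instance Definition _ (S : subspace) := GRing.Zmodule.on (quotv S).

Definition quotv_pi (S : subspace) (x : V) : quotv S :=
  (\pi_(Quotient.quot (sp_zmod S)) x)%qT.
Definition quotv_repr (S : subspace) (x : quotv S) : V := generic_quotient.repr x.

Lemma quotv_reprK (S : subspace) : cancel (@quotv_repr S) (@quotv_pi S).
Proof. by move=> x; exact: reprK. Qed.

Lemma quotv_eq (S : subspace) (x y : V) :
  quotv_pi S x = quotv_pi S y <-> S (x - y).
Proof.
split; first by move/eqP; rewrite /quotv_pi -Quotient.idealrBE => /asboolP.
by move=> h; apply/eqP; rewrite /quotv_pi -Quotient.idealrBE; exact/asboolP.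
Qed.

Lemma quotv_piD (S : subspace) x y :
  quotv_pi S (x + y) = quotv_pi S x + quotv_pi S y.
Proof. exact: raddfD. Qed.

Lemma quotv_reprP (S : subspace) x : S (quotv_repr (quotv_pi S x) - x).
Proof. by apply/quotv_eq; rewrite quotv_reprK. Qed.

Lemma sp_scale (S : subspace) a u : S u -> S (a *: u).
Proof. by move=> Su; rewrite -[_ *: _]addr0; apply: sp_lin => //; exact: sp_zero. Qed.

Definition quotv_scale (S : subspace) (a : k) (x : quotv S) : quotv S :=
  quotv_pi S (a *: quotv_repr x).

Lemma quotv_piZ (S : subspace) a x :
  quotv_scale a (quotv_pi S x) = quotv_pi S (a *: x).
Proof. by apply/quotv_eq; rewrite -scalerBr; apply/sp_scale/quotv_reprP. Qed.

Fact quotv_scaleA (S : subspace) a b (x : quotv S) :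
  quotv_scale a (quotv_scale b x) = quotv_scale (a * b) x.
Proof. by rewrite -[x]quotv_reprK !quotv_piZ scalerA. Qed.
Fact quotv_scale1 (S : subspace) : left_id 1 (@quotv_scale S).
Proof. by move=> x; rewrite -[x]quotv_reprK !quotv_piZ scale1r. Qed.
Fact quotv_scaleDr (S : subspace) : right_distributive (@quotv_scale S) +%R.
Proof.
move=> a x y; rewrite -[x]quotv_reprK -[y]quotv_reprK.
by rewrite -quotv_piD !quotv_piZ -quotv_piD scalerDr.
Qed.
Fact quotv_scaleDl (S : subspace) (x : quotv S) :
  {morph (@quotv_scale S)^~ x : a b / a + b}.
Proof.
by move=> a b; rewrite -[x]quotv_reprK !quotv_piZ scalerDl quotv_piD.
Qed.

HB.instance Definition _ (S : subspace) :=
  GRing.Zmodule_isLmodule.Build k (quotv S) (@quotv_scaleA S) (@quotv_scale1 S)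
    (@quotv_scaleDr S) (@quotv_scaleDl S).

Lemma quotv_pi_linear (S : subspace) : linear (quotv_pi S).
Proof.
move=> a x y; rewrite quotv_piD; congr (_ + _).
by rewrite -[RHS]/(quotv_scale a _) quotv_piZ.
Qed.

End Subspace.

Section SubspaceMaps.
Context (k : fieldType).
Implicit Types U V W : lmodType k.

Lemma kerv_lin U V (f : {linear U -> V}) a u v :
  f u = 0 -> f v = 0 -> f (a *: u + v) = 0.
Proof. by move=> fu fv; rewrite linearP fu fv scaler0 addr0. Qed.

Definition kerv U V (f : {linear U -> V}) : subspace U :=
  Subspace (linear0 f) (kerv_lin (f := f)).

Fact imv_zero U V (f : {linear U -> V}) : exists x, f x = 0.
Proof. by exists 0; exact: linear0. Qed.
Fact imv_lin U V (f : {linear U -> V}) a u v :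
  (exists x, f x = u) -> (exists x, f x = v) -> exists x, f x = a *: u + v.
Proof. by case=> x <- [y <-]; exists (a *: x + y); rewrite linearP. Qed.

Definition imv U V (f : {linear U -> V}) : subspace V :=
  Subspace (imv_zero f) (@imv_lin _ _ f).

Fact preimv_zero U V (f : {linear U -> V}) (S : subspace V) : S (f 0).
Proof. by rewrite linear0; exact: sp_zero. Qed.
Fact preimv_lin U V (f : {linear U -> V}) (S : subspace V) a u v :
  S (f u) -> S (f v) -> S (f (a *: u + v)).
Proof. by move=> Su Sv; rewrite linearP; exact: sp_lin. Qed.

Definition preimv U V (f : {linear U -> V}) (S : subspace V) : subspace U :=
  Subspace (preimv_zero f S) (@preimv_lin _ _ f S).

Section Map.
Context (U V : lmodType k) (S : subspace U) (T : subspace V).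
Context (f : {linear U -> V}) (h : forall x, S x -> T (f x)).

Definition subsp_map_fun (x : subsp S) : subsp T := insubsp (h (subspP x)).
Fact subsp_map_linear : linear subsp_map_fun.
Proof. by move=> a x y; apply: val_inj; rewrite /= linearP. Qed.
Definition subsp_map : {linear subsp S -> subsp T} := mklin subsp_map_linear.

Definition quotv_map_fun (x : quotv S) : quotv T := quotv_pi T (f (quotv_repr x)).
Lemma quotv_map_pi x : quotv_map_fun (quotv_pi S x) = quotv_pi T (f x).
Proof. by apply/quotv_eq; rewrite -linearB; apply/h/quotv_reprP. Qed.
Fact quotv_map_linear : linear quotv_map_fun.
Proof.
move=> a x y; rewrite -[x]quotv_reprK -[y]quotv_reprK.
by rewrite -quotv_pi_linear !quotv_map_pi linearP quotv_pi_linear.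
Qed.
Definition quotv_map : {linear quotv S -> quotv T} := mklin quotv_map_linear.
Lemma quotv_mapE x : quotv_map (quotv_pi S x) = quotv_pi T (f x).
Proof. exact: quotv_map_pi. Qed.

End Map.
End SubspaceMaps.

Section Pmod.
Context (k : fieldType) (d : Order.disp_t) (P : porderType d).

Record pmod := Pmod {
  pm_obj :> P -> lmodType k;
  pm_map : forall p q : P, (p <= q)%O -> {linear pm_obj p -> pm_obj q};
  pm_id : forall p (h : (p <= p)%O) x, pm_map h x = x;
  pm_comp : forall p q r (h1 : (p <= q)%O) (h2 : (q <= r)%O) (h3 : (p <= r)%O) x,
      pm_map h2 (pm_map h1 x) = pm_map h3 x }.

Section Hom.
Context (M N : pmod).

Definition hom_data : Type := dprod (fun p : P => dprod (fun _ : M p => N p)).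
HB.instance Definition _ := GRing.Lmodule.on hom_data.

Definition is_pmor (f : forall p, M p -> N p) : Prop :=
  (forall p, linear (f p)) /\
  (forall p q (h : (p <= q)%O) x, f q (pm_map M h x) = pm_map N h (f p x)).

Fact is_pmor0 : is_pmor (0 : hom_data).
Proof.
split=> [p a x y|p q h x]; last by rewrite linear0.
by rewrite /= -[LHS]/(0 : N p) -[X in _ = a *: X + _]/(0 : N p)
  -[X in _ = _ + X]/(0 : N p) scaler0 addr0.
Qed.
Fact is_pmor_lin a (f g : hom_data) :
  is_pmor f -> is_pmor g -> is_pmor (a *: f + g : hom_data).
Proof.
move=> [fl fn] [gl gn]; split=> [p b x y|p q h x].
  rewrite -[LHS]/(a *: f p (b *: x + y) + g p (b *: x + y)).
  rewrite -[X in _ = b *: X + _]/(a *: f p x + g p x).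
  rewrite -[X in _ = _ + X]/(a *: f p y + g p y).
  by rewrite fl gl !scalerDr !scalerA [a * b]mulrC addrACA.
rewrite -[LHS]/(a *: f q (pm_map M h x) + g q (pm_map M h x)).
by rewrite -[X in _ = pm_map N h X]/(a *: f p x + g p x) fn gn linearP.
Qed.

Definition pmor_sp : subspace hom_data := Subspace is_pmor0 is_pmor_lin.

Definition pmor : Type := subsp pmor_sp.
HB.instance Definition _ := GRing.Lmodule.on pmor.

Definition pmor_fun (f : pmor) (p : P) : M p -> N p := val f p.
Coercion pmor_fun : pmor >-> Funclass.

Fact pmor_linear (f : pmor) p : linear (pmor_fun f (p := p)).
Proof. exact: (proj1 (subspP f)). Qed.
HB.instance Definition _ (f : pmor) p :=
  GRing.isLinear.Build k (M p) (N p) _ (pmor_fun f (p := p)) (@pmor_linear f p).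

Lemma pmor_nat (f : pmor) p q (h : (p <= q)%O) x :
  f q (pm_map M h x) = pm_map N h (f p x).
Proof. exact: (proj2 (subspP f)). Qed.

Lemma pmorP (f g : pmor) : (forall p x, f p x = g p x) -> f = g.
Proof.
move=> fg; apply: val_inj; apply: functional_extensionality_dep => p.
by apply: functional_extensionality_dep => x; exact: fg.
Qed.

Definition mkpmor (f : forall p, {linear M p -> N p})
    (h : forall p q (h : (p <= q)%O) x, f q (pm_map M h x) = pm_map N h (f p x)) :
    pmor :=
  insubsp (S := pmor_sp) (conj (fun p => linearP (f p)) h).

End Hom.

Section HomEval.
Context (M N : pmod).
Implicit Types f g : pmor M N.

Lemma pmor0E p x : (0 : pmor M N) p x = 0. Proof. by []. Qed.
Lemma pmorDE f g p x : (f + g : pmor M N) p x = f p x + g p x. Proof. by []. Qed.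
Lemma pmorNE f p x : (- f : pmor M N) p x = - f p x. Proof. by []. Qed.
Lemma pmorZE a f p x : (a *: f : pmor M N) p x = a *: f p x. Proof. by []. Qed.

End HomEval.
End Pmod.

Section Category.
Context (k : fieldType) (d : Order.disp_t) (P : porderType d).
Implicit Types M N A B C D : pmod k P.

Fact idlin_subproof (V : lmodType k) : linear (fun x : V => x).
Proof. by []. Qed.
Definition idlin (V : lmodType k) : {linear V -> V} := mklin (@idlin_subproof V).

Definition pid M : pmor M M := mkpmor (f := fun p => idlin (M p)) (fun _ _ _ _ => erefl).

Fact complin_subproof A B C (g : pmor B C) (f : pmor A B) p :
  linear (fun x => g p (f p x)).
Proof. by move=> a x y; rewrite !linearP. Qed.
Fact pmcomp_subproof A B C (g : pmor B C) (f : pmor A B) p q (h : (p <= q)%O) x :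
  mklin (@complin_subproof A B C g f q) (pm_map A h x) =
  pm_map C h (mklin (@complin_subproof A B C g f p) x).
Proof. by rewrite /= !pmor_nat. Qed.
Definition pmcomp A B C (g : pmor B C) (f : pmor A B) : pmor A C :=
  mkpmor (@pmcomp_subproof A B C g f).

Lemma pidE M p x : pid M p x = x. Proof. by []. Qed.
Lemma pmcompE A B C (g : pmor B C) (f : pmor A B) p x : pmcomp g f p x = g p (f p x).
Proof. by []. Qed.

Lemma pmcompA A B C D (h : pmor C D) (g : pmor B C) (f : pmor A B) :
  pmcomp h (pmcomp g f) = pmcomp (pmcomp h g) f.
Proof. exact: pmorP. Qed.
Lemma pmcomp1f A B (f : pmor A B) : pmcomp (pid B) f = f.
Proof. exact: pmorP. Qed.
Lemma pmcompf1 A B (f : pmor A B) : pmcomp f (pid A) = f.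
Proof. exact: pmorP. Qed.
Lemma pmcomp0f A B C (f : pmor A B) : pmcomp (0 : pmor B C) f = 0.
Proof. exact: pmorP. Qed.
Lemma pmcompf0 A B C (g : pmor B C) : pmcomp g (0 : pmor A B) = 0.
Proof. by apply: pmorP => p x; rewrite pmcompE pmor0E linear0. Qed.
Lemma pmcompDl A B C (g g' : pmor B C) (f : pmor A B) :
  pmcomp (g + g') f = pmcomp g f + pmcomp g' f.
Proof. exact: pmorP. Qed.
Lemma pmcompDr A B C (g : pmor B C) (f f' : pmor A B) :
  pmcomp g (f + f') = pmcomp g f + pmcomp g f'.
Proof. by apply: pmorP => p x; rewrite pmcompE !pmorDE linearD. Qed.
Lemma pmcompZl A B C a (g : pmor B C) (f : pmor A B) :
  pmcomp (a *: g) f = a *: pmcomp g f.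
Proof. exact: pmorP. Qed.
Lemma pmcompZr A B C a (g : pmor B C) (f : pmor A B) :
  pmcomp g (a *: f) = a *: pmcomp g f.
Proof. by apply: pmorP => p x; rewrite pmcompE !pmorZE linearZ. Qed.

(* Limits and colimits of persistence modules are computed pointwise: these are
   the categorical mono- and epimorphisms. *)
Definition pmono A B (f : pmor A B) := forall p, injective (f p).
Definition pepi A B (f : pmor A B) := forall p y, exists x, f p x = y.

Definition exact_at A B C (f : pmor A B) (g : pmor B C) :=
  forall p y, g p y = 0 <-> exists x, f p x = y.

Definition short_exact A B C (f : pmor A B) (g : pmor B C) :=
  [/\ pmono f, exact_at f g & pepi g].

Definition projective_pm M :=
  forall A B (e : pmor A B) (f : pmor M B), pepi e ->
  exists g : pmor M A, pmcomp e g = f.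

Definition injective_pm M :=
  forall A B (m : pmor A B) (f : pmor A M), pmono m ->
  exists g : pmor B M, pmcomp g m = f.

Section Product.
Context (I : Type) (F : I -> pmod k P).

Definition pprod_obj (p : P) : lmodType k := dprod (fun i => F i p).
Fact pprod_map_linear p q (h : (p <= q)%O) :
  linear (fun (s : pprod_obj p) => (fun i => pm_map (F i) h (s i)) : pprod_obj q).
Proof.
move=> a s t; apply: functional_extensionality_dep => i.
exact: (linearP (pm_map (F i) h)).
Qed.
Definition pprod_map p q (h : (p <= q)%O) : {linear pprod_obj p -> pprod_obj q} :=
  mklin (pprod_map_linear h).
Fact pprod_id p (h : (p <= p)%O) x : pprod_map h x = x.
Proof. by apply: functional_extensionality_dep => i; exact: pm_id. Qed.
Fact pprod_comp p q r (h1 : (p <= q)%O) (h2 : (q <= r)%O) (h3 : (p <= r)%O) x :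
  pprod_map h2 (pprod_map h1 x) = pprod_map h3 x.
Proof. by apply: functional_extensionality_dep => i; exact: pm_comp. Qed.
Definition pprod : pmod k P := Pmod pprod_id pprod_comp.

Fact pproj_linear i p : linear (fun s : pprod p => s i).
Proof. by []. Qed.
Definition pproj i : pmor pprod (F i) :=
  mkpmor (f := fun p => mklin (@pproj_linear i p)) (fun _ _ _ _ => erefl).

Section Tuple.
Context (M : pmod k P) (f : forall i, pmor M (F i)).
Fact ptuple_linear p : linear (fun x : M p => (fun i => f i p x) : pprod p).
Proof.
move=> a x y; apply: functional_extensionality_dep => i.
exact: (linearP (pmor_fun (f i) (p := p))).
Qed.
Fact ptuple_nat p q (h : (p <= q)%O) x :
  mklin (@ptuple_linear q) (pm_map M h x) = pm_map pprod h (mklin (@ptuple_linear p) x).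
Proof. by apply: functional_extensionality_dep => i; exact: pmor_nat. Qed.
Definition ptuple : pmor M pprod := mkpmor ptuple_nat.
End Tuple.

Lemma pproj_tuple M (f : forall i, pmor M (F i)) i : pmcomp (pproj i) (ptuple f) = f i.
Proof. exact: pmorP. Qed.
Lemma pprod_ext M (f g : pmor M pprod) :
  (forall i, pmcomp (pproj i) f = pmcomp (pproj i) g) -> f = g.
Proof.
move=> fg; apply: pmorP => p x; apply: functional_extensionality_dep => i.
by have := congr1 (fun u : pmor M (F i) => u p x) (fg i).
Qed.

End Product.

Definition pprod_mor (I : Type) (F G : I -> pmod k P) (f : forall i, pmor (F i) (G i)) :
    pmor (pprod F) (pprod G) :=
  ptuple (fun i => pmcomp (f i) (pproj F i)).

Definition pzero : pmod k P := pprod (fun i : void => match i with end).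

Section Kernel.
Context A B (f : pmor A B).

Definition pker_obj p : lmodType k := subsp (kerv (pmor_fun f (p := p))).
Fact pker_stable p q (h : (p <= q)%O) (x : A p) : f p x = 0 -> f q (pm_map A h x) = 0.
Proof. by move=> fx; rewrite pmor_nat fx linear0. Qed.
Definition pker_map p q (h : (p <= q)%O) : {linear pker_obj p -> pker_obj q} :=
  subsp_map (S := kerv _) (T := kerv _) (pker_stable h).
Fact pker_id p (h : (p <= p)%O) x : pker_map h x = x.
Proof. by apply: val_inj; exact: pm_id. Qed.
Fact pker_comp p q r (h1 : (p <= q)%O) (h2 : (q <= r)%O) (h3 : (p <= r)%O) x :
  pker_map h2 (pker_map h1 x) = pker_map h3 x.
Proof. by apply: val_inj; exact: pm_comp. Qed.
Definition pker : pmod k P := Pmod pker_id pker_comp.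

Fact pker_in_linear p : linear (fun x : pker p => val x : A p).
Proof. by []. Qed.
Definition pker_in : pmor pker A :=
  mkpmor (f := fun p => mklin (@pker_in_linear p)) (fun _ _ _ _ => erefl).

Definition pim_obj p : lmodType k := subsp (imv (pmor_fun f (p := p))).
Fact pim_stable p q (h : (p <= q)%O) (y : B p) :
  (exists x, f p x = y) -> exists x, f q x = pm_map B h y.
Proof. by case=> x <-; exists (pm_map A h x); exact: pmor_nat. Qed.
Definition pim_map p q (h : (p <= q)%O) : {linear pim_obj p -> pim_obj q} :=
  subsp_map (S := imv _) (T := imv _) (pim_stable h).
Fact pim_id p (h : (p <= p)%O) x : pim_map h x = x.
Proof. by apply: val_inj; exact: pm_id. Qed.
Fact pim_comp p q r (h1 : (p <= q)%O) (h2 : (q <= r)%O) (h3 : (p <= r)%O) x :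
  pim_map h2 (pim_map h1 x) = pim_map h3 x.
Proof. by apply: val_inj; exact: pm_comp. Qed.
Definition pim : pmod k P := Pmod pim_id pim_comp.

End Kernel.

Section KernelMap.
Context A B A' B' (f : pmor A B) (f' : pmor A' B') (a : pmor A A') (b : pmor B B').
Context (sq : pmcomp f' a = pmcomp b f).

Fact pker_mor_stable p (x : A p) : f p x = 0 -> f' p (a p x) = 0.
Proof. by move=> fx; rewrite -pmcompE sq pmcompE fx linear0. Qed.
Definition pker_mor_lin p : {linear pker f p -> pker f' p} :=
  subsp_map (S := kerv _) (T := kerv _) (f := pmor_fun a (p := p)) (@pker_mor_stable p).
Fact pker_mor_nat p q (h : (p <= q)%O) x :
  pker_mor_lin q (pm_map (pker f) h x) = pm_map (pker f') h (pker_mor_lin p x).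
Proof. by apply: val_inj; exact: pmor_nat. Qed.
Definition pker_mor : pmor (pker f) (pker f') := mkpmor pker_mor_nat.

End KernelMap.

(* ker g / (im f \cap ker g); g \o f = 0 is not assumed but holds in all uses *)
Section Homology.
Context A B C (f : pmor A B) (g : pmor B C).

Definition cyc_sp p : subspace (B p) := kerv (pmor_fun g (p := p)).
Definition bnd_sp p : subspace (subsp (cyc_sp p)) :=
  preimv (val : {linear subsp (cyc_sp p) -> B p}) (imv (pmor_fun f (p := p))).

Definition homology_obj p : lmodType k := quotv (bnd_sp p).
Definition cyc_map p q (h : (p <= q)%O) : {linear subsp (cyc_sp p) -> subsp (cyc_sp q)} :=
  pker_map g h.
Fact homology_stable p q (h : (p <= q)%O) (z : subsp (cyc_sp p)) :
  bnd_sp p z -> bnd_sp q (cyc_map h z).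
Proof. exact: (pim_stable (f := f) h). Qed.
Definition homology_map p q (h : (p <= q)%O) :
    {linear homology_obj p -> homology_obj q} :=
  quotv_map (@homology_stable p q h).
Fact homology_id p (h : (p <= p)%O) x : homology_map h x = x.
Proof.
rewrite -[x]quotv_reprK; move: (quotv_repr x) => y.
by rewrite quotv_mapE; congr quotv_pi; exact: (pker_id (f := g) h).
Qed.
Fact homology_comp p q r (h1 : (p <= q)%O) (h2 : (q <= r)%O) (h3 : (p <= r)%O) x :
  homology_map h2 (homology_map h1 x) = homology_map h3 x.
Proof.
rewrite -[x]quotv_reprK; move: (quotv_repr x) => y.
rewrite (quotv_mapE (@homology_stable p q h1)) !quotv_mapE.
by congr quotv_pi; exact: (pker_comp (f := g) h1 h2 h3).
Qed.
Definition homology : pmod k P := Pmod homology_id homology_comp.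

End Homology.

Section HomologyMap.
Context A B C (f : pmor A B) (g : pmor B C).
Context A' B' C' (f' : pmor A' B') (g' : pmor B' C').
Context (a : pmor A A') (b : pmor B B') (c : pmor C C').
Context (sqf : pmcomp f' a = pmcomp b f) (sqg : pmcomp g' b = pmcomp c g).

Definition cyc_mor p : {linear subsp (cyc_sp g p) -> subsp (cyc_sp g' p)} :=
  pker_mor_lin sqg p.
Fact homology_mor_stable p z : bnd_sp f g p z -> bnd_sp f' g' p (cyc_mor p z).
Proof.
case=> x fx; exists (a p x).
by rewrite -[LHS]/(pmcomp f' a p x) sqf pmcompE fx.
Qed.
Definition homology_mor_lin p : {linear homology f g p -> homology f' g' p} :=
  quotv_map (@homology_mor_stable p).
Fact homology_mor_nat p q (h : (p <= q)%O) x :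
  homology_mor_lin q (pm_map (homology f g) h x) =
  pm_map (homology f' g') h (homology_mor_lin p x).
Proof.
rewrite -[x]quotv_reprK; move: (quotv_repr x) => y.
rewrite !quotv_mapE; congr quotv_pi; apply: val_inj; exact: pmor_nat.
Qed.
Definition homology_mor : pmor (homology f g) (homology f' g') :=
  mkpmor homology_mor_nat.

End HomologyMap.

End Category.

Section Pullback.
Context (k : fieldType) (d d' : Order.disp_t) (P : porderType d) (Q : porderType d').
Context (f : {omorphism P -> Q}).

Section Obj.
Context (G : pmod k Q).
Fact pullback_id p (h : (p <= p)%O) x : pm_map G (omorph_le f h) x = x.
Proof. exact: pm_id. Qed.
Fact pullback_comp p q r (h1 : (p <= q)%O) (h2 : (q <= r)%O) (h3 : (p <= r)%O) x :
  pm_map G (omorph_le f h2) (pm_map G (omorph_le f h1) x) = pm_map G (omorph_le f h3) x.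
Proof. exact: pm_comp. Qed.
Definition pullback : pmod k P :=
  Pmod (pm_obj := fun p => G (f p))
       (pm_map := fun p q h => pm_map G (omorph_le f h)) pullback_id pullback_comp.
End Obj.

Fact pullback_mor_nat G G' (u : pmor G G') p q (h : (p <= q)%O) (x : pullback G p) :
  u (f q) (pm_map (pullback G) h x) = pm_map (pullback G') h (u (f p) x).
Proof. exact: pmor_nat. Qed.
Definition pullback_mor G G' (u : pmor G G') : pmor (pullback G) (pullback G') :=
  mkpmor (M := pullback G) (N := pullback G')
    (f := fun p => mklin (@pmor_linear _ _ _ _ _ u (f p))) (@pullback_mor_nat _ _ u).

End Pullback.

Lemma sig_fun_irr (T : Type) (A : pred T) (F : T -> Type)
    (s : forall x : {x : T | A x}, F (sval x)) x (h h' : A x) :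
  s (exist _ x h) = s (exist _ x h').
Proof. by rewrite (bool_irrelevance h h'). Qed.

Section Pushforward.
Context (k : fieldType) (d d' : Order.disp_t) (P : porderType d) (Q : porderType d').
Context (f : {omorphism P -> Q}).

Section Obj.
Context (F : pmod k P).

(* lim_{q <= f p} F_p as the space of compatible families *)
Definition push_index (q : Q) : Type := {p : P | (q <= f p)%O}.
Definition compatible q (s : dprod (fun p : push_index q => F (sval p))) : Prop :=
  forall (p p' : push_index q) (h : (sval p <= sval p')%O), pm_map F h (s p) = s p'.
Fact compatible0 q : compatible (0 : dprod (fun p : push_index q => F (sval p))).
Proof. by move=> p p' h; exact: linear0. Qed.
Fact compatible_lin q a (s t : dprod (fun p : push_index q => F (sval p))) :
  compatible s -> compatible t ->
  compatible (a *: s + t : dprod (fun p : push_index q => F (sval p))).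
Proof.
move=> cs ct p p' h; rewrite -[LHS]/(pm_map F h (a *: s p + t p)).
by rewrite linearP cs ct.
Qed.
Definition push_sp q := Subspace (@compatible0 q) (@compatible_lin q).
Definition push_obj q : lmodType k := subsp (push_sp q).

Definition push_reindex q q' (h : (q <= q')%O) (p : push_index q') : push_index q :=
  exist _ (sval p) (le_trans h (proj2_sig p)).
Fact push_map_compatible q q' (h : (q <= q')%O) (s : push_obj q) :
  compatible (fun p : push_index q' => val s (push_reindex h p)).
Proof.
move=> p p' le_pp'.
exact: (subspP (S := push_sp q) s (push_reindex h p) (push_reindex h p') le_pp').
Qed.
Fact push_map_linear q q' (h : (q <= q')%O) :
  linear (fun s : push_obj q => insubsp (S := push_sp q') (push_map_compatible h s) : push_obj q').
Proof. by move=> a s t; apply: val_inj. Qed.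
Definition push_map q q' (h : (q <= q')%O) : {linear push_obj q -> push_obj q'} :=
  mklin (push_map_linear h).
Fact push_id q (h : (q <= q)%O) s : push_map h s = s.
Proof.
apply: val_inj; apply: functional_extensionality_dep => -[p hp].
rewrite -[LHS]/(val s (push_reindex h (exist _ p hp))).
exact: (@sig_fun_irr P (fun p => q <= f p)%O (fun p => F p) (val s) p (le_trans h hp) hp).
Qed.
Fact push_comp q q' q'' (h1 : (q <= q')%O) (h2 : (q' <= q'')%O) (h3 : (q <= q'')%O) s :
  push_map h2 (push_map h1 s) = push_map h3 s.
Proof.
apply: val_inj; apply: functional_extensionality_dep => -[p hp].
rewrite -[LHS]/(val s (push_reindex h1 (push_reindex h2 (exist _ p hp)))).
rewrite -[RHS]/(val s (push_reindex h3 (exist _ p hp))).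
exact: (@sig_fun_irr P (fun p => q <= f p)%O (fun p => F p) (val s) p
  (le_trans h1 (le_trans h2 hp)) (le_trans h3 hp)).
Qed.
Definition pushforward : pmod k Q := Pmod push_id push_comp.
End Obj.

Section Mor.
Context (F F' : pmod k P) (u : pmor F F').
Fact push_mor_compatible q (s : push_obj F q) :
  compatible (F := F') (fun p : push_index q => u (sval p) (val s p)).
Proof. by move=> p p' h; rewrite -pmor_nat; congr (u _ _); exact: (subspP (S := push_sp F q) s p p' h). Qed.
Fact push_mor_linear q :
  linear (fun s : push_obj F q =>
    insubsp (S := push_sp F' q) (push_mor_compatible s) : push_obj F' q).
Proof.
move=> a s t; apply: val_inj; apply: functional_extensionality_dep => p.
exact: (linearP (pmor_fun u (p := sval p))).
Qed.
Fact push_mor_nat q q' (h : (q <= q')%O) s :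
  mklin (@push_mor_linear q') (pm_map (pushforward F) h s) =
  pm_map (pushforward F') h (mklin (@push_mor_linear q) s).
Proof. exact: val_inj. Qed.
Definition push_mor : pmor (pushforward F) (pushforward F') :=
  mkpmor (M := pushforward F) (N := pushforward F')
    (f := fun q => mklin (@push_mor_linear q)) push_mor_nat.
End Mor.

End Pushforward.

Section SheafHom.
Context (k : fieldType) (d : Order.disp_t) (Q : porderType d).

Definition upset (q : Q) : Type := {q' : Q | (q <= q')%O}.
HB.instance Definition _ q := SubChoice.on (upset q).
HB.instance Definition _ q := [SubChoice_isSubPOrder of upset q by <: with d].

Definition upset_val q : {omorphism upset q -> Q} := val.

Definition upset_widen q q' (h : (q <= q')%O) (x : upset q') : upset q :=
  exist _ (val x) (le_trans h (proj2_sig x)).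

Definition restr q (M : pmod k Q) : pmod k (upset q) := pullback (upset_val q) M.
Definition restr_mor q (M N : pmod k Q) (u : pmor M N) : pmor (restr q M) (restr q N) :=
  pullback_mor (upset_val q) u.

Section Obj.
Context (M N : pmod k Q).
Definition shom_obj q : lmodType k := pmor (restr q M) (restr q N).
Section Map.
Context (q q' : Q) (h : (q <= q')%O).
Fact shom_map_pmor (u : pmor (restr q M) (restr q N)) :
  is_pmor (M := restr q' M) (N := restr q' N) (fun x => u (upset_widen h x)).
Proof.
split=> [x|x y le_xy z]; first exact: (@pmor_linear _ _ _ _ _ u (upset_widen h x)).
have le_xy' : (upset_widen h x <= upset_widen h y)%O by [].
have E : u (upset_widen h y) (pm_map M (omorph_le (upset_val q) le_xy') z) =
    pm_map N (omorph_le (upset_val q) le_xy') (u (upset_widen h x) z).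
  exact: (pmor_nat u le_xy' z).
by move: E; rewrite (bool_irrelevance (omorph_le (upset_val q) le_xy')
  (omorph_le (upset_val q') le_xy)).
Qed.
Fact shom_map_linear :
  linear (fun u => insubsp (S := pmor_sp _ _) (shom_map_pmor u) : shom_obj q').
Proof. by move=> a u v; apply: pmorP. Qed.
Definition shom_map : {linear shom_obj q -> shom_obj q'} := mklin shom_map_linear.
End Map.
Fact shom_id q (h : (q <= q)%O) (u : pmor (restr q M) (restr q N)) : shom_map h u = u.
Proof.
apply: pmorP => x y; rewrite -[LHS]/(u (upset_widen h x) y).
case: x y => x hx y; apply: (congr1 (fun v : M x -> N x => v y)).
exact: (@sig_fun_irr Q (fun x => q <= x)%O (fun x => M x -> N x) (fun x => u x) x
  (le_trans h hx) hx).
Qed.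
Fact shom_comp q q' q'' (h1 : (q <= q')%O) (h2 : (q' <= q'')%O) (h3 : (q <= q'')%O)
    (u : pmor (restr q M) (restr q N)) :
  shom_map h2 (shom_map h1 u) = shom_map h3 u.
Proof.
apply: pmorP => x y.
case: x y => x hx y; rewrite -[LHS]/(u (upset_widen h1 (upset_widen h2 (exist _ x hx))) y).
rewrite -[RHS]/(u (upset_widen h3 (exist _ x hx)) y).
apply: (congr1 (fun v : M x -> N x => v y)).
exact: (@sig_fun_irr Q (fun x => q <= x)%O (fun x => M x -> N x) (fun x => u x) x
  (le_trans h1 (le_trans h2 hx)) (le_trans h3 hx)).
Qed.
Definition shom : pmod k Q := Pmod shom_id shom_comp.
End Obj.

Section Mor.
Context (M M' N N' : pmod k Q).

Section Def.
Context (f : pmor M' M) (g : pmor N N').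
Fact shom_mor_linear q :
  linear (fun u : shom M N q =>
    pmcomp (restr_mor q g) (pmcomp u (restr_mor q f)) : shom M' N' q).
Proof. by move=> a u v; rewrite pmcompDl pmcompZl pmcompDr pmcompZr. Qed.
Fact shom_mor_nat q q' (h : (q <= q')%O) u :
  mklin (@shom_mor_linear q') (pm_map (shom M N) h u) =
  pm_map (shom M' N') h (mklin (@shom_mor_linear q) u).
Proof. exact: pmorP. Qed.
Definition shom_mor : pmor (shom M N) (shom M' N') :=
  mkpmor (M := shom M N) (N := shom M' N')
    (f := fun q => mklin (@shom_mor_linear q)) shom_mor_nat.
End Def.

Lemma shom_mor0f (g : pmor N N') : shom_mor (0 : pmor M' M) g = 0.
Proof.
apply: pmorP => q u.
rewrite -[LHS]/(pmcomp (restr_mor q g) (pmcomp u (restr_mor q (0 : pmor M' M)))).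
have -> : restr_mor q (0 : pmor M' M) = 0 by exact: pmorP.
by rewrite !pmcompf0.
Qed.

End Mor.
End SheafHom.

Section InternalHom.
Context (k : fieldType) (d : Order.disp_t) (P : porderType d).

Definition pi1 (x : (P *p P)%type) : P := x.1.
Fact pi1_le : {homo pi1 : x y / (x <= y)%O}.
Proof. by move=> x y; rewrite leEprod => /andP[]. Qed.
HB.instance Definition _ := Order.isOrderMorphism.Build _ _ _ _ pi1 pi1_le.

Definition pi2 (x : (P *p P)%type) : P := x.2.
Fact pi2_le : {homo pi2 : x y / (x <= y)%O}.
Proof. by move=> x y; rewrite leEprod => /andP[]. Qed.
HB.instance Definition _ := Order.isOrderMorphism.Build _ _ _ _ pi2 pi2_le.

Context (phi : {omorphism (P *p P)%type -> P}).

Definition ihom (M N : pmod k P) : pmod k P :=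
  pushforward pi2 (shom (pullback pi1 M) (pullback phi N)).

Definition ihom_mor (M M' N N' : pmod k P) (f : pmor M' M) (g : pmor N N') :
    pmor (ihom M N) (ihom M' N') :=
  push_mor pi2 (shom_mor (pullback_mor pi1 f) (pullback_mor phi g)).

Lemma ihom_mor_id M N : ihom_mor (pid M) (pid N) = pid (ihom M N).
Proof.
apply: pmorP => p s; apply: val_inj; apply: functional_extensionality_dep => x.
exact: pmorP.
Qed.

Lemma ihom_mor_comp M M' M'' N N' N'' (f : pmor M' M) (f' : pmor M'' M')
    (g : pmor N N') (g' : pmor N' N'') :
  pmcomp (ihom_mor f' g') (ihom_mor f g) = ihom_mor (pmcomp f f') (pmcomp g' g).
Proof.
apply: pmorP => p s; apply: val_inj; apply: functional_extensionality_dep => x.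
exact: pmorP.
Qed.

Lemma ihom_mor0f M M' N N' (g : pmor N N') : ihom_mor (0 : pmor M' M) g = 0.
Proof.
apply: pmorP => p s; apply: val_inj; apply: functional_extensionality_dep => x.
rewrite -[LHS]/(shom_mor (pullback_mor pi1 (0 : pmor M' M)) (pullback_mor phi g)
  (sval x) (val s x)).
have -> : pullback_mor pi1 (0 : pmor M' M) = 0 by exact: pmorP.
by rewrite shom_mor0f.
Qed.

Lemma ihom_morf0 M M' N N' (f : pmor M' M) : ihom_mor f (0 : pmor N N') = 0.
Proof.
apply: pmorP => p s; apply: val_inj; apply: functional_extensionality_dep => x.
exact: pmorP.
Qed.

End InternalHom.

Section Complexes.
Context (k : fieldType) (d : Order.disp_t) (P : porderType d).

(* X_{n-1}, with X_{-1} = 0: complexes are indexed by nat and vanish elsewhere *)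
Definition prev_term (X : nat -> pmod k P) (n : nat) : pmod k P :=
  if n is m.+1 then X m else pzero k P.

Record chain := Chain {
  ch_obj :> nat -> pmod k P;
  ch_d : forall n, pmor (ch_obj n.+1) (ch_obj n);
  ch_dd : forall n, pmcomp (ch_d n) (ch_d n.+1) = 0 }.

Definition ch_out (K : chain) n : pmor (K n) (prev_term K n) :=
  match n return pmor (K n) (prev_term K n) with
  | 0 => 0
  | m.+1 => ch_d K m
  end.

Definition hlgy (K : chain) n : pmod k P := homology (ch_d K n) (ch_out K n).
Definition ch_bnd (K : chain) n : pmod k P := pim (ch_d K n).

Record chain_map (K K' : chain) := ChainMap {
  cm_fun :> forall n, pmor (K n) (K' n);
  cm_comm : forall n, pmcomp (ch_d K' n) (cm_fun n.+1) = pmcomp (cm_fun n) (ch_d K n) }.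

Definition prev_mor (X Y : nat -> pmod k P) (f : forall n, pmor (X n) (Y n)) n :
    pmor (prev_term X n) (prev_term Y n) :=
  match n return pmor (prev_term X n) (prev_term Y n) with
  | 0 => 0
  | m.+1 => f m
  end.

Fact cm_out K K' (f : chain_map K K') n :
  pmcomp (ch_out K' n) (f n) = pmcomp (prev_mor f n) (ch_out K n).
Proof. by case: n => [|n]; [rewrite /= !pmcomp0f|exact: cm_comm]. Qed.

Definition hlgy_mor K K' (f : chain_map K K') n : pmor (hlgy K n) (hlgy K' n) :=
  homology_mor (cm_comm f n) (cm_out f n).

(* A negative complex, indexed by L^q := L_{-q} for q >= 0 *)
Record cochain := Cochain {
  co_obj :> nat -> pmod k P;
  co_d : forall n, pmor (co_obj n) (co_obj n.+1);
  co_dd : forall n, pmcomp (co_d n.+1) (co_d n) = 0 }.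

Definition co_in (L : cochain) n : pmor (prev_term L n) (L n) :=
  match n return pmor (prev_term L n) (L n) with
  | 0 => 0
  | m.+1 => co_d L m
  end.

Definition cohlgy (L : cochain) n : pmod k P := homology (co_in L n) (co_d L n).
Definition co_bnd (L : cochain) n : pmod k P := pim (co_in L n).

Record cochain_map (L L' : cochain) := CochainMap {
  com_fun :> forall n, pmor (L n) (L' n);
  com_comm : forall n, pmcomp (co_d L' n) (com_fun n) = pmcomp (com_fun n.+1) (co_d L n) }.

Fact com_in L L' (g : cochain_map L L') n :
  pmcomp (co_in L' n) (prev_mor g n) = pmcomp (g n) (co_in L n).
Proof. by case: n => [|n]; [rewrite /= !pmcompf0|exact: com_comm]. Qed.

Definition cohlgy_mor L L' (g : cochain_map L L') n : pmor (cohlgy L n) (cohlgy L' n) :=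
  homology_mor (com_in g n) (com_comm g n).

End Complexes.

Section Resolution.
Context (k : fieldType) (d : Order.disp_t) (P : porderType d).
Implicit Types M N : pmod k P.

Definition is_proj_resolution M (Q : chain k P) (aug : pmor (Q 0) M) : Prop :=
  [/\ forall n, projective_pm (Q n), pepi aug, exact_at (ch_d Q 0) aug &
      forall n, exact_at (ch_d Q n.+1) (ch_d Q n)].

Section FreeLift.
Context (T : choiceType) (V : lmodType k) (f : T -> V).
Fact fglift_linear : linear (fglift f).
Proof.
have fgB : {morph fglift f : x y / x - y} by exact: lift_is_additive.
have fg0 : fglift f 0 = 0 by rewrite -[X in fglift f X](subrr 0) fgB subrr.
have fgN x : fglift f (- x) = - fglift f x by rewrite -sub0r fgB fg0 sub0r.
have fgD : {morph fglift f : x y / x + y}.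
  by move=> x y; rewrite -[y in LHS]opprK fgB fgN opprK.
have fgS (r : seq T) (F : T -> {freeg T / k}) :
  fglift f (\sum_(x <- r) F x) = \sum_(x <- r) fglift f (F x).
  exact: (big_morph _ fgD fg0).
move=> a x y; rewrite fgD; congr (_ + _).
rewrite -[in RHS](freeg_sumE x) fgS scaler_sumr.
rewrite -[a *: x]/(fgscale a x) /fgscale fgS.
by apply: eq_bigr => t _; rewrite !liftU scalerA.
Qed.
Definition free_lift : {linear {freeg T / k} -> V} := mklin fglift_linear.
Lemma free_liftU x : free_lift << x >> = f x.
Proof. by rewrite -[LHS]/(fglift f << x >>) liftU scale1r. Qed.
End FreeLift.

Lemma free_ext (T : choiceType) (V : lmodType k) (f g : {linear {freeg T / k} -> V}) :
  (forall x, f << x >> = g << x >>) -> f =1 g.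
Proof.
move=> fg x; rewrite -(freeg_sumE x) !linear_sum; apply: eq_bigr => t _.
have -> : << coeff t x *g t >> = coeff t x *: (<< t >> : {freeg T / k}).
  by apply/eqP/freeg_eqP => u; rewrite coeffZ !coeffU mul1r.
by rewrite !linearZ fg.
Qed.

Section Free.
Context (M : pmod k P).

(* The free persistence module with one generator in degree p for every x in
   M_p: in degree q it is spanned by the pairs (p, x) with p <= q. *)
Definition gen (q : P) : Type := {s : {p : P & M p} | (tag s <= q)%O}.
HB.instance Definition _ q := Choice.on (gen q).
Definition mkgen p q (h : (p <= q)%O) (x : M p) : gen q :=
  exist _ (Tagged (fun p => M p) x) h.
Definition gen_widen q q' (h : (q <= q')%O) (s : gen q) : gen q' :=
  exist _ (sval s) (le_trans (proj2_sig s) h).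

Definition pfree_obj q : lmodType k := {freeg (gen q) / k}.
Definition pfree_map q q' (h : (q <= q')%O) : {linear pfree_obj q -> pfree_obj q'} :=
  free_lift (fun s => << gen_widen h s >>).
Fact pfree_id q (h : (q <= q)%O) x : pfree_map h x = x.
Proof.
rewrite -[RHS]/(idlin _ x); apply: free_ext => s; rewrite free_liftU.
by congr << _ >>; apply: val_inj.
Qed.
Fact pfree_comp q q' q'' (h1 : (q <= q')%O) (h2 : (q' <= q'')%O) (h3 : (q <= q'')%O) x :
  pfree_map h2 (pfree_map h1 x) = pfree_map h3 x.
Proof.
rewrite -[LHS]/((pfree_map h2 \o pfree_map h1) x); apply: free_ext => s.
rewrite -[LHS]/(pfree_map h2 (pfree_map h1 _)) !free_liftU.
congr << _ >>; exact: val_inj.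
Qed.
Definition pfree : pmod k P := Pmod pfree_id pfree_comp.

Section Lift.
Context (N : pmod k P) (f : forall p, M p -> N p).
Definition pfree_lift_lin q : {linear pfree q -> N q} :=
  free_lift (fun s : gen q => pm_map N (proj2_sig s) (f (tagged (sval s)))).
Fact pfree_lift_nat q q' (h : (q <= q')%O) x :
  pfree_lift_lin q' (pm_map pfree h x) = pm_map N h (pfree_lift_lin q x).
Proof.
rewrite -[LHS]/((pfree_lift_lin q' \o pfree_map h) x).
rewrite -[RHS]/((pm_map N h \o pfree_lift_lin q) x).
apply: free_ext => s.
rewrite -[LHS]/(pfree_lift_lin q' (pfree_map h _)) -[RHS]/(pm_map N h (pfree_lift_lin q _)).
rewrite !free_liftU; exact: esym (pm_comp _ _ _ _).
Qed.
Definition pfree_lift : pmor pfree N := mkpmor pfree_lift_nat.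
Lemma pfree_liftE p q (h : (p <= q)%O) (x : M p) :
  pfree_lift q << mkgen h x >> = pm_map N h (f x).
Proof. exact: free_liftU. Qed.
End Lift.

Lemma pfree_ext N (f g : pmor pfree N) :
  (forall p x, f p << mkgen (lexx p) x >> = g p << mkgen (lexx p) x >>) -> f = g.
Proof.
move=> fg; apply: pmorP => q.
have E := @free_ext (gen q) (N q) (pmor_fun f (p := q) : {linear pfree q -> N q})
  (pmor_fun g (p := q) : {linear pfree q -> N q}).
refine (E _) => -[[p x] h] {E}.
have -> : << exist _ (Tagged (fun p => M p) x) h >> =
    pm_map pfree h << mkgen (lexx p) x >> :> pfree q.
  by rewrite -[RHS]/(pfree_map h _) free_liftU; congr << _ >>; apply: val_inj.
rewrite -[LHS]/(f q (pm_map pfree h _)) -[RHS]/(g q (pm_map pfree h _)).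
by rewrite !pmor_nat fg.
Qed.

Lemma pfree_projective : projective_pm pfree.
Proof.
move=> A B e f epi_e.
have pre p (x : M p) : {a : A p | e p a = f p << mkgen (lexx p) x >>}.
  exact/cid/epi_e.
exists (pfree_lift (fun p x => sval (pre p x))); apply: pfree_ext => p x.
by rewrite pmcompE pfree_liftE pm_id; case: (pre p x).
Qed.

Definition pcover : pmor pfree M := pfree_lift (fun _ x => x).
Lemma pcover_epi : pepi pcover.
Proof. by move=> p x; exists << mkgen (lexx p) x >>; rewrite pfree_liftE pm_id. Qed.

End Free.

Definition pfree_mor M N (f : pmor M N) : pmor (pfree M) (pfree N) :=
  pfree_lift (fun p x => << mkgen (M := N) (lexx p) (f p x) >> : pfree N p).

Lemma pcover_nat M N (f : pmor M N) :
  pmcomp (pcover N) (pfree_mor f) = pmcomp f (pcover M).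
Proof.
apply: pfree_ext => p x; rewrite !pmcompE !pfree_liftE !pm_id.
by rewrite pfree_liftE pm_id.
Qed.

Fixpoint syz M n : pmod k P := if n is m.+1 then pker (pcover (syz M m)) else M.

Fixpoint syz_mor M N (f : pmor M N) n : pmor (syz M n) (syz N n) :=
  match n return pmor (syz M n) (syz N n) with
  | 0 => f
  | m.+1 => pker_mor (pcover_nat (syz_mor f m))
  end.

Section Standard.
Context (M : pmod k P).
Definition res_d n : pmor (pfree (syz M n.+1)) (pfree (syz M n)) :=
  pmcomp (pker_in (pcover (syz M n))) (pcover (syz M n.+1)).
Fact res_dd n : pmcomp (res_d n) (res_d n.+1) = 0.
Proof.
apply: pmorP => p x; rewrite !pmcompE.
have -> : pcover (syz M n.+1) p (pker_in (pcover (syz M n.+1)) p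
    (pcover (syz M n.+2) p x)) = 0.
  exact: (subspP (S := kerv _) (pcover (syz M n.+2) p x)).
by rewrite linear0.
Qed.
Definition res : chain k P := Chain res_dd.

Lemma resP : @is_proj_resolution M res (pcover M).
Proof.
have ex n : exact_at (res_d n) (pcover (syz M n)).
  move=> p y; split=> [h|[x <-]].
    have [x xy] := pcover_epi (M := syz M n.+1) (p := p)
      (insubsp (S := kerv (pmor_fun (pcover (syz M n)) (p := p))) h).
    by exists x; rewrite pmcompE xy.
  exact: (subspP (S := kerv _) (pcover (syz M n.+1) p x)).
split=> [n|||n]; [exact: pfree_projective|exact: pcover_epi|exact: (ex 0)|].
move=> p y; have [ex1 ex2] := ex n.+1 p y; split=> h.
  by apply: ex1; apply: val_inj; rewrite -[LHS]/(res_d n p y).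
by rewrite -[LHS]/(pker_in _ p (pcover (syz M n.+1) p y)) ex2 // linear0.
Qed.
End Standard.

Fact res_mor_comm M N (f : pmor M N) n :
  pmcomp (ch_d (res N) n) (pfree_mor (syz_mor f n.+1)) =
  pmcomp (pfree_mor (syz_mor f n)) (ch_d (res M) n).
Proof.
rewrite -[LHS]pmcompA pcover_nat !pmcompA; congr (pmcomp _ _).
exact: pmorP.
Qed.
Definition res_mor M N (f : pmor M N) : chain_map (res M) (res N) :=
  ChainMap (K := res M) (K' := res N) (cm_fun := fun n => pfree_mor (syz_mor f n))
    (res_mor_comm f).

End Resolution.

Section Kunneth.
Context (k : fieldType) (d : Order.disp_t) (P : porderType d).
Context (phi : {omorphism (P *p P)%type -> P}).

Section IhomComplex.
Context (Q : chain k P) (N : pmod k P).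
Definition ihom_d n : pmor (ihom phi (Q n) N) (ihom phi (Q n.+1) N) :=
  ihom_mor phi (ch_d Q n) (pid N).
Fact ihom_dd n : pmcomp (ihom_d n.+1) (ihom_d n) = 0.
Proof. by rewrite ihom_mor_comp ch_dd ihom_mor0f. Qed.
Definition ihom_complex : cochain k P := Cochain ihom_dd.
End IhomComplex.

Fact ihom_complex_comm Q Q' N N' (f : chain_map Q' Q) (g : pmor N N') n :
  pmcomp (co_d (ihom_complex Q' N') n) (ihom_mor phi (f n) g) =
  pmcomp (ihom_mor phi (f n.+1) g) (co_d (ihom_complex Q N) n).
Proof. by rewrite !ihom_mor_comp cm_comm pmcomp1f pmcompf1. Qed.
Definition ihom_complex_mor Q Q' N N' (f : chain_map Q' Q) (g : pmor N N') :
    cochain_map (ihom_complex Q N) (ihom_complex Q' N') :=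
  CochainMap (L := ihom_complex Q N) (L' := ihom_complex Q' N')
    (com_fun := fun n => ihom_mor phi (f n) g) (ihom_complex_comm f g).

(* The right derived functors of ihom phi, computed with the functorial
   projective resolution res M (see resP). *)
Definition Ext (i : nat) (M N : pmod k P) : pmod k P :=
  cohlgy (ihom_complex (res M) N) i.
Definition Ext_mor i M M' N N' (f : pmor M' M) (g : pmor N N') :
    pmor (Ext i M N) (Ext i M' N') :=
  cohlgy_mor (ihom_complex_mor (res_mor f) g) i.

(* Pairs (i, j) with i + j = n, and with i + j = n - 1 *)
Definition bideg (n : nat) : Type := {ij : nat * nat | ij.1 + ij.2 == n}%N.
Definition bideg_pred (n : nat) : Type := {ij : nat * nat | (ij.1 + ij.2).+1 == n}%N.

Section Total.
Context (K : chain k P) (L : cochain k P).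

Definition tot_obj n : pmod k P :=
  pprod (fun pq : bideg n => ihom phi (K (sval pq).1) (L (sval pq).2)).
Definition tot_proj n p q (e : (p + q == n)%N) : pmor (tot_obj n) (ihom phi (K p) (L q)) :=
  pproj (fun pq : bideg n => ihom phi (K (sval pq).1) (L (sval pq).2)) (exist _ (p, q) e).

Definition tot_dK n p q : (p + q == n.+1)%N -> pmor (tot_obj n) (ihom phi (K p) (L q)) :=
  match p return (p + q == n.+1)%N -> pmor (tot_obj n) (ihom phi (K p) (L q)) with
  | 0 => fun=> 0
  | p'.+1 => fun e =>
      (-1) ^+ (p' + q + 1)%N *:
        pmcomp (ihom_mor phi (ch_d K p') (pid (L q))) (tot_proj (p := p') (q := q) e)
  end.

Fact bideg_shift p q n : (p + q.+1 == n.+1 -> p + q == n)%N.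
Proof. by rewrite addnS. Qed.

Definition tot_dL n p q : (p + q == n.+1)%N -> pmor (tot_obj n) (ihom phi (K p) (L q)) :=
  match q return (p + q == n.+1)%N -> pmor (tot_obj n) (ihom phi (K p) (L q)) with
  | 0 => fun=> 0
  | q'.+1 => fun e =>
      pmcomp (ihom_mor phi (pid (K p)) (co_d L q')) (tot_proj (bideg_shift e))
  end.

Definition tot_d n : pmor (tot_obj n) (tot_obj n.+1) :=
  ptuple (fun pq : bideg n.+1 => tot_dK (proj2_sig pq) + tot_dL (proj2_sig pq)).

Lemma tot_proj_d n p q (e : (p + q == n.+1)%N) :
  pmcomp (tot_proj e) (tot_d n) = tot_dK e + tot_dL e.
Proof. exact: pmorP. Qed.

Fact tot_dd n : pmcomp (tot_d n.+1) (tot_d n) = 0.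
Proof.
apply: pprod_ext => -[[p q] e]; rewrite pmcompf0 pmcompA.
rewrite -/(tot_proj e) tot_proj_d pmcompDl.
have -> : pmcomp (tot_dK e) (tot_d n) =
    match p return (p + q == n.+2)%N -> pmor (tot_obj n) (ihom phi (K p) (L q)) with
    | 0 => fun=> 0
    | p'.+1 => fun e => (-1) ^+ (p' + q + 1)%N *:
        pmcomp (ihom_mor phi (ch_d K p') (pid (L q))) (tot_dL (p := p') (q := q) e)
    end e.
  case: p e => [|p] e /=; first by rewrite pmcomp0f.
  rewrite pmcompZl -pmcompA tot_proj_d pmcompDr.
  suff -> : pmcomp (ihom_mor phi (ch_d K p) (pid (L q))) (tot_dK (p := p) (q := q) (n := n) e) = 0.
    by rewrite add0r.
  case: p e => [|p] e /=; first by rewrite pmcompf0.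
  by rewrite pmcompZr pmcompA ihom_mor_comp ch_dd ihom_mor0f pmcomp0f scaler0.
case: q e => [|q] e /=.
  by rewrite pmcomp0f addr0; case: p e => [|p] e //; rewrite pmcompf0 scaler0.
rewrite -pmcompA tot_proj_d pmcompDr.
have -> : pmcomp (ihom_mor phi (pid (K p)) (co_d L q)) (tot_dL (bideg_shift e)) = 0.
  case: q e => [|q] e /=; first by rewrite pmcompf0.
  by rewrite pmcompA ihom_mor_comp co_dd ihom_morf0 pmcomp0f.
rewrite addr0.
case: p e => [|p] e /=; first by rewrite pmcompf0 addr0.
rewrite pmcompZr !pmcompA !ihom_mor_comp !pmcomp1f !pmcompf1.
set u := ihom_mor _ _ _.
have irr a b (e1 e2 : (p + q == n)%N) : a = - b ->
    a *: pmcomp u (tot_proj e1) + b *: pmcomp u (tot_proj e2) = 0.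
  by rewrite (bool_irrelevance e1 e2) => ->; rewrite scaleNr addNr.
by apply: irr; rewrite [(p + q.+1)%N]addnS addSn exprS mulN1r.
Qed.

Definition tot : cochain k P := Cochain tot_dd.

End Total.

Section TotalMap.
Context (K K' : chain k P) (L L' : cochain k P).
Context (f : chain_map K' K) (g : cochain_map L L').

Definition tot_mor n : pmor (tot K L n) (tot K' L' n) :=
  pprod_mor (fun pq : bideg n => ihom_mor phi (f (sval pq).1) (g (sval pq).2)).

Lemma tot_proj_mor n p q (e : (p + q == n)%N) :
  pmcomp (tot_proj K' L' e) (tot_mor n) =
  pmcomp (ihom_mor phi (f p) (g q)) (tot_proj K L e).
Proof. exact: pmorP. Qed.

Fact tot_mor_comm n :
  pmcomp (co_d (tot K' L') n) (tot_mor n) = pmcomp (tot_mor n.+1) (co_d (tot K L) n).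
Proof.
rewrite -[co_d (tot K' L') n]/(tot_d K' L' n) -[co_d (tot K L) n]/(tot_d K L n).
apply: pprod_ext => -[[p q] e]; rewrite !pmcompA.
rewrite -/(tot_proj K' L' e) tot_proj_d -/(tot_mor n.+1) tot_proj_mor -pmcompA tot_proj_d.
rewrite pmcompDl pmcompDr; congr (_ + _).
  case: p e => [|p] e /=; first by rewrite pmcomp0f pmcompf0.
  rewrite pmcompZl pmcompZr -pmcompA tot_proj_mor !pmcompA !ihom_mor_comp.
  by rewrite cm_comm pmcomp1f pmcompf1.
case: q e => [|q] e /=; first by rewrite pmcomp0f pmcompf0.
by rewrite -pmcompA tot_proj_mor !pmcompA !ihom_mor_comp com_comm pmcomp1f pmcompf1.
Qed.

Definition tot_cochain_map : cochain_map (tot K L) (tot K' L') :=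
  CochainMap (L := tot K L) (L' := tot K' L') (com_fun := tot_mor) tot_mor_comm.

End TotalMap.
End Kunneth.

Section KunnethSequence.
Context (k : fieldType) (d : Order.disp_t) (P : porderType d).
Context (phi : {omorphism (P *p P)%type -> P}).

Definition proj_with_bnd (K : chain k P) : Prop :=
  (forall n, projective_pm (K n)) /\ (forall n, projective_pm (ch_bnd K n)).
Definition inj_with_bnd (L : cochain k P) : Prop :=
  (forall n, injective_pm (L n)) /\ (forall n, injective_pm (co_bnd L n)).

Definition ext_term (n : nat) (K : chain k P) (L : cochain k P) : pmod k P :=
  pprod (fun ij : bideg_pred n => Ext phi 1 (hlgy K (sval ij).1) (cohlgy L (sval ij).2)).
Definition mid_term (n : nat) (K : chain k P) (L : cochain k P) : pmod k P :=
  cohlgy (tot phi K L) n.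
Definition hom_term (n : nat) (K : chain k P) (L : cochain k P) : pmod k P :=
  pprod (fun ij : bideg n => ihom phi (hlgy K (sval ij).1) (cohlgy L (sval ij).2)).

Section Mor.
Context (n : nat) (K K' : chain k P) (L L' : cochain k P).
Context (f : chain_map K' K) (g : cochain_map L L').

Definition ext_term_mor : pmor (ext_term n K L) (ext_term n K' L') :=
  pprod_mor (fun ij : bideg_pred n =>
    Ext_mor phi 1 (hlgy_mor f (sval ij).1) (cohlgy_mor g (sval ij).2)).
Definition mid_term_mor : pmor (mid_term n K L) (mid_term n K' L') :=
  cohlgy_mor (tot_cochain_map phi f g) n.
Definition hom_term_mor : pmor (hom_term n K L) (hom_term n K' L') :=
  pprod_mor (fun ij : bideg n =>
    ihom_mor phi (hlgy_mor f (sval ij).1) (cohlgy_mor g (sval ij).2)).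
End Mor.

(* Naturality is with respect to all chain maps K' -> K between complexes that
   satisfy the projectivity hypothesis, and all chain maps L -> L'. *)
Record kunneth_ses (n : nat) := KunnethSES {
  ses_in : forall K, proj_with_bnd K -> forall L, pmor (ext_term n K L) (mid_term n K L);
  ses_out : forall K, proj_with_bnd K -> forall L, pmor (mid_term n K L) (hom_term n K L);
  ses_exact : forall K (hK : proj_with_bnd K) L, short_exact (ses_in hK L) (ses_out hK L);
  ses_in_nat : forall K (hK : proj_with_bnd K) K' (hK' : proj_with_bnd K') L L'
      (f : chain_map K' K) (g : cochain_map L L'),
    pmcomp (mid_term_mor n f g) (ses_in hK L) = pmcomp (ses_in hK' L') (ext_term_mor n f g);
  ses_out_nat : forall K (hK : proj_with_bnd K) K' (hK' : proj_with_bnd K') L L'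
      (f : chain_map K' K) (g : cochain_map L L'),
    pmcomp (hom_term_mor n f g) (ses_out hK L) = pmcomp (ses_out hK' L') (mid_term_mor n f g) }.

Definition splits_when_injective (n : nat) (S : kunneth_ses n) : Prop :=
  forall K (hK : proj_with_bnd K) L, inj_with_bnd L ->
  exists s : pmor (hom_term n K L) (mid_term n K L), pmcomp (ses_out S hK L) s = pid _.

Definition splits_naturally (n : nat) (S : kunneth_ses n) : Prop :=
  exists s : forall K, proj_with_bnd K -> forall L, inj_with_bnd L ->
      pmor (hom_term n K L) (mid_term n K L),
    (forall K (hK : proj_with_bnd K) L (hL : inj_with_bnd L),
       pmcomp (ses_out S hK L) (s K hK L hL) = pid _) /\
    (forall K (hK : proj_with_bnd K) K' (hK' : proj_with_bnd K')
        L (hL : inj_with_bnd L) L' (hL' : inj_with_bnd L')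
        (f : chain_map K' K) (g : cochain_map L L'),
       pmcomp (mid_term_mor n f g) (s K hK L hL) =
       pmcomp (s K' hK' L' hL') (hom_term_mor n f g)).

End KunnethSequence.

(* Main.v *)
From HB Require Import structures.
Require Import Defs.
From mathcomp Require Import all_boot all_order all_algebra.
From mathcomp Require Import boolp classical_sets.

Set Implicit Arguments.
Unset Strict Implicit.
Unset Printing Implicit Defensive.

Import Order.TTheory GRing.Theory.
Local Open Scope ring_scope.

(** The internal hom is an ordinary Hom space in disguise. An element of
    [ihom phi M N] in degree [y] is a compatible family over pairs [(x, y')] with
    [y <= y'], and compatibility in the second coordinate determines it by its
    components at [(x, y)]: it is a morphism from [M] to the pullback of [N] along
    [phi (-, y)] ([ihom_ev_inj], [ihom_mkK]). Pulling back is exact, so [ihom] is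
    left exact in both variables, and exact in [N] when [M] is projective
    ([ihom_factor], [ihom_descend], [ihom_lift_exact]). From there on the argument
    is that of the Kunneth theorem for Hom.

    Write [B_p], [Z_p], [H_p] for boundaries, cycles and homology of [K], and
    [Z^q], [H^q] for cycles and cohomology of [L]. As [B_(p-1)] is projective,
    [Z_p] is a direct summand of [K_p] ([ch_retract_ex]), hence projective, and
    [0 -> B_p -> Z_p -> H_p -> 0] is a projective resolution. So the first Ext
    module of [H_p] and [N] is the cokernel of restriction from maps [Z_p -> N] to
    maps [B_p -> N] ([connecting_epi], [connecting_ker]). A cocycle of the total
    complex, restricted to [Z_p], takes values in [Z^q] and carries boundaries to
    boundaries, so it induces [H_p -> H^q]; this is [kunneth_out]. In the other
    direction a family of maps [B_i -> Z^j], composed with [K_(i+1) -> B_i], is a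
    cocycle, whose class depends only on the Ext class that the family represents;
    this is [kunneth_in]. Both maps come from universal properties
    ([pmono_factor], [pepi_descend]), so naturality is inherited from maps whose
    definition involves no choice, and exactness is a diagram chase with the
    retractions [K_p -> Z_p]. If the boundaries of [L] are injective, then
    [Z^q -> H^q] has a section; with the retraction [K_p -> Z_p] it turns a family
    of maps [H_p -> H^q] into a cocycle, and this splits the sequence
    ([kunneth_split]).

    There is no natural splitting in general, because a natural splitting forces
    every chain map that is zero on homology to act by zero on the middle term
    ([natural_splitting_kills]): it acts by zero on both outer terms. Over the
    poset [false < true], with [phi] the first projection, consider the nonsplit
    extension of the simple module at [false] by the simple module at [true]. Its
    class is a chain map from the projective resolution of the former to the
    latter placed in degree one. It is zero on homology, but it is nonzero
    on maps into the injective resolution of the simple module at [true]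
    ([mid_ext_class_neq0]). That the modules in this resolution are injective
    amounts to the extension of linear maps from subspaces, which rests on Zorn's
    lemma ([linear_extension]). *)

(** * Morphisms of persistence modules *)

Section Morphisms.
Context (k : fieldType) (d : Order.disp_t) (P : porderType d).
Implicit Types A B C M N : pmod k P.

Lemma pmor_app A B (f g : pmor A B) : f = g -> forall p x, f p x = g p x.
Proof. by move=> ->. Qed.

Lemma pmono_ker0 A B (f : pmor A B) :
  (forall p x, f p x = 0 -> x = 0) -> pmono f.
Proof.
move=> f0 p x y fxy; apply/eqP; rewrite -subr_eq0; apply/eqP/f0.
by rewrite linearB /= fxy subrr.
Qed.

Lemma pmono_cancel A B C (m : pmor B C) (f g : pmor A B) :
  pmono m -> pmcomp m f = pmcomp m g -> f = g.
Proof.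
by move=> mm fg; apply: pmorP => p x; apply: (mm p); exact: (pmor_app fg).
Qed.

Lemma pepi_cancel A B C (e : pmor A B) (f g : pmor B C) :
  pepi e -> pmcomp f e = pmcomp g e -> f = g.
Proof.
by move=> ee fg; apply: pmorP => p y; have [x <-] := ee p y; exact: (pmor_app fg).
Qed.

(** The lift is chosen pointwise; as it is unique, linearity and compatibility
    with the structure maps are inherited from [f]. *)
Lemma pmono_factor A B C (m : pmor B C) (f : pmor A C) :
  pmono m -> (forall p a, exists b, m p b = f p a) ->
  {g : pmor A B | pmcomp m g = f}.
Proof.
move=> mm fm; pose g p a : B p := sval (cid (fm p a)).
have gE p a : m p (g p a) = f p a by rewrite /g; case: cid.
have gP : is_pmor g.
  split=> [p c x y|p q h x]; apply: (mm _); first by rewrite gE !linearP /= !gE.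
  by rewrite gE !pmor_nat gE.
by exists (insubsp (S := pmor_sp A B) gP); apply: pmorP => p x; exact: gE.
Qed.

(** Dual to [pmono_factor]. These two lemmas produce every map of the Kunneth
    sequence, and each characterizes the map by an equation, from which naturality
    follows without looking at the choices. *)
Lemma pepi_descend A B C (e : pmor A B) (f : pmor A C) :
  pepi e -> (forall p a, e p a = 0 -> f p a = 0) ->
  {g : pmor B C | pmcomp g e = f}.
Proof.
move=> ee ef; pose g p b : C p := f p (sval (cid (ee p b))).
have gE p a : g p (e p a) = f p a.
  rewrite /g; case: cid => a' /= ea'; apply/eqP; rewrite -subr_eq0 -linearB.
  by apply/eqP/ef; rewrite linearB /= ea' subrr.
have gP : is_pmor g.
  split=> [p c x y|p q h x].
    have [a <-] := ee p x; have [b <-] := ee p y.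
    by rewrite -linearP /= !gE linearP.
  by have [a <-] := ee p x; rewrite -pmor_nat !gE pmor_nat.
by exists (insubsp (S := pmor_sp B C) gP); apply: pmorP => p x; exact: gE.
Qed.

Lemma pker_in_mono A B (f : pmor A B) : pmono (pker_in f).
Proof. by move=> p x y; exact: val_inj. Qed.

Lemma pker_inP A B (f : pmor A B) p (a : A p) :
  f p a = 0 -> exists z : pker f p, pker_in f p z = a.
Proof. by move=> fa; exists (insubsp (S := kerv _) fa). Qed.

Lemma pker_in0 A B (f : pmor A B) : pmcomp f (pker_in f) = 0.
Proof. by apply: pmorP => p z; exact: (subspP (S := kerv _) z). Qed.

Lemma pker_in_morE A B A' B' (f : pmor A B) (f' : pmor A' B') a b
    (sq : pmcomp f' a = pmcomp b f) :
  pmcomp (pker_in f') (pker_mor sq) = pmcomp a (pker_in f).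
Proof. exact: pmorP. Qed.

Lemma pker_factor A B C (f : pmor B C) (g : pmor A B) :
  pmcomp f g = 0 -> {h : pmor A (pker f) | pmcomp (pker_in f) h = g}.
Proof.
move=> fg; apply: pmono_factor; first exact: pker_in_mono.
by move=> p a; apply: pker_inP; exact: (pmor_app fg).
Qed.

Fact pim_in_linear A B (f : pmor A B) p : linear (fun y : pim f p => val y : B p).
Proof. by []. Qed.
Definition pim_in A B (f : pmor A B) : pmor (pim f) B :=
  mkpmor (f := fun p => mklin (@pim_in_linear A B f p)) (fun _ _ _ _ => erefl).

Lemma pim_in_mono A B (f : pmor A B) : pmono (pim_in f).
Proof. by move=> p x y; exact: val_inj. Qed.

Lemma pim_inP A B (f : pmor A B) p (y : pim f p) : exists a, f p a = pim_in f p y.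
Proof. exact: (subspP (S := imv _) y). Qed.

Lemma pim_co_subproof A B (f : pmor A B) :
  {g : pmor A (pim f) | pmcomp (pim_in f) g = f}.
Proof.
apply: pmono_factor; first exact: pim_in_mono.
move=> p a; have h : imv (pmor_fun f (p := p)) (f p a) by exists a.
by exists (insubsp (S := imv _) h).
Qed.
Definition pim_co A B (f : pmor A B) := sval (pim_co_subproof f).
Lemma pim_in_co A B (f : pmor A B) : pmcomp (pim_in f) (pim_co f) = f.
Proof. by rewrite /pim_co; case: pim_co_subproof. Qed.

Lemma pim_co_epi A B (f : pmor A B) : pepi (pim_co f).
Proof.
move=> p y; have [a fa] := pim_inP y; exists a; apply: (@pim_in_mono _ _ f).
by rewrite -fa; exact: (pmor_app (pim_in_co f)).
Qed.

Lemma pim_mor A B A' B' (f : pmor A B) (f' : pmor A' B') (a : pmor A A') (b : pmor B B') :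
  pmcomp f' a = pmcomp b f ->
  {c : pmor (pim f) (pim f') |
    pmcomp (pim_in f') c = pmcomp b (pim_in f) &
    pmcomp c (pim_co f) = pmcomp (pim_co f') a}.
Proof.
move=> sq; have [|p y|c cE] := @pmono_factor _ _ _ (pim_in f') (pmcomp b (pim_in f)).
- exact: pim_in_mono.
- have [x xy] := pim_inP y; exists (pim_co f' p (a p x)).
  by rewrite -pmcompE pim_in_co pmcompE -xy; exact: (pmor_app sq).
exists c => //; apply: (pmono_cancel (m := pim_in f')); first exact: pim_in_mono.
by rewrite !pmcompA cE -pmcompA !pim_in_co sq.
Qed.

Section HomologyClass.
Context A B C (f : pmor A B) (g : pmor B C).

Fact hclass_nat p q (h : (p <= q)%O) (z : pker g p) :
  mklin (@quotv_pi_linear _ _ (bnd_sp f g q)) (pm_map (pker g) h z) =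
  pm_map (homology f g) h (mklin (@quotv_pi_linear _ _ (bnd_sp f g p)) z).
Proof. by apply: esym; exact: quotv_mapE. Qed.
Definition hclass : pmor (pker g) (homology f g) :=
  mkpmor (M := pker g) (N := homology f g)
    (f := fun p => mklin (@quotv_pi_linear _ _ (bnd_sp f g p))) hclass_nat.

Lemma hclass_epi : pepi hclass.
Proof. by move=> p y; exists (quotv_repr y); exact: quotv_reprK. Qed.

Lemma hclass_eq0 p (z : pker g p) :
  hclass p z = 0 <-> exists a, f p a = pker_in g p z.
Proof.
have -> : (0 : homology f g p) = quotv_pi (bnd_sp f g p) 0.
  exact: esym (linear0 (mklin (@quotv_pi_linear _ _ (bnd_sp f g p)))).
by rewrite -[hclass p z]/(quotv_pi (bnd_sp f g p) z) quotv_eq subr0.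
Qed.

End HomologyClass.

Lemma hclass_mor A B C (f : pmor A B) (g : pmor B C) A' B' C' (f' : pmor A' B')
    (g' : pmor B' C') a b c (sqf : pmcomp f' a = pmcomp b f)
    (sqg : pmcomp g' b = pmcomp c g) :
  pmcomp (homology_mor sqf sqg) (hclass f g) = pmcomp (hclass f' g') (pker_mor sqg).
Proof.
by apply: pmorP => p z; exact: (quotv_mapE (@homology_mor_stable _ _ _ _ _ _ _ _ _ _ _ _ _ _ _ _ sqf sqg p)).
Qed.

(** [homology f g] divides [ker g] by its intersection with [im f]; as
    [g f = 0], this intersection is all of [im f]. *)
Lemma bnd_cyc A B C (f : pmor A B) (g : pmor B C) : pmcomp g f = 0 ->
  {j : pmor (pim f) (pker g) | pmcomp (pker_in g) j = pim_in f}.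
Proof.
move=> gf; apply: pker_factor; apply: pmorP => p y.
by have [a] := pim_inP y; rewrite pmcompE => <-; exact: (pmor_app gf).
Qed.

Lemma bnd_cyc_exact A B C (f : pmor A B) (g : pmor B C) (j : pmor (pim f) (pker g)) :
  pmcomp (pker_in g) j = pim_in f -> short_exact j (hclass f g).
Proof.
move=> jE; split; last exact: hclass_epi.
  apply: pmono_ker0 => p y jy; apply: (@pim_in_mono _ _ f).
  by rewrite linear0 -jE pmcompE jy linear0.
move=> p z; rewrite hclass_eq0; split=> [[a fa]|[y <-]].
  exists (pim_co f p a); apply: (@pker_in_mono _ _ g).
  by rewrite -[LHS]/(pmcomp (pker_in g) j p _) jE -fa; exact: (pmor_app (pim_in_co f)).
have [a fa] := pim_inP y; exists a.
by rewrite fa -jE.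
Qed.

Lemma retract_projective M N (i : pmor N M) (r : pmor M N) :
  pmcomp r i = pid N -> projective_pm M -> projective_pm N.
Proof.
move=> ri pM A B e f ee; have [g gE] := pM A B e (pmcomp f r) ee.
by exists (pmcomp g i); rewrite pmcompA gE -pmcompA ri pmcompf1.
Qed.

Lemma retract_injective M N (i : pmor N M) (r : pmor M N) :
  pmcomp r i = pid N -> injective_pm M -> injective_pm N.
Proof.
move=> ri iM A B e f ee; have [g gE] := iM A B e (pmcomp i f) ee.
by exists (pmcomp r g); rewrite -pmcompA gE pmcompA ri pmcomp1f.
Qed.

End Morphisms.

(** * Elements of the internal hom as morphisms *)

Section Slice.
Context (d : Order.disp_t) (P : porderType d).
Context (phi : {omorphism (P *p P)%type -> P}).

(** In degree [y] the internal hom consists of the morphisms from [M] to the pullback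
    of [N] along this map. *)
Definition slice (y x : P) : P := phi (x, y).
Fact slice_le y : {homo slice y : a b / (a <= b)%O}.
Proof. by move=> a b h; apply: omorph_le; rewrite leEprod /= h lexx. Qed.
HB.instance Definition _ y := Order.isOrderMorphism.Build _ _ _ _ (slice y) (slice_le y).

End Slice.

Section Evaluation.
Context (k : fieldType) (d : Order.disp_t) (P : porderType d).
Context (phi : {omorphism (P *p P)%type -> P}).

Local Notation p1 := (@pi1 d P : {omorphism (P *p P)%type -> P}).
Local Notation p2 := (@pi2 d P : {omorphism (P *p P)%type -> P}).

Definition push_top (x y : P) : push_index (@pi2 d P) y :=
  exist _ ((x, y) : (P *p P)%type) (lexx y).
Definition upset_top (xy : (P *p P)%type) : upset xy := exist _ xy (lexx xy).

Section Family.
Context (M N : pmod k P) (y : P).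
Implicit Type u : ihom phi M N y.

Definition ihom_comp u (i : push_index (@pi2 d P) y) (z : upset (sval i)) :
    M (pi1 (val z)) -> N (phi (val z)) :=
  pmor_fun (val u i : pmor _ _) (p := z).
Arguments ihom_comp u {i} z m.

Lemma ihom_compE u (i i' : push_index (@pi2 d P) y) (h : (sval i <= sval i')%O)
    (z : upset (sval i')) m :
  ihom_comp u z m = ihom_comp (i := i) u (upset_widen h z) m.
Proof.
have E := subspP (S := push_sp p2 _ y) u i i' h.
by rewrite /ihom_comp -E.
Qed.

Definition ihom_ev_fun u (x : P) : M x -> N (slice phi y x) :=
  ihom_comp (i := push_top x y) u (upset_top (x, y)).

Lemma ihom_comp_nat u (i : push_index (@pi2 d P) y) (z z' : upset (sval i))
    (h : (val z <= val z')%O) m :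
  ihom_comp u z' (pm_map M (omorph_le p1 h) m) =
  pm_map N (omorph_le phi h) (ihom_comp u z m).
Proof.
have E := pmor_nat (val u i : pmor _ _) (p := z) (q := z') h m.
move: E; rewrite /ihom_comp /=.
by rewrite (bool_irrelevance (omorph_le p1 _) (omorph_le p1 h))
  (bool_irrelevance (omorph_le phi _) (omorph_le phi h)).
Qed.
(** The components at [(pi1 z, y)] determine all the others: compatibility moves the
    index from [i] up to [z] and down to [(pi1 z, y)], and between these two points
    the pullback of [M] along [pi1] is constant, so that naturality leaves only the
    structure map of [N]. *)
Lemma ihom_comp_full u (i : push_index (@pi2 d P) y) (z : upset (sval i))
    (h : (slice phi y (pi1 (val z)) <= phi (val z))%O) m :
  ihom_comp u z m = pm_map N h (ihom_ev_fun u m).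
Proof.
case: z h m => -[a b] hz h m.
have hy : (y <= b)%O by apply: le_trans (proj2_sig i) _; exact: (pi2_le hz).
pose i' : push_index (@pi2 d P) y := exist _ ((a, b) : (P *p P)%type) hy.
have hj : ((a, y) <= (a, b) :> (P *p P)%type)%O by rewrite leEprod /= lexx hy.
have -> : ihom_comp u (exist _ ((a, b) : (P *p P)%type) hz : upset (sval i)) m =
    ihom_comp (i := i) u (upset_widen hz (upset_top (a, b))) m.
  rewrite /upset_widen /=.
  by rewrite (bool_irrelevance (le_trans _ _) hz).
rewrite -(@ihom_compE u i i' hz (upset_top (a, b))).
rewrite (@ihom_compE u (push_top a y) i' hj (upset_top (a, b))).
have := @ihom_comp_nat u (push_top a y) (upset_top (a, y)) (upset_widen hj (upset_top (a, b))) hj m.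
rewrite pm_id => ->; congr (pm_map N _ _); exact: bool_irrelevance.
Qed.

Fact ihom_ev_pmor u : is_pmor (M := M) (N := pullback (slice phi y) N) (ihom_ev_fun u).
Proof.
split=> [x|x x' h m].
  exact: (pmor_linear (val u (push_top x y) : pmor _ _) (p := upset_top (x, y))).
have hj : ((x, y) <= (x', y) :> (P *p P)%type)%O by rewrite leEprod /= h lexx.
have E := @ihom_compE u (push_top x y) (push_top x' y) hj (upset_top (x', y)).
rewrite /ihom_ev_fun E.
have := @ihom_comp_nat u (push_top x y) (upset_top (x, y)) (upset_widen hj (upset_top (x', y))) hj m.
have -> : omorph_le p1 hj = h by exact: bool_irrelevance.
move=> ->; rewrite -[RHS]/(pm_map N (omorph_le (slice phi y) h) (ihom_ev_fun u m)).
by have -> : omorph_le phi hj = omorph_le (slice phi y) h by exact: bool_irrelevance.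
Qed.
Definition ihom_ev u : pmor M (pullback (slice phi y) N) :=
  insubsp (S := pmor_sp _ _) (ihom_ev_pmor u).

Fact slice_upset (i : push_index p2 y) (z : upset (sval i)) :
  (slice phi y (pi1 (val z)) <= phi (val z))%O.
Proof.
have h : ((pi1 (val z), y) <= val z :> (P *p P)%type)%O; last exact: (omorph_le phi h).
rewrite leEprod lexx /=; apply: le_trans (proj2_sig i) _.
exact: (pi2_le (proj2_sig z)).
Qed.

Lemma ihom_evD u v : ihom_ev (u + v : ihom phi M N y) = ihom_ev u + ihom_ev v.
Proof. exact: pmorP. Qed.

Lemma ihom_evZ a u : ihom_ev (a *: u : ihom phi M N y) = a *: ihom_ev u.
Proof. exact: pmorP. Qed.

Lemma ihom_ev_inj : injective ihom_ev.
Proof.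
move=> u v uv; apply: val_inj; apply: functional_extensionality_dep => i.
apply: pmorP => z m.
rewrite -[LHS]/(ihom_comp u z m) -[RHS]/(ihom_comp v z m) !(ihom_comp_full _ (slice_upset z)).
congr (pm_map N _ _).
by rewrite -[LHS]/(ihom_ev u _ m) uv.
Qed.

Section Make.
Context (f : pmor M (pullback (slice phi y) N)).

Definition ihom_mk_fun (i : push_index p2 y) (z : upset (sval i)) (m : M (pi1 (val z))) :
    N (phi (val z)) := pm_map N (slice_upset z) (f (pi1 (val z)) m).

Fact ihom_mk_pmor i :
  is_pmor (M := restr (sval i) (pullback p1 M)) (N := restr (sval i) (pullback phi N))
    (@ihom_mk_fun i).
Proof.
split=> [z a m m'|z z' h m]; first by rewrite /ihom_mk_fun !linearP.
rewrite /ihom_mk_fun.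
have := pmor_nat f (omorph_le p1 (omorph_le (upset_val (sval i)) h)) m.
rewrite -[pm_map (restr _ _) h m]/(pm_map M (omorph_le p1 (omorph_le (upset_val (sval i)) h)) m) => ->.
rewrite -[X in pm_map N _ X]/(pm_map N (omorph_le (slice phi y) _) _).
have h3 : (slice phi y (pi1 (val z)) <= phi (val z'))%O.
  apply: le_trans (slice_upset z) _; exact: omorph_le.
rewrite (pm_comp _ _ h3).
rewrite -[RHS]/(pm_map N (omorph_le phi (omorph_le (upset_val (sval i)) h)) _).
by rewrite (pm_comp _ _ h3).
Qed.

Fact ihom_mk_compatible :
  compatible (F := shom (pullback p1 M) (pullback phi N))
    (fun i : push_index p2 y => insubsp (S := pmor_sp _ _) (ihom_mk_pmor i)).
Proof.
move=> i i' h; apply: pmorP => z m; rewrite /= /pmor_fun /=.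
rewrite /ihom_mk_fun; congr (pm_map N _ _); exact: bool_irrelevance.
Qed.
Definition ihom_mk : ihom phi M N y := insubsp (S := push_sp p2 _ y) ihom_mk_compatible.

Lemma ihom_mkK : ihom_ev ihom_mk = f.
Proof.
apply: pmorP => x m.
rewrite -[LHS]/(pm_map N (slice_upset (i := push_top x y) (upset_top (x, y))) (f x m)).
exact: (@pm_id _ _ _ N (phi (x, y)) _ (f x m)).
Qed.
End Make.

End Family.

Lemma ihom_ev_mor M M' N N' (f : pmor M' M) (g : pmor N N') y (u : ihom phi M N y) :
  ihom_ev (ihom_mor phi f g y u) =
  pmcomp (pullback_mor (slice phi y) g) (pmcomp (ihom_ev u) f).
Proof. exact: pmorP. Qed.

End Evaluation.

Section Exactness.
Context (k : fieldType) (d : Order.disp_t) (P : porderType d).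
Context (phi : {omorphism (P *p P)%type -> P}).
Implicit Types M N H A B C : pmod k P.

Lemma ihom_mono M M' N N' (f : pmor M' M) (g : pmor N N') :
  pepi f -> pmono g -> pmono (ihom_mor phi f g).
Proof.
move=> fe gm y u v uv; apply: ihom_ev_inj; apply: (pepi_cancel fe).
apply: (pmono_cancel (m := pullback_mor (slice phi y) g)).
  by move=> p a b; exact: gm.
by rewrite -!ihom_ev_mor uv.
Qed.

(** Left exactness in the second variable. *)
Lemma ihom_factor M A B C (m : pmor A B) (g : pmor B C) y (u : ihom phi M B y) :
  pmono m -> exact_at m g -> ihom_mor phi (pid M) g y u = 0 ->
  exists v : ihom phi M A y, ihom_mor phi (pid M) m y v = u.
Proof.
move=> mm mg gu.
have [|p a|v vE] := @pmono_factor _ _ _ _ _ _ (pullback_mor (slice phi y) m) (ihom_ev u).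
- by move=> p a b; exact: mm.
- apply/mg.
  have := @pmor_app _ _ _ _ _ _ _ (ihom_ev_mor (pid M) g u) p a; rewrite gu => E.
  exact: esym E.
exists (ihom_mk v); apply: ihom_ev_inj.
by rewrite ihom_ev_mor ihom_mkK pmcompf1.
Qed.

(** Left exactness in the first variable. *)
Lemma ihom_descend A B H N (f : pmor A B) (e : pmor B H) y (u : ihom phi B N y) :
  pepi e -> exact_at f e -> ihom_mor phi f (pid N) y u = 0 ->
  exists v : ihom phi H N y, ihom_mor phi e (pid N) y v = u.
Proof.
move=> ee fe fu.
have [||v vE] := @pepi_descend _ _ _ _ _ _ e (ihom_ev u).
- exact: ee.
- move=> p a /fe [b <-].
  have := @pmor_app _ _ _ _ _ _ _ (ihom_ev_mor f (pid N) u) p b; rewrite fu => E.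
  exact: esym E.
exists (ihom_mk v); apply: ihom_ev_inj.
rewrite ihom_ev_mor ihom_mkK vE; exact: pmorP.
Qed.

Lemma ihom_lift M A B (e : pmor A B) :
  projective_pm M -> pepi e -> pepi (ihom_mor phi (pid M) e).
Proof.
move=> pM ee y u.
have [|v vE] := pM _ _ (pullback_mor (slice phi y) e) (ihom_ev u).
  by move=> p a; exact: ee.
exists (ihom_mk v); apply: ihom_ev_inj.
by rewrite ihom_ev_mor ihom_mkK pmcompf1.
Qed.

(** Exactness in the second variable: an element killed by [g] takes values in the
    image of [f], onto which [f] is epi. *)
Lemma ihom_lift_exact M A B C (f : pmor A B) (g : pmor B C) y (u : ihom phi M B y) :
  projective_pm M -> exact_at f g -> ihom_mor phi (pid M) g y u = 0 ->
  exists v : ihom phi M A y, ihom_mor phi (pid M) f y v = u.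
Proof.
move=> pM fg gu.
have fg' : exact_at (pim_in f) g.
  move=> p b; rewrite fg; split=> [[a <-]|[c <-]]; last exact: pim_inP.
  by exists (pim_co f p a); exact: (pmor_app (pim_in_co f)).
have [v <-] := ihom_factor (@pim_in_mono _ _ _ _ _ f) fg' gu.
have [w <-] := ihom_lift pM (@pim_co_epi _ _ _ _ _ f) v.
by exists w; rewrite -pmcompE ihom_mor_comp pmcomp1f pim_in_co.
Qed.

Lemma ihom_morDl M M' N N' (f f' : pmor M' M) (g : pmor N N') :
  ihom_mor phi (f + f') g = ihom_mor phi f g + ihom_mor phi f' g.
Proof.
apply: pmorP => y u; apply: ihom_ev_inj; rewrite ihom_ev_mor.
by rewrite pmorDE ihom_evD !ihom_ev_mor !pmcompDr.
Qed.

End Exactness.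

(** * The first Ext module from a short projective presentation *)

Section HomologyEq.
Context (k : fieldType) (d : Order.disp_t) (P : porderType d).
Context (A B C : pmod k P) (f : pmor A B) (g : pmor B C).
Lemma hclass_eq p (z z' : pker g p) :
  (exists a, pker_in g p z = pker_in g p z' + f p a) -> hclass f g p z = hclass f g p z'.
Proof.
move=> [a e]; apply/eqP; rewrite -subr_eq0 -linearB; apply/eqP/hclass_eq0.
by exists a; rewrite linearB /= e addrAC subrr add0r.
Qed.
End HomologyEq.

Section Connecting.
Context (k : fieldType) (d : Order.disp_t) (P : porderType d).
Context (phi : {omorphism (P *p P)%type -> P}).
Implicit Types B Z H N F : pmod k P.

(** Two lifts of the same map differ by a map into the kernel. This is what makes
    the constructions below independent of the choice of a comparison map. *)
Lemma lift_difference B Z H F (j : pmor B Z) (p : pmor Z H) (a a' : pmor F Z) :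
  short_exact j p -> pmcomp p a = pmcomp p a' ->
  exists c : pmor F B, a = a' + pmcomp j c.
Proof.
move=> [jm jp _] paa'.
have [y x|c cE] := @pmono_factor _ _ _ _ _ _ j (a - a') jm.
  apply/jp; rewrite pmorDE pmorNE linearB /=.
  by apply/eqP; rewrite subr_eq0; apply/eqP/(pmor_app paa').
by exists c; rewrite cE addrC subrK.
Qed.

(** A comparison of the standard resolution of [H], in its first two degrees, with
    [0 -> B -> Z -> H -> 0]. *)
Definition res_lift B Z H (j : pmor B Z) (p : pmor Z H)
    (a : pmor (res H 0) Z) (b : pmor (res H 1) B) : Prop :=
  pmcomp p a = pcover H /\ pmcomp j b = pmcomp a (res_d H 0).

Lemma pcover_res_d H : pmcomp (pcover H) (res_d H 0) = 0.
Proof. by rewrite /res_d pmcompA pker_in0 pmcomp0f. Qed.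

Lemma lift_to_kernel B Z H F F' (j : pmor B Z) (p : pmor Z H) (a : pmor F Z) (e : pmor F' F) :
  short_exact j p -> pmcomp (pmcomp p a) e = 0 ->
  exists b : pmor F' B, pmcomp j b = pmcomp a e.
Proof.
move=> [jm jp _] pae.
have [y x|b bE] := @pmono_factor _ _ _ _ _ _ j (pmcomp a e) jm; last by exists b.
by apply/jp; exact: (pmor_app pae).
Qed.

Lemma res_lift_ex B Z H (j : pmor B Z) (p : pmor Z H) : short_exact j p ->
  exists a b, res_lift j p a b.
Proof.
move=> se; have [_ _ pe] := se.
have [a aE] := @pfree_projective _ _ _ _ _ _ p (pcover H) pe.
have [|b bE] := @lift_to_kernel _ _ _ _ _ j p a (res_d H 0) se; last by exists a, b.
by rewrite aE pcover_res_d.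
Qed.

Section Connect.
Context B Z H (j : pmor B Z) (p : pmor Z H) (se : short_exact j p).
Context (a : pmor (res H 0) Z) (b : pmor (res H 1) B) (ab : res_lift j p a b).
Context N.

Lemma res_lift_d : pmcomp b (res_d H 1) = 0.
Proof.
have [jm _ _] := se; have [_ jb] := ab; apply: (pmono_cancel jm).
by rewrite pmcompA jb -pmcompA res_dd !pmcompf0.
Qed.

Lemma ihom_lift_cocycle :
  pmcomp (co_d (ihom_complex phi (res H) N) 1) (ihom_mor phi b (pid N)) = 0.
Proof. by rewrite ihom_mor_comp -/(res_d H 1) res_lift_d ihom_mor0f. Qed.

Definition connecting_cyc := sval (pker_factor ihom_lift_cocycle).
Lemma connecting_cycE : pmcomp (pker_in _) connecting_cyc = ihom_mor phi b (pid N).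
Proof. by rewrite /connecting_cyc; case: pker_factor. Qed.

(** The connecting map of the long exact sequence of Ext: composition with [b] turns
    a map on [B] into a cocycle, because [b] kills the next differential. *)
Definition connecting : pmor (ihom phi B N) (Ext phi 1 H N) := pmcomp (hclass _ _) connecting_cyc.

End Connect.

(** The two ways around the square give two lifts of the same map to [Z]. They differ
    by a map [c] into [B], and composition with [c] accounts for the difference of
    the cocycles, which is a coboundary. *)
Lemma connecting_nat B Z H (j : pmor B Z) (p : pmor Z H) (se : short_exact j p)
    a b (ab : res_lift j p a b)
    B' Z' H' (j' : pmor B' Z') (p' : pmor Z' H') (se' : short_exact j' p')
    a' b' (ab' : res_lift j' p' a' b') N N' (fB : pmor B' B) (fZ : pmor Z' Z)
    (fH : pmor H' H) (g : pmor N N') :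
  pmcomp j fB = pmcomp fZ j' -> pmcomp p fZ = pmcomp fH p' ->
  pmcomp (Ext_mor phi 1 fH g) (connecting se ab N) =
  pmcomp (connecting se' ab' N') (ihom_mor phi fB g).
Proof.
move=> sqj sqp; have [pa jb] := ab; have [pa' jb'] := ab'; have [jm _ _] := se.
have [c cE] : exists c, pmcomp a (res_mor fH 0) = pmcomp fZ a' + pmcomp j c.
  apply: (lift_difference se); rewrite !pmcompA pa sqp -pmcompA pa'.
  exact: pcover_nat.
have bE : pmcomp b (res_mor fH 1) = pmcomp fB b' + pmcomp c (res_d H' 0).
  apply: (pmono_cancel jm).
  have E : pmcomp (res_d H 0) (res_mor fH 1) = pmcomp (res_mor fH 0) (res_d H' 0).
    exact: (cm_comm (res_mor fH) 0).
  rewrite pmcompA jb -[LHS]pmcompA E pmcompA cE pmcompDl pmcompDr.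
  rewrite [in RHS]pmcompA sqj -[pmcomp (pmcomp fZ j') b']pmcompA jb'.
  by congr (_ + _); exact: pmorP.
apply: pmorP => y v; rewrite !pmcompE.
rewrite -[LHS]/(pmcomp (homology_mor _ _) (hclass _ _) y _) hclass_mor pmcompE.
apply: hclass_eq; exists (ihom_mor phi c g y v).
rewrite -[LHS]/(pmcomp (pker_in _) (pker_mor _) y _) pker_in_morE.
rewrite -[pker_in _ _ _ in RHS]/(pmcomp (pker_in _) (connecting_cyc _ _ _) y _) connecting_cycE.
rewrite pmcompE -[pker_in _ y _]/(pmcomp (pker_in _) (connecting_cyc _ _ _) y _) connecting_cycE.
rewrite -!pmcompE -[co_in _ _]/(ihom_mor phi (res_d H' 0) (pid N')) !ihom_mor_comp.
by rewrite !pmcomp1f pmcompf1 bE ihom_morDl.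
Qed.

Lemma syz_short_exact H : short_exact (pker_in (pcover H)) (pcover H).
Proof.
split; [exact: pker_in_mono| |exact: pcover_epi].
move=> p y; split=> [/pker_inP //|[x <-]].
exact: (pmor_app (pker_in0 (pcover H))).
Qed.

Lemma res_d1_exact H : exact_at (res_d H 1) (pcover (syz H 1)).
Proof.
have [_ _ _ /(_ 0) ex] := resP H; move=> p y.
split=> [yE|/ex]; last first.
  move=> E; apply: (@pker_in_mono _ _ _ _ _ (pcover H)); rewrite linear0.
  exact: E.
by apply/ex; rewrite -[LHS]/(pker_in (pcover H) p (pcover (syz H 1) p y)) yE linear0.
Qed.

Section ConnectingExact.
Context B Z H (j : pmor B Z) (p : pmor Z H) (se : short_exact j p).
Context (a : pmor (res H 0) Z) (b : pmor (res H 1) B) (ab : res_lift j p a b).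
Context (pZ : projective_pm Z).

(** A comparison in the direction opposite to [res_lift], down to the first syzygy. *)
Lemma lift_back : exists (a1 : pmor Z (res H 0)) (b1 : pmor B (syz H 1)),
  pmcomp (pcover H) a1 = p /\ pmcomp (pker_in (pcover H)) b1 = pmcomp a1 j.
Proof.
have [a1 a1E] := pZ p (@pcover_epi _ _ _ H).
have [|b1 b1E] := @lift_to_kernel _ _ _ _ _ _ _ a1 j (syz_short_exact H); last by exists a1, b1.
rewrite a1E; have [_ jp _] := se; apply: pmorP => y x; apply/jp; by exists x.
Qed.

(** A cocycle is a map on the first syzygy; its composite with [b1] is a map on [B],
    and the round trip [b1 b] is homotopic to the covering of the syzygy. *)
Lemma connecting_epi N : pepi (connecting se ab N).
Proof.
move=> y e; have [w <-] := @hclass_epi _ _ _ _ _ _ _ _ y e.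
have [pa jb] := ab; have [jm jp pe] := se.
have [a1 [b1 [a1E b1E]]] := lift_back.
have [w' w'E] : exists w' : ihom phi (syz H 1) N y,
    ihom_mor phi (pcover (syz H 1)) (pid N) y w' = pker_in _ y w.
  apply: ihom_descend; [exact: pcover_epi|exact: res_d1_exact|].
  exact: (pmor_app (pker_in0 (co_d (ihom_complex phi (res H) N) 1)) w).
have [c cE] : exists c, pmcomp a1 a = pid _ + pmcomp (pker_in (pcover H)) c.
  apply: (lift_difference (syz_short_exact H)).
  by rewrite pmcompA a1E pmcompf1.
have bE : pmcomp b1 b = pcover (syz H 1) + pmcomp c (res_d H 0).
  apply: (pmono_cancel (@pker_in_mono _ _ _ _ _ (pcover H))).
  rewrite pmcompA b1E -[LHS]pmcompA jb [LHS]pmcompA cE pmcompDl pmcompDr pmcomp1f.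
  by congr (_ + _); exact: pmorP.
exists (ihom_mor phi b1 (pid N) y w'); apply: hclass_eq.
exists (ihom_mor phi c (pid N) y w').
rewrite -[LHS]/(pmcomp (pker_in _) (connecting_cyc _ _ _) y _) connecting_cycE -w'E.
rewrite -[co_in _ _]/(ihom_mor phi (res_d H 0) (pid N)) -!pmcompE !ihom_mor_comp.
by rewrite pmcompf1 bE ihom_morDl.
Qed.

(** If composition with [b] makes [v] a coboundary, then [v] composed with the round
    trip [b0 b1] extends to [Z]. The round trip is homotopic to the identity by [c], so
    [v] extends as well. *)
Lemma connecting_ker N : exact_at (ihom_mor phi j (pid N)) (connecting se ab N).
Proof.
have [pa jb] := ab; have [jm jp pe] := se.
move=> y v; split; last first.
  case=> s <-; rewrite pmcompE; apply/hclass_eq0.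
  exists (ihom_mor phi a (pid N) y s).
  rewrite -[RHS]/(pmcomp (pker_in _) (connecting_cyc _ _ _) y _) connecting_cycE.
  rewrite -[co_in _ _]/(ihom_mor phi (res_d H 0) (pid N)) -!pmcompE !ihom_mor_comp.
  by rewrite jb.
move/hclass_eq0 => [t].
rewrite -[RHS]/(pmcomp (pker_in _) (connecting_cyc _ _ _) y _) connecting_cycE.
rewrite -[co_in _ _]/(ihom_mor phi (res_d H 0) (pid N)) => tE.
have [a1 [b1 [a1E b1E]]] := lift_back.
have [|b0 b0E] := @lift_to_kernel _ _ _ _ _ j p a (pker_in (pcover H)) se.
  by rewrite pa pker_in0.
have bE : b = pmcomp b0 (pcover (syz H 1)).
  by apply: (pmono_cancel jm); rewrite jb [RHS]pmcompA b0E; exact: pmorP.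
have {}tE : ihom_mor phi (pker_in (pcover H)) (pid N) y t = ihom_mor phi b0 (pid N) y v.
  apply: (@ihom_mono _ _ _ phi _ _ _ _ (pcover (syz H 1)) (pid N)).
  - exact: pcover_epi.
  - by move=> q x x'.
  by rewrite -!pmcompE !ihom_mor_comp pmcompf1 -bE.
have [c cE] : exists c, pmcomp a a1 = pid _ + pmcomp j c.
  by apply: (lift_difference se); rewrite pmcompA pa a1E pmcompf1.
(* hence [v + v c j = t a1 j], which exhibits [v] as a restriction from [Z] *)
have b0b1 : pmcomp b0 b1 = pid _ + pmcomp c j.
  apply: (pmono_cancel jm); rewrite pmcompA b0E -[LHS]pmcompA b1E [LHS]pmcompA cE.
  by rewrite pmcompDl pmcompDr pmcomp1f pmcompf1 pmcompA.
exists (ihom_mor phi a1 (pid N) y t - ihom_mor phi c (pid N) y v).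
have E1 : v + ihom_mor phi (pmcomp c j) (pid N) y v =
    ihom_mor phi b1 (pid N) y (ihom_mor phi b0 (pid N) y v).
  by rewrite -pmcompE ihom_mor_comp pmcompf1 b0b1 ihom_morDl ihom_mor_id.
rewrite linearB /= -!pmcompE !ihom_mor_comp pmcompf1 -b1E.
rewrite -{1}[pid N]pmcompf1 -ihom_mor_comp pmcompE tE -E1.
exact: addrK.
Qed.
End ConnectingExact.
End Connecting.

(** * Cycles, boundaries and homology of complexes *)

Section Products.
Context (k : fieldType) (d : Order.disp_t) (P : porderType d).
Context (I : Type) (F G : I -> pmod k P) (f : forall i, pmor (F i) (G i)).

Lemma pprod_eq p (s t : pprod F p) : (forall i, s i = t i) -> s = t.
Proof. exact: functional_extensionality_dep. Qed.

Lemma pprod_mono : (forall i, pmono (f i)) -> pmono (pprod_mor f).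
Proof.
move=> fm p s t st; apply: functional_extensionality_dep => i.
by apply: (fm i); exact: (congr1 (fun g : pprod G p => g i) st).
Qed.

Lemma pprod_lift p (t : pprod G p) :
  (forall i, exists x, f i p x = t i) -> exists s, pprod_mor f p s = t.
Proof.
move=> ft; exists (fun i => sval (cid (ft i))).
by apply: functional_extensionality_dep => i; exact: (svalP (cid (ft i))).
Qed.

End Products.

Section Complexes.
Context (k : fieldType) (d : Order.disp_t) (P : porderType d).

Section Chain.
Context (K : chain k P).
Definition ch_cyc n : pmod k P := pker (ch_out K n).
Definition ch_cyc_in n : pmor (ch_cyc n) (K n) := pker_in (ch_out K n).

Lemma ch_out_d n : pmcomp (ch_out K n) (ch_d K n) = 0.
Proof. by case: n => [|n] /=; [rewrite pmcomp0f|rewrite ch_dd]. Qed.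

Definition ch_bnd_in n : pmor (ch_bnd K n) (ch_cyc n) := sval (bnd_cyc (ch_out_d n)).
Lemma ch_bnd_inE n : pmcomp (ch_cyc_in n) (ch_bnd_in n) = pim_in (ch_d K n).
Proof. by rewrite /ch_bnd_in; case: bnd_cyc. Qed.

Definition ch_cl n : pmor (ch_cyc n) (hlgy K n) := hclass _ _.
Lemma ch_cl_exact n : short_exact (ch_bnd_in n) (ch_cl n).
Proof. exact/bnd_cyc_exact/ch_bnd_inE. Qed.

Definition ch_d_co n : pmor (K n.+1) (ch_bnd K n) := pim_co (ch_d K n).
Lemma ch_dE n : pmcomp (ch_cyc_in n) (pmcomp (ch_bnd_in n) (ch_d_co n)) = ch_d K n.
Proof. by rewrite pmcompA ch_bnd_inE pim_in_co. Qed.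

Lemma ch_d_cyc_in n : pmcomp (ch_d K n) (ch_cyc_in n.+1) = 0.
Proof. exact: pker_in0. Qed.

Lemma ch_d_co_cyc_in n : pmcomp (ch_d_co n) (ch_cyc_in n.+1) = 0.
Proof.
apply: (pmono_cancel (m := pim_in (ch_d K n))); first exact: pim_in_mono.
by rewrite pmcompA pim_in_co ch_d_cyc_in pmcompf0.
Qed.

Lemma ch_d_co_d n : pmcomp (ch_d_co n) (ch_d K n.+1) = 0.
Proof. by rewrite -ch_dE pmcompA ch_d_co_cyc_in pmcomp0f. Qed.

Lemma ch_cyc_in_exact n : exact_at (ch_cyc_in n.+1) (ch_d_co n).
Proof.
move=> p x; split=> [h|[z <-]]; last exact: (pmor_app (ch_d_co_cyc_in n)).
apply: pker_inP; rewrite -[LHS]/(ch_d K n p x) -(pim_in_co (ch_d K n)) pmcompE.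
by rewrite -/(ch_d_co n) h linear0.
Qed.

Lemma ch_cyc_in0_epi : pepi (ch_cyc_in 0).
Proof. by move=> p x; apply: pker_inP. Qed.

(** In positive degree the corestricted differential [K_n -> B_(n-1)] has a section
    [s], since [B_(n-1)] is projective, and [1 - s d] is a projection onto the cycles.
    In degree [0] every chain is a cycle. *)
Lemma ch_retract_ex n : (forall m, projective_pm (ch_bnd K m)) ->
  {r : pmor (K n) (ch_cyc n) | pmcomp r (ch_cyc_in n) = pid _}.
Proof.
move=> pB; apply: cid; case: n => [|n].
  have [r rE] := @pker_factor _ _ _ _ _ _ (ch_out K 0) (pid (K 0)) (pmcomp0f _ _).
  exists r; apply: (pmono_cancel (@pker_in_mono _ _ _ _ _ (ch_out K 0))).
  by rewrite pmcompA rE pmcomp1f pmcompf1.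
have [s sE] := pB n _ _ (ch_d_co n) (pid _) (@pim_co_epi _ _ _ _ _ _).
have [|r rE] := @pker_factor _ _ _ _ _ _ (ch_out K n.+1) (pid _ - pmcomp s (ch_d_co n)).
  rewrite -[ch_out K n.+1]/(ch_d K n) -(pim_in_co (ch_d K n)) -/(ch_d_co n).
  rewrite -pmcompA pmcompDr pmcompf1 -scaleN1r pmcompZr pmcompA sE pmcomp1f.
  by rewrite scaleN1r subrr pmcompf0.
exists r; apply: (pmono_cancel (@pker_in_mono _ _ _ _ _ (ch_out K n.+1))).
rewrite pmcompA rE pmcompDl pmcomp1f -scaleN1r pmcompZl -pmcompA ch_d_co_cyc_in.
by rewrite pmcompf0 scaler0 addr0 pmcompf1.
Qed.

Lemma ch_cyc_projective n : proj_with_bnd K -> projective_pm (ch_cyc n).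
Proof.
move=> [pK pB]; have [r rE] := ch_retract_ex n pB.
exact: retract_projective rE (pK n).
Qed.

End Chain.

Section Cochain.
Context (L : cochain k P).
Definition co_cyc n : pmod k P := pker (co_d L n).
Definition co_cyc_in n : pmor (co_cyc n) (L n) := pker_in (co_d L n).

Lemma co_d_in n : pmcomp (co_d L n) (co_in L n) = 0.
Proof. by case: n => [|n] /=; [rewrite pmcompf0|rewrite co_dd]. Qed.

Lemma co_d_cyc_in n : pmcomp (co_d L n) (co_cyc_in n) = 0.
Proof. exact: pker_in0. Qed.

Lemma co_cyc_in_exact n : exact_at (co_cyc_in n) (co_d L n).
Proof.
move=> p x; split=> [/pker_inP //|[z <-]]; exact: (pmor_app (co_d_cyc_in n)).
Qed.

Definition co_d_cyc n : pmor (prev_term L n) (co_cyc n) := sval (pker_factor (co_d_in n)).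
Lemma co_d_cycE n : pmcomp (co_cyc_in n) (co_d_cyc n) = co_in L n.
Proof. by rewrite /co_d_cyc; case: pker_factor. Qed.

Definition co_cl n : pmor (co_cyc n) (cohlgy L n) := hclass _ _.
Lemma co_cl_epi n : pepi (co_cl n).
Proof. exact: hclass_epi. Qed.

Lemma co_d_cyc_exact n : exact_at (co_d_cyc n) (co_cl n).
Proof.
move=> p z; rewrite hclass_eq0; split=> -[x xE]; exists x.
  by apply: (@pker_in_mono _ _ _ _ _ (co_d L n)); rewrite -xE -co_d_cycE.
by rewrite -xE -co_d_cycE.
Qed.

Lemma co_cl_d_cyc n : pmcomp (co_cl n) (co_d_cyc n) = 0.
Proof. by apply: pmorP => p x; apply/co_d_cyc_exact; exists x. Qed.

(** Being injective, the boundaries are a direct summand of the cycles, and the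
    complementary projection factors through cohomology. *)
Lemma co_section n : injective_pm (co_bnd L n) ->
  {s : pmor (cohlgy L n) (co_cyc n) | pmcomp (co_cl n) s = pid _}.
Proof.
move=> iB; apply: cid; have [j jE] := bnd_cyc (co_d_in n).
have [jm jp pe] := bnd_cyc_exact jE.
have [r rE] := iB _ _ j (pid _) jm.
have [|s sE] := @pepi_descend _ _ _ _ _ _ (co_cl n) (pid _ - pmcomp j r) pe.
  move=> p z /jp [b <-]; rewrite pmorDE pmorNE pmcompE pidE.
  by rewrite (pmor_app rE b : r p (j p b) = b) subrr.
exists s; apply: (pepi_cancel pe); rewrite -pmcompA sE pmcompDr pmcompf1.
rewrite -scaleN1r pmcompZr pmcompA.
have -> : pmcomp (co_cl n) j = 0 by apply: pmorP => p x; apply/jp; exists x.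
by rewrite pmcomp0f scaler0 addr0 pmcomp1f.
Qed.

End Cochain.

Section ChainMaps.
Context (K K' : chain k P) (f : chain_map K K').
Definition ch_cyc_mor n : pmor (ch_cyc K n) (ch_cyc K' n) := pker_mor (cm_out f n).
Lemma ch_cyc_in_mor n : pmcomp (ch_cyc_in K' n) (ch_cyc_mor n) = pmcomp (f n) (ch_cyc_in K n).
Proof. exact: pker_in_morE. Qed.
Lemma ch_cl_mor n : pmcomp (hlgy_mor f n) (ch_cl K n) = pmcomp (ch_cl K' n) (ch_cyc_mor n).
Proof. exact: hclass_mor. Qed.

Lemma ch_bnd_mor_ex n : {c : pmor (ch_bnd K n) (ch_bnd K' n) |
  pmcomp (pim_in (ch_d K' n)) c = pmcomp (f n) (pim_in (ch_d K n)) &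
  pmcomp c (ch_d_co K n) = pmcomp (ch_d_co K' n) (f n.+1)}.
Proof. exact/pim_mor/cm_comm. Qed.
Definition ch_bnd_mor n := s2val (ch_bnd_mor_ex n).
Lemma ch_d_co_mor n : pmcomp (ch_bnd_mor n) (ch_d_co K n) = pmcomp (ch_d_co K' n) (f n.+1).
Proof. by rewrite /ch_bnd_mor; case: ch_bnd_mor_ex. Qed.
Lemma ch_bnd_in_mor n : pmcomp (ch_bnd_in K' n) (ch_bnd_mor n) = pmcomp (ch_cyc_mor n) (ch_bnd_in K n).
Proof.
apply: (pmono_cancel (@pker_in_mono _ _ _ _ _ (ch_out K' n))).
rewrite -/(ch_cyc_in K' n) pmcompA ch_bnd_inE [RHS]pmcompA ch_cyc_in_mor -[RHS]pmcompA ch_bnd_inE.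
by rewrite /ch_bnd_mor; case: ch_bnd_mor_ex.
Qed.
End ChainMaps.

Section CochainMaps.
Context (L L' : cochain k P) (g : cochain_map L L').
Definition co_cyc_mor n : pmor (co_cyc L n) (co_cyc L' n) := pker_mor (com_comm g n).
Lemma co_cyc_in_mor n : pmcomp (co_cyc_in L' n) (co_cyc_mor n) = pmcomp (g n) (co_cyc_in L n).
Proof. exact: pker_in_morE. Qed.
Lemma co_cl_mor n : pmcomp (cohlgy_mor g n) (co_cl L n) = pmcomp (co_cl L' n) (co_cyc_mor n).
Proof. exact: hclass_mor. Qed.
End CochainMaps.

End Complexes.

(** * The total complex on families over all bidegrees *)

Lemma bideg_extend (k : fieldType) (G : nat -> nat -> lmodType k) n
    (h : forall pq : bideg n, G (sval pq).1 (sval pq).2) :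
  exists h' : forall p q, G p q, forall pq, h pq = h' (sval pq).1 (sval pq).2.
Proof.
exists (fun p q => match pselect (p + q == n)%N return G p q with
  | left e => h (exist _ (p, q) e)
  | right _ => 0
  end) => -[[p q] e] /=.
by case: pselect => // e'; rewrite (bool_irrelevance e e').
Qed.

Section Families.
Context (k : fieldType) (d : Order.disp_t) (P : porderType d).
Context (phi : {omorphism (P *p P)%type -> P}).
Context (K : chain k P) (L : cochain k P) (y : P).

(** An element of the total complex of degree [n] is a family over the pairs with
    [p + q = n]. Taking it as the restriction of a family over all pairs keeps proofs of
    [p + q = n] out of the indices. *)
Definition fam := forall p q, ihom phi (K p) (L q) y.
Implicit Types U V Y : fam.

Definition tot_of n U : tot_obj phi K L n y := fun pq : bideg n => U (sval pq).1 (sval pq).2.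
Arguments tot_of n U : clear implicits.

Lemma tot_ofP n (u : tot_obj phi K L n y) : exists U, u = tot_of n U.
Proof.
have [U UE] := bideg_extend (G := fun p q => ihom phi (K p) (L q) y) u.
by exists U; exact: functional_extensionality_dep.
Qed.

Lemma tot_of_eq n U V : tot_of n U = tot_of n V <-> forall p q, (p + q = n)%N -> U p q = V p q.
Proof.
split=> [E p q /eqP e|E].
  exact: (congr1 (fun u : tot_obj phi K L n y => u (exist _ (p, q) e)) E).
by apply: functional_extensionality_dep => -[[p q] e]; apply/E/eqP.
Qed.

Definition fam_dK U p q : ihom phi (K p) (L q) y :=
  match p return ihom phi (K p) (L q) y with
  | 0 => 0
  | p'.+1 => (-1) ^+ (p' + q + 1)%N *: ihom_mor phi (ch_d K p') (pid (L q)) y (U p' q)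
  end.
Definition fam_dL U p q : ihom phi (K p) (L q) y :=
  match q return ihom phi (K p) (L q) y with
  | 0 => 0
  | q'.+1 => ihom_mor phi (pid (K p)) (co_d L q') y (U p q')
  end.
Definition fam_d U : fam := fun p q => fam_dK U p q + fam_dL U p q.

Lemma tot_d_of n U : co_d (tot phi K L) n y (tot_of n U) = tot_of n.+1 (fam_d U).
Proof.
apply: functional_extensionality_dep => -[[p q] e].
rewrite -[LHS]/(tot_dK phi K L e y (tot_of n U) + tot_dL phi K L e y (tot_of n U)).
by rewrite /tot_of /=; congr (_ + _); [case: p e|case: q e].
Qed.

(** In degree [0] there is no incoming differential, in agreement with
    [fam_d Y 0 0 = 0]. *)
Lemma tot_bnd n U : (exists a, co_in (tot phi K L) n y a = tot_of n U) <->
  exists Y, forall p q, (p + q = n)%N -> U p q = fam_d Y p q.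
Proof.
case: n => [|n] /=.
  split=> [[a E]|[Y YE]].
    exists (fun _ _ => 0) => -[] // -[] // _; rewrite /fam_d /= addr0.
    exact: (congr1 (fun u : tot_obj phi K L 0 y => u (exist _ (0, 0)%N (eqxx _))) (esym E)).
  exists 0; apply: (proj2 (@tot_of_eq 0 (fun _ _ => 0) U)) => -[] // -[] // _.
  by rewrite YE // /fam_d /= addr0.
split=> [[a E]|[Y YE]].
  have [Y aY] := tot_ofP a; exists Y => p q e.
  by move: E; rewrite aY tot_d_of => /tot_of_eq ->.
by exists (tot_of n Y); rewrite tot_d_of; apply/tot_of_eq => p q e; rewrite YE.
Qed.

Lemma fam_dK_cyc M p q (i : pmor M (K p)) U : (pmcomp (ch_out K p) i = 0) ->
  ihom_mor phi i (pid (L q)) y (fam_dK U p q) = 0.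
Proof.
case: p i => [|p] i /= di; first by rewrite linear0.
by rewrite linearZ /= -pmcompE ihom_mor_comp di ihom_mor0f scaler0.
Qed.

Lemma fam_dL_bnd U p q : exists w, fam_dL U p q = ihom_mor phi (pid (K p)) (co_in L q) y w.
Proof. by case: q => [|q]; [exists 0; rewrite linear0|exists (U p q)]. Qed.

End Families.
Arguments tot_of {k d P phi K L y} n U.

(** * From the cohomology of the total complex to maps on homology *)

Lemma signr_solve (k : fieldType) (V : lmodType k) n (a b : V) :
  (-1) ^+ n *: a + b = 0 -> a = - ((-1) ^+ n *: b).
Proof.
move=> /eqP; rewrite addr_eq0 => /eqP E.
by rewrite -scalerN -E scalerA -expr2 sqrr_sign scale1r.
Qed.

Lemma signrZK (k : fieldType) (V : lmodType k) n (a : V) :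
  (-1) ^+ n *: ((-1) ^+ n *: a) = a.
Proof. by rewrite scalerA -expr2 sqrr_sign scale1r. Qed.

Section IhomExtra.
Context (k : fieldType) (d : Order.disp_t) (P : porderType d).
Context (phi : {omorphism (P *p P)%type -> P}).

Lemma ihom_ihom (M M' M'' N N' N'' : pmod k P) (f : pmor M' M) (f' : pmor M'' M')
    (g : pmor N N') (g' : pmor N' N'') y (u : ihom phi M N y) :
  ihom_mor phi f' g' y (ihom_mor phi f g y u) = ihom_mor phi (pmcomp f f') (pmcomp g' g) y u.
Proof. by rewrite -pmcompE ihom_mor_comp. Qed.

Lemma ihom0l (M M' N N' : pmod k P) (g : pmor N N') y (u : ihom phi M N y) :
  ihom_mor phi (0 : pmor M' M) g y u = 0.
Proof. by rewrite ihom_mor0f. Qed.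

Lemma ihom0r (M M' N N' : pmod k P) (f : pmor M' M) y (u : ihom phi M N y) :
  ihom_mor phi f (0 : pmor N N') y u = 0.
Proof. by rewrite ihom_morf0. Qed.

Lemma pid_mono (M : pmod k P) : pmono (pid M). Proof. by move=> p x z. Qed.
Lemma pid_epi (M : pmod k P) : pepi (pid M). Proof. by move=> p x; exists x. Qed.

End IhomExtra.

Definition ihE := (@ihom_ihom, @pmcompf1, @pmcomp1f).

Section Out.
Context (k : fieldType) (d : Order.disp_t) (P : porderType d).
Context (phi : {omorphism (P *p P)%type -> P}).
Context (K : chain k P) (L : cochain k P).
Local Notation ih := (ihom_mor phi).

Section Elements.
Context (y : P).
Implicit Types U Y : @fam _ _ _ phi K L y.

(** On cycles only the part of the differential coming from [L] survives. *)
Lemma fam_d_cyc U p q :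
  ih (ch_cyc_in K p) (pid (L q)) y (fam_d U p q) =
  ih (ch_cyc_in K p) (pid (L q)) y (fam_dL U p q).
Proof. by rewrite /fam_d linearD /= fam_dK_cyc ?add0r //; exact: pker_in0. Qed.

Lemma fam_cocycle_cyc U p q : fam_d U p q.+1 = 0 ->
  ih (pid _) (co_d L q) y (ih (ch_cyc_in K p) (pid _) y (U p q)) = 0.
Proof.
move=> E; have := fam_d_cyc U p q.+1; rewrite E linear0 /= !ihE => E'.
by rewrite -E'.
Qed.

Lemma ihom_cyc_inj M q (s t : ihom phi M (co_cyc L q) y) :
  ih (pid M) (co_cyc_in L q) y s = ih (pid M) (co_cyc_in L q) y t -> s = t.
Proof. by apply: ihom_mono; [exact: pid_epi|exact: pker_in_mono]. Qed.

Lemma ihom_bnd_inj M p (s t : ihom phi (ch_bnd K p) M y) :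
  ih (ch_d_co K p) (pid M) y s = ih (ch_d_co K p) (pid M) y t -> s = t.
Proof. by apply: ihom_mono; [exact: pim_co_epi|exact: pid_mono]. Qed.

Lemma fam_dL_cyc U p q : exists w, fam_dL U p q = ih (pid (K p)) (co_cyc_in L q) y (ih (pid _) (co_d_cyc L q) y w).
Proof.
by have [w wE] := fam_dL_bnd U p q; exists w; rewrite ihom_ihom co_d_cycE pmcompf1.
Qed.

(** On [B_p] the cocycle condition writes [s], up to sign, as the differential of
    the component in bidegree [(p + 1, q - 1)], so that [s] vanishes there modulo
    boundaries of [L]. *)
Lemma cocycle_descend U p q (s : ihom phi (ch_cyc K p) (co_cyc L q) y) :
  fam_d U p.+1 q = 0 ->
  ih (pid _) (co_cyc_in L q) y s = ih (ch_cyc_in K p) (pid _) y (U p q) ->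
  exists h, ih (ch_cl K p) (pid _) y h = ih (pid _) (co_cl L q) y s.
Proof.
move=> E sE; have [_ _ ce] := ch_cl_exact K p; have [_ cex _] := ch_cl_exact K p.
apply: (ihom_descend ce cex); apply: ihom_bnd_inj; rewrite linear0.
have [w wE] := fam_dL_cyc U p.+1 q.
move: E; rewrite /fam_d wE => /signr_solve E.
have E2 : ih (pmcomp (ch_bnd_in K p) (ch_d_co K p)) (pid _) y s =
    - ((-1) ^+ (p + q + 1) *: ih (pid _) (co_d_cyc L q) y w).
  apply: ihom_cyc_inj; rewrite linearN linearZ /= -E !ihE -[co_cyc_in L q]pmcomp1f -[pmcomp _ (ch_d_co K p)]pmcomp1f.
  by rewrite -ihom_ihom sE ihom_ihom ch_dE pmcompf1.
rewrite !ihE.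
have -> : ih (pmcomp (ch_bnd_in K p) (ch_d_co K p)) (co_cl L q) y s =
   ih (pid _) (co_cl L q) y (ih (pmcomp (ch_bnd_in K p) (ch_d_co K p)) (pid _) y s).
  by rewrite ihom_ihom !pmcompf1.
by rewrite E2 linearN linearZ /= ihom_ihom co_cl_d_cyc ihom0r scaler0 oppr0.
Qed.

End Elements.

Context (n : nat).
Notation prodn F G := (pprod (fun pq : bideg n => ihom phi (F (sval pq).1) (G (sval pq).2))).
Notation mor f g := (pprod_mor (fun pq : bideg n => ih (f (sval pq).1) (g (sval pq).2))).

Definition restr_cyc : pmor (tot_obj phi K L n) (prodn (ch_cyc K) L) :=
  mor (ch_cyc_in K) (fun q => pid (L q)).
Definition incl_cyc : pmor (prodn (ch_cyc K) (co_cyc L)) (prodn (ch_cyc K) L) :=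
  mor (fun p => pid (ch_cyc K p)) (co_cyc_in L).
Definition cl_cyc : pmor (prodn (ch_cyc K) (co_cyc L)) (prodn (ch_cyc K) (cohlgy L)) :=
  mor (fun p => pid (ch_cyc K p)) (co_cl L).
Definition cl_hom : pmor (hom_term phi n K L) (prodn (ch_cyc K) (cohlgy L)) :=
  mor (ch_cl K) (fun q => pid (cohlgy L q)).

Lemma incl_cyc_mono : pmono incl_cyc.
Proof. by apply: pprod_mono => pq; apply: ihom_mono; [exact: pid_epi|exact: pker_in_mono]. Qed.
Lemma cl_hom_mono : pmono cl_hom.
Proof. by apply: pprod_mono => pq; apply: ihom_mono; [exact: hclass_epi|exact: pid_mono]. Qed.

Definition tot_cyc := pker (co_d (tot phi K L) n).
Definition tot_cyc_in : pmor tot_cyc (tot phi K L n) := pker_in (co_d (tot phi K L) n).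

Lemma tot_cyc_fam y (z : tot_cyc y) : exists U, tot_cyc_in y z = tot_of n U /\
  forall p q, (p + q = n.+1)%N -> fam_d U p q = 0.
Proof.
have [U UE] := tot_ofP (tot_cyc_in y z : tot_obj phi K L n y); exists U; split=> // p q.
have := pmor_app (pker_in0 (co_d (tot phi K L) n)) z.
rewrite pmcompE -/tot_cyc_in UE tot_d_of pmor0E => E.
exact: (proj1 (@tot_of_eq _ _ _ _ _ _ _ _ _ (fun _ _ => 0)) E).
Qed.

Lemma fam_tot_cyc y (U : @fam _ _ _ phi K L y) :
  (forall p q, (p + q = n.+1)%N -> fam_d U p q = 0) ->
  exists z : tot_cyc y, tot_cyc_in y z = tot_of n U.
Proof.
move=> U0; apply: pker_inP; rewrite tot_d_of.
exact: (proj2 (@tot_of_eq _ _ _ _ _ _ _ _ _ (fun _ _ => 0)) U0).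
Qed.

(** Restriction of a cocycle to [Z_p], with values in [Z^q]. *)
Lemma out_cyc_ex : {s : pmor tot_cyc (prodn (ch_cyc K) (co_cyc L)) |
  pmcomp incl_cyc s = pmcomp restr_cyc tot_cyc_in}.
Proof.
apply: pmono_factor; first exact: incl_cyc_mono.
move=> y z; apply: pprod_lift => -[[p q] /= e].
have [U [zU U0]] := tot_cyc_fam z.
rewrite pmcompE zU.
apply: (ihom_factor (@pker_in_mono _ _ _ _ _ (co_d L q)) (@co_cyc_in_exact _ _ _ L q)).
apply: (@fam_cocycle_cyc y U p q); apply: U0.
by rewrite addnS (eqP e).
Qed.
Definition out_cyc := sval out_cyc_ex.
Lemma out_cycE : pmcomp incl_cyc out_cyc = pmcomp restr_cyc tot_cyc_in.
Proof. exact: svalP out_cyc_ex. Qed.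

Lemma out_cyc_fam y (z : tot_cyc y) U p q (e : (p + q == n)%N) : tot_cyc_in y z = tot_of n U ->
  ih (pid _) (co_cyc_in L q) y (out_cyc y z (exist _ (p, q) e)) = ih (ch_cyc_in K p) (pid _) y (U p q).
Proof.
move=> zU; have := pmor_app out_cycE z; rewrite !pmcompE zU.
by move=> /(congr1 (fun t : prodn (ch_cyc K) L y => t (exist _ (p, q) e))).
Qed.

Lemma out_hom_ex : {t : pmor tot_cyc (hom_term phi n K L) |
  pmcomp cl_hom t = pmcomp cl_cyc out_cyc}.
Proof.
apply: pmono_factor; first exact: cl_hom_mono.
move=> y z; apply: pprod_lift => -[[p q] /= e].
have [U [zU U0]] := tot_cyc_fam z.
apply: (@cocycle_descend y U p q); last exact: out_cyc_fam.
by apply: U0; rewrite addSn (eqP e).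
Qed.
Definition out_hom := sval out_hom_ex.
Lemma out_homE : pmcomp cl_hom out_hom = pmcomp cl_cyc out_cyc.
Proof. exact: svalP out_hom_ex. Qed.

Definition tot_cl : pmor tot_cyc (mid_term phi n K L) := hclass _ _.

(** A coboundary, restricted to [Z_p], factors through the differential of [L], so
    that it vanishes in [H^q]. *)
Lemma kunneth_out_ex : {o : pmor (mid_term phi n K L) (hom_term phi n K L) |
  pmcomp o tot_cl = out_hom}.
Proof.
apply: pepi_descend; first exact: hclass_epi.
move=> y z /hclass_eq0; have [U [zU U0]] := tot_cyc_fam z.
rewrite -/tot_cyc_in zU => /tot_bnd [Y YE].
apply: cl_hom_mono; rewrite linear0 -[LHS]/(pmcomp cl_hom out_hom y z) out_homE pmcompE.
apply: functional_extensionality_dep => -[[p q] e].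
rewrite -[LHS]/(ih (pid _) (co_cl L q) y (out_cyc y z (exist _ (p, q) e))).
have [w wE] := fam_dL_cyc Y p q.
have -> : out_cyc y z (exist _ (p, q) e) = ih (ch_cyc_in K p) (co_d_cyc L q) y w.
  apply: ihom_cyc_inj; rewrite (out_cyc_fam e zU) YE ?(eqP e) // fam_d_cyc wE.
  by rewrite !ihE.
by rewrite !ihE co_cl_d_cyc ihom0r.
Qed.
Definition kunneth_out := sval kunneth_out_ex.
Lemma kunneth_outE : pmcomp kunneth_out tot_cl = out_hom.
Proof. exact: svalP kunneth_out_ex. Qed.

End Out.

(** * From Ext classes to the cohomology of the total complex *)

Section In.
Context (k : fieldType) (d : Order.disp_t) (P : porderType d).
Context (phi : {omorphism (P *p P)%type -> P}).
Context (K : chain k P).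
Local Notation ih := (ihom_mor phi).

Lemma hlgy_lift_ex p :
  {ab : pmor (res (hlgy K p) 0) (ch_cyc K p) * pmor (res (hlgy K p) 1) (ch_bnd K p) |
    res_lift (ch_bnd_in K p) (ch_cl K p) ab.1 ab.2}.
Proof. by apply: cid; have [a [b ab]] := res_lift_ex (ch_cl_exact K p); exists (a, b). Qed.

Definition hlgy_connecting p N : pmor (ihom phi (ch_bnd K p) N) (Ext phi 1 (hlgy K p) N) :=
  connecting phi (ch_cl_exact K p) (svalP (hlgy_lift_ex p)) N.

Section Maps.
Context (L : cochain k P) (n : nat).

(** The index set consists of all pairs, not only of those with [i + j = n - 1]: then
    [bnd_comp] requires no proof about its index. *)
Definition bnd_prod : pmod k P :=
  pprod (fun pq : nat * nat => ihom phi (ch_bnd K pq.1) (co_cyc L pq.2)).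

Definition connecting_prod : pmor bnd_prod (ext_term phi n K L) :=
  ptuple (fun ij : bideg_pred n => pmcomp (pmcomp (hlgy_connecting (sval ij).1 (cohlgy L (sval ij).2))
      (ih (pid (ch_bnd K (sval ij).1)) (co_cl L (sval ij).2)))
    (pproj (fun pq : nat * nat => ihom phi (ch_bnd K pq.1) (co_cyc L pq.2)) (sval ij))).

Definition bnd_comp p q : pmor bnd_prod (ihom phi (K p) (L q)) :=
  match p return pmor bnd_prod (ihom phi (K p) (L q)) with
  | 0 => 0
  | i.+1 => pmcomp (ih (ch_d_co K i) (co_cyc_in L q)) (pproj _ (i, q))
  end.

Definition bnd_tot : pmor bnd_prod (tot_obj phi K L n) :=
  ptuple (fun pq : bideg n => bnd_comp (sval pq).1 (sval pq).2).

Definition bnd_comp_fam y (V : bnd_prod y) : @fam _ _ _ phi K L y := fun p q => bnd_comp p q y V.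

Lemma bnd_totE y V : bnd_tot y V = tot_of n (bnd_comp_fam V).
Proof. by []. Qed.

(** Such a family kills the boundaries of [K] and takes values in the cycles of [L]. *)
Lemma bnd_comp_fam_d y (V : bnd_prod y) p q : fam_d (bnd_comp_fam V) p q = 0.
Proof.
have dL0 : fam_dL (bnd_comp_fam V) p q = 0.
  case: q => [|q] //=; rewrite /bnd_comp_fam; case: p => [|p] /=; first by rewrite linear0.
  by rewrite ihom_ihom co_d_cyc_in ihom0r.
rewrite /fam_d dL0 addr0.
case: p {dL0} => [|[|p]] //=; rewrite /bnd_comp_fam /=; first by rewrite linear0 scaler0.
by rewrite ihom_ihom ch_d_co_d ihom0l scaler0.
Qed.

Lemma bnd_to_cyc_ex : {c : pmor bnd_prod (tot_cyc phi K L n) |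
  pmcomp (tot_cyc_in phi K L n) c = bnd_tot}.
Proof.
apply: pker_factor; apply: pmorP => y V; rewrite pmcompE bnd_totE tot_d_of.
apply: (proj2 (@tot_of_eq _ _ _ _ _ _ _ _ _ (fun _ _ => 0))) => p q _.
exact: bnd_comp_fam_d.
Qed.
Definition bnd_to_cyc := sval bnd_to_cyc_ex.
Lemma bnd_to_cycE : pmcomp (tot_cyc_in phi K L n) bnd_to_cyc = bnd_tot.
Proof. exact: svalP bnd_to_cyc_ex. Qed.

Context (hK : proj_with_bnd K).
Local Notation cycP i := (@ch_cyc_projective _ _ _ K i hK).

Lemma connecting_prod_epi : pepi connecting_prod.
Proof.
move=> y e.
have ex (ij : bideg_pred n) : exists v : ihom phi (ch_bnd K (sval ij).1) (co_cyc L (sval ij).2) y,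
    hlgy_connecting (sval ij).1 _ y (ih (pid _) (co_cl L _) y v) = e ij.
  have [v' <-] := @connecting_epi _ _ _ phi _ _ _ _ _ (ch_cl_exact K (sval ij).1) _ _
    (svalP (hlgy_lift_ex (sval ij).1)) (cycP _) _ y (e ij).
  have [v <-] := ihom_lift (phi := phi) (hK.2 (sval ij).1) (@co_cl_epi _ _ _ L (sval ij).2) v'.
  by exists v.
pose V (ij : nat * nat) := match pselect ((ij.1 + ij.2).+1 == n)%N
    return ihom phi (ch_bnd K ij.1) (co_cyc L ij.2) y with
  | left h => sval (cid (ex (exist _ ij h)))
  | right _ => 0
  end.
have VE ij (h : ((ij.1 + ij.2).+1 == n)%N) : V ij = sval (cid (ex (exist _ ij h))).
  rewrite /V; case: (pselect _) => [h'|nh]; last by case: nh.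
  by rewrite (bool_irrelevance h' h).
exists V; apply: (@pprod_eq _ _ _ _ (fun ij => Ext phi 1 _ _)) => -[ij h].
rewrite -[LHS]/(hlgy_connecting ij.1 _ y (ih (pid _) (co_cl L _) y (V ij))) (VE ij h).
exact: (svalP (cid (ex (exist _ ij h)))).
Qed.

Lemma connecting_prod_ker y (V : bnd_prod y) : connecting_prod y V = 0 <->
  forall i j, ((i + j).+1 = n)%N -> exists t : ihom phi (ch_cyc K i) (cohlgy L j) y,
    ih (ch_bnd_in K i) (pid _) y t = ih (pid _) (co_cl L j) y (V (i, j)).
Proof.
split=> [E i j /eqP h|E].
  apply/(connecting_ker (ch_cl_exact K i) (svalP (hlgy_lift_ex i)) (cycP i)).
  exact: (congr1 (fun t : ext_term phi n K L y => t (exist _ (i, j) h)) E).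
apply: (@pprod_eq _ _ _ _ (fun ij => Ext phi 1 _ _)) => -[[i j] h].
have /(connecting_ker (ch_cl_exact K i) (svalP (hlgy_lift_ex i)) (cycP i)) E' :=
  E i j (eqP h).
exact: E'.
Qed.

Definition ch_retract p := sval (ch_retract_ex p hK.2).
Lemma ch_retractK p : pmcomp (ch_retract p) (ch_cyc_in K p) = pid _.
Proof. exact: svalP (ch_retract_ex p hK.2). Qed.
Lemma ch_retract_d p : pmcomp (ch_retract p) (ch_d K p) = pmcomp (ch_bnd_in K p) (ch_d_co K p).
Proof. by rewrite -{1}ch_dE pmcompA ch_retractK pmcomp1f. Qed.

(** With this sign, the coboundary is [t] restricted to boundaries; there is no part
    from [L], since [t] takes values in cycles. *)
Definition cyc_fam y (t : forall p q, ihom phi (ch_cyc K p) (co_cyc L q) y) :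
    @fam _ _ _ phi K L y :=
  fun p q => (-1) ^+ (p + q + 1)%N *: ih (ch_retract p) (co_cyc_in L q) y (t p q).

(** A family of maps from [B_i] to the term of [L] before [L_q], as a cochain on
    [K_(i+1)]. Its coboundary has only the part coming from [L], because [K_(i+2)]
    maps to zero in [B_i]. *)
Definition bnd_lift_fam y (w : forall p q, ihom phi (ch_bnd K p) (prev_term L q) y) :
    @fam _ _ _ phi K L y :=
  fun p q => match p return ihom phi (K p) (L q) y with
    | 0 => 0
    | i.+1 => ih (ch_d_co K i) (pid (L q)) y (w i q.+1)
    end.

Lemma fam_dD y (U V : @fam _ _ _ phi K L y) p q :
  fam_d (fun p q => U p q + V p q) p q = fam_d U p q + fam_d V p q.
Proof.
rewrite /fam_d addrACA; congr (_ + _).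
  by case: p => [|p] /=; rewrite ?addr0 // linearD scalerDr.
by case: q => [|q] /=; rewrite ?addr0 // linearD.
Qed.

Lemma fam_dN y (U : @fam _ _ _ phi K L y) p q :
  fam_d (fun p q => - U p q) p q = - fam_d U p q.
Proof.
rewrite /fam_d opprD; congr (_ + _).
  by case: p => [|p] /=; rewrite ?oppr0 // linearN scalerN.
by case: q => [|q] /=; rewrite ?oppr0 // linearN.
Qed.

Lemma cyc_fam_d y (t : forall p q, ihom phi (ch_cyc K p) (co_cyc L q) y) p q :
  fam_d (cyc_fam t) p q = match p return ihom phi (K p) (L q) y with
    | 0 => 0
    | i.+1 => ih (ch_d_co K i) (co_cyc_in L q) y (ih (ch_bnd_in K i) (pid _) y (t i q))
    end.
Proof.
have dL0 : fam_dL (cyc_fam t) p q = 0.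
  case: q => [|q] //=; rewrite /cyc_fam linearZ /=.
  by rewrite ihom_ihom co_d_cyc_in ihom0r scaler0.
rewrite /fam_d dL0 addr0; case: p {dL0} => [|p] //=.
by rewrite /cyc_fam linearZ /= signrZK !ihE ch_retract_d.
Qed.

Lemma bnd_lift_fam_d y (w : forall p q, ihom phi (ch_bnd K p) (prev_term L q) y) p q :
  fam_d (bnd_lift_fam w) p q = match p return ihom phi (K p) (L q) y with
    | 0 => 0
    | i.+1 => ih (ch_d_co K i) (co_cyc_in L q) y (ih (pid _) (co_d_cyc L q) y (w i q))
    end.
Proof.
have dK0 : fam_dK (bnd_lift_fam w) p q = 0.
  case: p => [|[|p]] //=; rewrite /bnd_lift_fam; first by rewrite linear0 scaler0.
  by rewrite ihom_ihom ch_d_co_d ihom0l scaler0.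
rewrite /fam_d dK0 add0r; case: p {dK0} => [|p].
  by case: q => [|q] //=; rewrite linear0.
rewrite ihom_ihom co_d_cycE pmcomp1f; case: q => [|q] /=; first by rewrite ihom0r.
by rewrite /bnd_lift_fam !ihE.
Qed.

(** If the Ext classes vanish, then up to boundaries [w] of [L] the family [V] is the
    restriction of a family [t] on cycles; [t] and [w] combine to a cochain whose
    coboundary is the cocycle of [V]. *)
Lemma kunneth_in_ex : {f : pmor (ext_term phi n K L) (mid_term phi n K L) |
  pmcomp f connecting_prod = pmcomp (tot_cl phi K L n) bnd_to_cyc}.
Proof.
apply: pepi_descend; first exact: connecting_prod_epi.
move=> y V /connecting_prod_ker VE; rewrite pmcompE; apply/hclass_eq0.
rewrite -/(tot_cyc_in phi K L n) -[tot_cyc_in _ _ _ _ _ _]/(pmcomp (tot_cyc_in phi K L n) bnd_to_cyc y V).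
rewrite bnd_to_cycE bnd_totE; apply/tot_bnd.
have tw i j : exists tw : ihom phi (ch_cyc K i) (co_cyc L j) y *
    ihom phi (ch_bnd K i) (prev_term L j) y, ((i + j).+1 = n)%N ->
    V (i, j) = ih (ch_bnd_in K i) (pid _) y tw.1 + ih (pid _) (co_d_cyc L j) y tw.2.
  have [h|h] := pselect ((i + j).+1 = n)%N; last by exists (0, 0).
  have [t tE] := VE i j h.
  have [t' t'E] := ihom_lift (phi := phi) (cycP i) (@co_cl_epi _ _ _ L j) t.
  have [|w wE] := @ihom_lift_exact _ _ _ phi (ch_bnd K i) _ _ _ _ _ y
    (V (i, j) - ih (ch_bnd_in K i) (pid _) y t') (hK.2 i) (@co_d_cyc_exact _ _ _ L j).
    rewrite linearB /= -tE -t'E !ihE subrr //.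
  by exists (t', w) => _ /=; rewrite wE addrC subrK.
pose t i j := (sval (cid (tw i j))).1; pose w i j := (sval (cid (tw i j))).2.
have tE i j : ((i + j).+1 = n)%N ->
    V (i, j) = ih (ch_bnd_in K i) (pid _) y (t i j) + ih (pid _) (co_d_cyc L j) y (w i j).
  exact: (svalP (cid (tw i j))).
exists (fun p q => cyc_fam t p q + bnd_lift_fam w p q) => p q pq.
rewrite fam_dD cyc_fam_d bnd_lift_fam_d.
case: p pq => [|p] pq; first by rewrite addr0.
by rewrite -linearD -tE.
Qed.
Definition kunneth_in := sval kunneth_in_ex.
Lemma kunneth_inE : pmcomp kunneth_in connecting_prod = pmcomp (tot_cl phi K L n) bnd_to_cyc.
Proof. exact: svalP kunneth_in_ex. Qed.

End Maps.
End In.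

(** * Exactness and splitting *)

Section Exact.
Context (k : fieldType) (d : Order.disp_t) (P : porderType d).
Context (phi : {omorphism (P *p P)%type -> P}).
Context (K : chain k P) (L : cochain k P) (n : nat) (hK : proj_with_bnd K).
Local Notation ih := (ihom_mor phi).
Local Notation cycP i := (@ch_cyc_projective _ _ _ K i hK).
Local Notation r := (ch_retract hK).

(** In total degree at least two this is an identity in the total complex; below,
    the terms that are not zero by definition involve [fam_d Y 0 0 = 0]. *)
Lemma fam_dd y (Y : @fam _ _ _ phi K L y) p q : fam_d (fam_d Y) p q = 0.
Proof.
have [m pq] : exists m, (p + q = m)%N by exists (p + q)%N.
case: m pq => [|[|m]].
- by case: p => // -[]; case: q => //; rewrite /fam_d /= addr0.
- case: p => [|[|]]; case: q => [|[|]] // _; rewrite /fam_d /= !addr0 ?add0r;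
  by rewrite linear0 ?scaler0.
move=> pq; have := @pmor_app _ _ _ _ _ _ _ (co_dd (tot phi K L) m) y (tot_of m Y).
rewrite pmcompE !tot_d_of => E.
exact: (proj1 (@tot_of_eq _ _ _ _ _ _ _ _ _ (fun _ _ => 0)) E).
Qed.

(** If the cocycle of [V] is the coboundary of [Y], then [Y] maps cycles of [K] to
    cycles of [L], and up to sign its restriction extends the class of [V] from
    [B_i] to [Z_i]. *)
Lemma kunneth_in_mono : pmono (kunneth_in phi L n hK).
Proof.
apply: pmono_ker0 => y e; have [V <-] := connecting_prod_epi hK e.
rewrite -[LHS]/(pmcomp (kunneth_in phi L n hK) (connecting_prod phi K L n) y V) kunneth_inE.
move/hclass_eq0; rewrite -/(tot_cyc_in phi K L n).
rewrite -[tot_cyc_in _ _ _ _ _ _]/(pmcomp (tot_cyc_in phi K L n) (bnd_to_cyc phi K L n) y V).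
rewrite bnd_to_cycE bnd_totE => /tot_bnd [Y YE]. apply: (proj2 (connecting_prod_ker n hK V)) => i j ij.
have Ycyc p q : ((p + q).+1 = n)%N ->
    ih (pid _) (co_d L q) y (ih (ch_cyc_in K p) (pid _) y (Y p q)) = 0.
  move=> pq; have := congr1 (ih (ch_cyc_in K p) (pid _) y) (YE p q.+1 (etrans (addnS p q) pq)).
  rewrite fam_d_cyc /= !ihE => <-; rewrite /bnd_comp_fam.
  by case: p {pq} => [|p] /=; rewrite ?linear0 // ihE ch_d_co_cyc_in ihom0l.
have [s sE] := ihom_factor (@pker_in_mono _ _ _ _ _ (co_d L j)) (@co_cyc_in_exact _ _ _ L j) (Ycyc i j ij).
exists ((-1) ^+ (i + j + 1)%N *: ih (pid _) (co_cl L j) y s).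
have [w wE] := fam_dL_cyc Y i.+1 j.
have E : ih (ch_d_co K i) (pid _) y (V (i, j)) = (-1) ^+ (i + j + 1)%N *:
    ih (pmcomp (ch_bnd_in K i) (ch_d_co K i)) (pid _) y s + ih (pid _) (co_d_cyc L j) y w.
  apply: ihom_cyc_inj; rewrite linearD linearZ /= -wE !ihE.
  rewrite -[LHS]/(bnd_comp_fam V i.+1 j) (YE i.+1 j ij) /fam_d /=.
  congr (_ *: _ + _); rewrite -ch_dE.
  by rewrite -[pid (L j)]pmcomp1f -ihom_ihom -sE !ihE.
apply: ihom_bnd_inj; rewrite linearZ /= !ihE.
have := congr1 (ih (pid _) (co_cl L j) y) E; rewrite linearD linearZ /= !ihE.
by rewrite co_cl_d_cyc ihom0r addr0 => ->; rewrite linearZ /= !ihE.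
Qed.

Lemma kunneth_out_in : pmcomp (kunneth_out phi K L n) (kunneth_in phi L n hK) = 0.
Proof.
apply: (pepi_cancel (connecting_prod_epi hK (L := L) (phi := phi) (n := n))).
rewrite -pmcompA kunneth_inE pmcompA kunneth_outE pmcomp0f.
apply: (pmono_cancel (cl_hom_mono (phi := phi) (K := K) (L := L) (n := n))).
rewrite pmcompA out_homE pmcompf0 -pmcompA.
suff -> : pmcomp (out_cyc phi K L n) (bnd_to_cyc phi K L n) = 0 by rewrite pmcompf0.
apply: (pmono_cancel (incl_cyc_mono (phi := phi) (K := K) (L := L) (n := n))).
rewrite pmcompA out_cycE pmcompf0 -pmcompA bnd_to_cycE; apply: pmorP => y V.
rewrite pmcompE bnd_totE; apply: pprod_eq => -[[p q] e].
rewrite -[LHS]/(ih (ch_cyc_in K p) (pid _) y (bnd_comp_fam V p q)).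
case: p e => [|p] e; rewrite /bnd_comp_fam /=; first by rewrite linear0.
by rewrite ihE ch_d_co_cyc_in ihom0l.
Qed.

(** A cocycle in the kernel has boundaries as values on cycles. Lifting these values
    and extending along the retraction gives a cochain whose coboundary agrees with
    the cocycle on cycles; the difference factors through [K_(i+1) -> B_i]. *)
Lemma kunneth_out_ker y c : kunneth_out phi K L n y c = 0 ->
  exists e, kunneth_in phi L n hK y e = c.
Proof.
have [z <-] := @hclass_epi _ _ _ _ _ _ _ _ y c.
rewrite -[LHS in LHS = _ -> _]/(pmcomp (kunneth_out phi K L n) (tot_cl phi K L n) y z).
rewrite kunneth_outE => /(congr1 (cl_hom phi K L n y)).
rewrite linear0 -[LHS in LHS = _ -> _]/(pmcomp (cl_hom phi K L n) (out_hom phi K L n) y z).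
rewrite out_homE pmcompE => oz0.
have [U [zU U0]] := tot_cyc_fam z.
have wex p q : exists w : ihom phi (ch_cyc K p) (prev_term L q) y, (p + q = n)%N ->
    ih (pid _) (co_in L q) y w = ih (ch_cyc_in K p) (pid _) y (U p q).
  have [/eqP e|h] := pselect (p + q = n)%N; last by exists 0.
  have E : ih (pid _) (co_cl L q) y (out_cyc phi K L n y z (exist _ (p, q) e)) = 0.
    exact: (congr1 (fun t : pprod (fun pq : bideg n =>
      ihom phi (ch_cyc K (sval pq).1) (cohlgy L (sval pq).2)) y => t (exist _ (p, q) e)) oz0).
  have [w wE] := ihom_lift_exact (cycP p) (@co_d_cyc_exact _ _ _ L q) E.
  exists w => _; rewrite -(out_cyc_fam e zU) -wE !ihE.
  by rewrite co_d_cycE.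
pose w p q := sval (cid (wex p q)).
have wE p q : (p + q = n)%N ->
    ih (pid _) (co_in L q) y (w p q) = ih (ch_cyc_in K p) (pid _) y (U p q).
  exact: (svalP (cid (wex p q))).
pose Y : @fam _ _ _ phi K L y := fun p q => ih (r p) (pid _) y (w p q.+1).
pose U' : @fam _ _ _ phi K L y := fun p q => U p q + - fam_d Y p q.
have U'd p q : (p + q = n.+1)%N -> fam_d U' p q = 0.
  by move=> pq; rewrite fam_dD fam_dN fam_dd U0 // subrr.
have U'cyc p q : (p + q = n)%N -> ih (ch_cyc_in K p) (pid _) y (U' p q) = 0.
  move=> pq; rewrite /U' linearB /= fam_d_cyc -wE //.
  apply/eqP; rewrite subr_eq0; apply/eqP; case: q {pq} => [|q] /=.
    by rewrite ihom0r linear0.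
  by rewrite /Y !ihE ch_retractK.
have vex i j : exists v : ihom phi (ch_bnd K i) (co_cyc L j) y, ((i + j).+1 = n)%N ->
    ih (ch_d_co K i) (co_cyc_in L j) y v = U' i.+1 j.
  have [ij|h] := pselect ((i + j).+1 = n)%N; last by exists 0.
  have [v' v'E] := ihom_descend (@pim_co_epi _ _ _ _ _ (ch_d K i)) (@ch_cyc_in_exact _ _ _ K i)
    (U'cyc i.+1 j ij).
  have v'0 : ih (pid _) (co_d L j) y v' = 0.
    apply: ihom_bnd_inj; rewrite linear0.
    have := U'd i.+1 j.+1; rewrite addnS addSn ij => /(_ erefl); rewrite /fam_d /=.
    have -> : ih (ch_d K i) (pid _) y (U' i j.+1) = 0.
      rewrite -ch_dE -[pid (L j.+1)]pmcomp1f -ihom_ihom U'cyc ?linear0 //.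
      by rewrite addnS.
    by rewrite scaler0 add0r -v'E !ihE.
  have [v vE] := ihom_factor (@pker_in_mono _ _ _ _ _ (co_d L j)) (@co_cyc_in_exact _ _ _ L j) v'0.
  by exists v => _; rewrite -v'E -vE !ihE.
pose V : bnd_prod phi K L y := fun ij => sval (cid (vex ij.1 ij.2)).
have VE i j : ((i + j).+1 = n)%N -> ih (ch_d_co K i) (co_cyc_in L j) y (V (i, j)) = U' i.+1 j.
  exact: (svalP (cid (vex i j))).
exists (connecting_prod phi K L n y V).
rewrite -[LHS]/(pmcomp (kunneth_in phi L n hK) (connecting_prod phi K L n) y V) kunneth_inE.
rewrite pmcompE; apply: hclass_eq; rewrite -/(tot_cyc_in phi K L n).
rewrite -[tot_cyc_in _ _ _ _ _ (bnd_to_cyc _ _ _ _ _ _)]/(pmcomp (tot_cyc_in phi K L n) (bnd_to_cyc phi K L n) y V).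
rewrite bnd_to_cycE bnd_totE zU.
have [a aE] : exists a, co_in (tot phi K L) n y a = tot_of n (fam_d (fun p q => - Y p q)).
  by apply/tot_bnd; exists (fun p q => - Y p q).
exists a; rewrite aE; apply: pprod_eq => -[[p q] e].
rewrite -[LHS]/(bnd_comp_fam V p q) -[RHS]/(U p q + fam_d (fun p q => - Y p q) p q) fam_dN.
rewrite -/(U' p q); case: p e => [|p] e; last exact: (VE p q (eqP e)).
rewrite /bnd_comp_fam /=; apply: (@ihom_mono _ _ _ phi _ _ _ _ (ch_cyc_in K 0) (pid (L q))).
- exact: ch_cyc_in0_epi.
- exact: pid_mono.
- by rewrite linear0 U'cyc // (eqP e).
Qed.

(** [kunneth_out] sees of a cocycle only its restriction to the cycles of [K]. *)
Lemma kunneth_out_lift y (s : forall p q, ihom phi (ch_cyc K p) (co_cyc L q) y)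
    (h : hom_term phi n K L y) (U : @fam _ _ _ phi K L y) :
  (forall p q (e : (p + q == n)%N), ih (pid _) (co_cl L q) y (s p q) =
     ih (ch_cl K p) (pid _) y (h (exist _ (p, q) e))) ->
  (forall p q, (p + q = n)%N -> ih (ch_cyc_in K p) (pid _) y (U p q) = ih (pid _) (co_cyc_in L q) y (s p q)) ->
  forall z, tot_cyc_in phi K L n y z = tot_of n U ->
  kunneth_out phi K L n y (tot_cl phi K L n y z) = h.
Proof.
move=> sh Us z zU; rewrite -[LHS]/(pmcomp (kunneth_out phi K L n) (tot_cl phi K L n) y z).
rewrite kunneth_outE; apply: cl_hom_mono.
rewrite -[LHS]/(pmcomp (cl_hom phi K L n) (out_hom phi K L n) y z) out_homE pmcompE.
apply: pprod_eq => -[[p q] e].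
rewrite -[LHS]/(ih (pid _) (co_cl L q) y (out_cyc phi K L n y z (exist _ (p, q) e))).
rewrite -[RHS]/(ih (ch_cl K p) (pid _) y (h (exist _ (p, q) e))) -sh; congr (ih _ _ _ _).
by apply: ihom_cyc_inj; rewrite (out_cyc_fam e zU) Us // (eqP e).
Qed.

(** A map [H_p -> H^q] lifts to [s : Z_p -> Z^q], but [s] composed with the retraction
    is not a cocycle: its coboundary is [s] on boundaries. As this dies in [H^q], it
    lifts to [w], and the cochain defined by [w] cancels it. *)
Lemma kunneth_out_epi : pepi (kunneth_out phi K L n).
Proof.
move=> y h.
have sex p q : exists s : ihom phi (ch_cyc K p) (co_cyc L q) y,
    ih (ch_bnd_in K p) (co_cl L q) y s = 0 /\
    forall e : (p + q == n)%N, ih (pid _) (co_cl L q) y s =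
     ih (ch_cl K p) (pid _) y (h (exist _ (p, q) e)).
  have [e|ne] := pselect (p + q == n)%N; last by exists 0; split; [rewrite linear0|].
  have [s sE] := ihom_lift (phi := phi) (cycP p) (@co_cl_epi _ _ _ L q)
    (ih (ch_cl K p) (pid _) y (h (exist _ (p, q) e))).
  exists s; split=> [|e']; last by rewrite (bool_irrelevance e' e).
  have := congr1 (ih (ch_bnd_in K p) (pid _) y) sE; rewrite !ihE => ->.
  have -> : pmcomp (ch_cl K p) (ch_bnd_in K p) = 0; last by rewrite ihom0l.
  have [_ ex _] := ch_cl_exact K p.
  by apply: pmorP => x b; apply/ex; exists b.
pose s p q := sval (cid (sex p q)).
have sB p q : ih (ch_bnd_in K p) (co_cl L q) y (s p q) = 0 := (svalP (cid (sex p q))).1.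
have sE p q (e : (p + q == n)%N) := (svalP (cid (sex p q))).2 e.
have wex p q : exists w : ihom phi (ch_bnd K p) (prev_term L q) y,
    ih (pid _) (co_d_cyc L q) y w = ih (ch_bnd_in K p) (pid _) y (s p q).
  apply: (ihom_lift_exact (hK.2 p) (@co_d_cyc_exact _ _ _ L q)).
  by rewrite !ihE.
pose w p q := sval (cid (wex p q)).
have wE p q : ih (pid _) (co_d_cyc L q) y (w p q) = ih (ch_bnd_in K p) (pid _) y (s p q).
  exact: (svalP (cid (wex p q))).
(* the sign in [t] undoes that of [cyc_fam], so that [U] restricts to [s] on cycles;
   the sign in [w'] makes the two coboundaries opposite *)
pose t p q := (-1) ^+ (p + q + 1)%N *: s p q.
pose w' p q := - ((-1) ^+ (p + q + 1)%N *: w p q).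
pose U : @fam _ _ _ phi K L y := fun p q => cyc_fam hK t p q + bnd_lift_fam w' p q.
have Ud p q : fam_d U p q = 0.
  rewrite fam_dD cyc_fam_d bnd_lift_fam_d; case: p => [|p]; first by rewrite addr0.
  rewrite -linearD /=.
  have -> : ih (ch_bnd_in K p) (pid _) y (t p q) + ih (pid _) (co_d_cyc L q) y (w' p q) = 0.
    rewrite /t /w' linearN linearZ /= [ih (pid _) (co_d_cyc L q) _ _]linearZ /= wE.
    exact: subrr.
  exact: linear0.
have [z zU] := fam_tot_cyc (n := n) (fun p q _ => Ud p q).
exists (tot_cl phi K L n y z); apply: (kunneth_out_lift sE _ zU) => p q _.
have -> : U p q = ih (r p) (co_cyc_in L q) y (s p q) + bnd_lift_fam w' p q.
  by rewrite /U /cyc_fam /t linearZ /= signrZK.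
rewrite linearD /= !ihE ch_retractK.
case: p => [|p] /=; first by rewrite linear0 addr0.
by rewrite !ihE ch_d_co_cyc_in ihom0l addr0.
Qed.

Lemma kunneth_exact : short_exact (kunneth_in phi L n hK) (kunneth_out phi K L n).
Proof.
split; [exact: kunneth_in_mono| |exact: kunneth_out_epi].
move=> y c; split; first exact: kunneth_out_ker.
by case=> e <-; exact: (pmor_app kunneth_out_in).
Qed.

(** The maps [K -> H(K)] given by the retraction and [H(L) -> L] given by the section
    are chain maps for the zero differential on homology, so composing with them
    produces cocycles. *)
Lemma kunneth_split : inj_with_bnd L ->
  exists s, pmcomp (kunneth_out phi K L n) s = pid _.
Proof.
move=> hL; pose sg q := sval (co_section (hL.2 q)).
have sgK q : pmcomp (co_cl L q) (sg q) = pid _ := svalP (co_section (hL.2 q)).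
pose c : pmor (hom_term phi n K L) (tot_obj phi K L n) := pprod_mor (fun pq : bideg n =>
  ih (pmcomp (ch_cl K (sval pq).1) (r (sval pq).1)) (pmcomp (co_cyc_in L (sval pq).2) (sg (sval pq).2))).
pose cf y (h' : forall p q, ihom phi (hlgy K p) (cohlgy L q) y) : @fam _ _ _ phi K L y :=
  fun p q => ih (pmcomp (ch_cl K p) (r p)) (pmcomp (co_cyc_in L q) (sg q)) y (h' p q).
have cE y (h : hom_term phi n K L y) : exists h' : forall p q, ihom phi (hlgy K p) (cohlgy L q) y,
    (forall p q (e : (p + q == n)%N), h (exist _ (p, q) e) = h' p q) /\ c y h = tot_of n (cf y h').
  have [h' hh'] := bideg_extend (G := fun p q => ihom phi (hlgy K p) (cohlgy L q) y) h.
  exists h'; split=> [p q e|]; first by rewrite hh'.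
  apply: pprod_eq => -[[p q] e].
  by rewrite -[LHS]/(ih _ _ y (h (exist _ (p, q) e))) hh'.
have [|c' c'E] := @pker_factor _ _ _ _ _ _ (co_d (tot phi K L) n) c.
  apply: pmorP => y h; have [h' [_ ch]] := cE y h.
  rewrite pmcompE ch tot_d_of.
  apply: (proj2 (@tot_of_eq _ _ _ _ _ _ _ _ _ (fun _ _ => 0))) => p q _.
  have clr i : pmcomp (pmcomp (ch_cl K i) (r i)) (ch_d K i) = 0.
    rewrite -pmcompA ch_retract_d pmcompA; have [_ ex _] := ch_cl_exact K i.
    by apply: pmorP => x b; apply/ex; eexists.
  rewrite /fam_d; case: p => [|p] /=; [rewrite add0r|rewrite ihE clr ihom0l scaler0 add0r];
    by case: q => [|q] //=; rewrite ihE pmcompA co_d_cyc_in pmcomp0f ihom0r.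
exists (pmcomp (tot_cl phi K L n) c'); apply: pmorP => y h.
have [h' [hh' ch]] := cE y h.
apply: (@kunneth_out_lift y (fun p q => ih (ch_cl K p) (sg q) y (h' p q)) h (cf y h')).
- by move=> p q e; rewrite !ihE sgK hh'.
- by move=> p q _; rewrite /cf !ihE -pmcompA ch_retractK pmcompf1.
- by rewrite -ch -c'E.
Qed.

End Exact.

(** * Naturality *)

Section Naturality.
Context (k : fieldType) (d : Order.disp_t) (P : porderType d).
Context (phi : {omorphism (P *p P)%type -> P}).
Context (K K' : chain k P) (L L' : cochain k P) (n : nat).
Context (f : chain_map K' K) (g : cochain_map L L').
Local Notation ih := (ihom_mor phi).

Definition tot_cyc_mor : pmor (tot_cyc phi K L n) (tot_cyc phi K' L' n) :=
  pker_mor (com_comm (tot_cochain_map phi f g) n).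

Lemma tot_cyc_in_mor :
  pmcomp (tot_cyc_in phi K' L' n) tot_cyc_mor = pmcomp (tot_mor phi f g n) (tot_cyc_in phi K L n).
Proof. exact: pker_in_morE. Qed.

Lemma tot_cl_mor :
  pmcomp (mid_term_mor phi n f g) (tot_cl phi K L n) = pmcomp (tot_cl phi K' L' n) tot_cyc_mor.
Proof. exact: hclass_mor. Qed.

Lemma out_cyc_mor : pmcomp (out_cyc phi K' L' n) tot_cyc_mor =
  pmcomp (pprod_mor (fun pq : bideg n => ih (ch_cyc_mor f (sval pq).1) (co_cyc_mor g (sval pq).2)))
    (out_cyc phi K L n).
Proof.
apply: (pmono_cancel (incl_cyc_mono (phi := phi) (K := K') (L := L') (n := n))).
rewrite pmcompA out_cycE -pmcompA tot_cyc_in_mor; apply: pmorP => y z.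
have [U [zU _]] := tot_cyc_fam z.
rewrite !pmcompE zU; apply: pprod_eq => -[[p q] e].
rewrite -[LHS]/(ih (ch_cyc_in K' p) (pid _) y (ih (f p) (g q) y (U p q))).
rewrite -[RHS]/(ih (pid _) (co_cyc_in L' q) y (ih (ch_cyc_mor f p) (co_cyc_mor g q) y
  (out_cyc phi K L n y z (exist _ (p, q) e)))).
rewrite !ihE co_cyc_in_mor -ch_cyc_in_mor -[g q in LHS]pmcompf1 -ihom_ihom -(out_cyc_fam e zU).
by rewrite !ihE.
Qed.

Lemma cl_hom_mor y (h : hom_term phi n K L y) :
  cl_hom phi K' L' n y (hom_term_mor phi n f g y h) =
  pprod_mor (fun pq : bideg n => ih (ch_cyc_mor f (sval pq).1) (cohlgy_mor g (sval pq).2)) y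
    (cl_hom phi K L n y h).
Proof.
apply: pprod_eq => -[[p q] e].
rewrite -[LHS]/(ih (ch_cl K' p) (pid _) y (ih (hlgy_mor f p) (cohlgy_mor g q) y (h (exist _ (p, q) e)))).
rewrite -[RHS]/(ih (ch_cyc_mor f p) (cohlgy_mor g q) y (ih (ch_cl K p) (pid _) y (h (exist _ (p, q) e)))).
by rewrite !ihE ch_cl_mor.
Qed.

Lemma cl_cyc_mor y h :
  cl_cyc phi K' L' n y
    (pprod_mor (fun pq : bideg n => ih (ch_cyc_mor f (sval pq).1) (co_cyc_mor g (sval pq).2)) y h) =
  pprod_mor (fun pq : bideg n => ih (ch_cyc_mor f (sval pq).1) (cohlgy_mor g (sval pq).2)) y
    (cl_cyc phi K L n y h).
Proof.
apply: pprod_eq => -[[p q] e].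
rewrite -[RHS]/(ih (ch_cyc_mor f p) (cohlgy_mor g q) y (ih (pid _) (co_cl L q) y (h (exist _ (p, q) e)))).
rewrite -[LHS]/(ih (pid _) (co_cl L' q) y (ih (ch_cyc_mor f p) (co_cyc_mor g q) y (h (exist _ (p, q) e)))).
by rewrite !ihE co_cl_mor.
Qed.

Lemma kunneth_out_nat :
  pmcomp (hom_term_mor phi n f g) (kunneth_out phi K L n) =
  pmcomp (kunneth_out phi K' L' n) (mid_term_mor phi n f g).
Proof.
apply: pmorP => y c; have [z <-] := @hclass_epi _ _ _ _ _ _ _ _ y c.
rewrite -/(tot_cl phi K L n) [LHS]pmcompE [RHS]pmcompE.
have outE (K1 : chain k P) (L1 : cochain k P) z1 : kunneth_out phi K1 L1 n y (tot_cl phi K1 L1 n y z1) = out_hom phi K1 L1 n y z1.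
  exact: (pmor_app (kunneth_outE phi K1 L1 n)).
have clE (K1 : chain k P) (L1 : cochain k P) z1 : cl_hom phi K1 L1 n y (out_hom phi K1 L1 n y z1) =
    cl_cyc phi K1 L1 n y (out_cyc phi K1 L1 n y z1).
  exact: (pmor_app (out_homE phi K1 L1 n)).
have -> : mid_term_mor phi n f g y (tot_cl phi K L n y z) = tot_cl phi K' L' n y (tot_cyc_mor y z).
  exact: (pmor_app tot_cl_mor).
rewrite (outE K L z) (outE K' L' (tot_cyc_mor y z)).
apply: (cl_hom_mono (phi := phi) (K := K') (L := L') (n := n)).
apply: etrans (cl_hom_mor _) _; apply: esym; apply: etrans (clE _ _ _) _.
apply: etrans (congr1 (cl_cyc phi K' L' n y) (@pmor_app _ _ _ _ _ _ _ out_cyc_mor y z)) _.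
by apply: etrans (cl_cyc_mor _) _; apply: congr1; exact: (esym (clE K L z)).
Qed.

Definition bnd_prod_mor : pmor (bnd_prod phi K L) (bnd_prod phi K' L') :=
  pprod_mor (fun pq : nat * nat => ih (ch_bnd_mor f pq.1) (co_cyc_mor g pq.2)).

Lemma bnd_to_cyc_mor :
  pmcomp tot_cyc_mor (bnd_to_cyc phi K L n) = pmcomp (bnd_to_cyc phi K' L' n) bnd_prod_mor.
Proof.
apply: (pmono_cancel (@pker_in_mono _ _ _ _ _ (co_d (tot phi K' L') n))).
rewrite -/(tot_cyc_in phi K' L' n) !pmcompA tot_cyc_in_mor bnd_to_cycE -pmcompA bnd_to_cycE.
apply: pmorP => y V; apply: pprod_eq => -[[p q] e].
rewrite -[LHS]/(ih (f p) (g q) y (bnd_comp_fam V p q)) -[RHS]/(bnd_comp_fam (bnd_prod_mor y V) p q).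
case: p e => [|p] e; rewrite /bnd_comp_fam; first by rewrite linear0.
rewrite -[bnd_comp _ _ _ _ _ _ _ in LHS]/(ih (ch_d_co K p) (co_cyc_in L q) y (V (p, q))).
rewrite -[RHS]/(ih (ch_d_co K' p) (co_cyc_in L' q) y (ih (ch_bnd_mor f p) (co_cyc_mor g q) y (V (p, q)))).
by rewrite !ihE ch_d_co_mor co_cyc_in_mor.
Qed.

Lemma connecting_prod_mor :
  pmcomp (ext_term_mor phi n f g) (connecting_prod phi K L n) = pmcomp (connecting_prod phi K' L' n) bnd_prod_mor.
Proof.
apply: pmorP => y V; apply: pprod_eq => -[[i j] e].
rewrite -[LHS]/(Ext_mor phi 1 (hlgy_mor f i) (cohlgy_mor g j) y
  (hlgy_connecting phi K i _ y (ih (pid _) (co_cl L j) y (V (i, j))))).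
rewrite -[RHS]/(hlgy_connecting phi K' i _ y (ih (pid _) (co_cl L' j) y
  (ih (ch_bnd_mor f i) (co_cyc_mor g j) y (V (i, j))))).
have E := connecting_nat phi (ch_cl_exact K i) (svalP (hlgy_lift_ex K i)) (ch_cl_exact K' i)
  (svalP (hlgy_lift_ex K' i)) (cohlgy_mor g j) (ch_bnd_in_mor f i) (esym (ch_cl_mor f i)).
have := @pmor_app _ _ _ _ _ _ _ E y (ih (pid _) (co_cl L j) y (V (i, j))).
rewrite !pmcompE -/(hlgy_connecting phi K i _) -/(hlgy_connecting phi K' i _) => ->.
by rewrite !ihE co_cl_mor.
Qed.

Lemma kunneth_in_nat (hK : proj_with_bnd K) (hK' : proj_with_bnd K') :
  pmcomp (mid_term_mor phi n f g) (kunneth_in phi L n hK) =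
  pmcomp (kunneth_in phi L' n hK') (ext_term_mor phi n f g).
Proof.
apply: pmorP => y e; have [V <-] := connecting_prod_epi hK e.
rewrite [LHS]pmcompE [RHS]pmcompE.
have inE (K1 : chain k P) (hK1 : proj_with_bnd K1) (L1 : cochain k P) V1 : kunneth_in phi L1 n hK1 y (connecting_prod phi K1 L1 n y V1) =
    tot_cl phi K1 L1 n y (bnd_to_cyc phi K1 L1 n y V1).
  exact: (pmor_app (kunneth_inE phi L1 n hK1)).
have -> : ext_term_mor phi n f g y (connecting_prod phi K L n y V) = connecting_prod phi K' L' n y (bnd_prod_mor y V).
  exact: (pmor_app connecting_prod_mor).
rewrite !inE.
have <- : tot_cyc_mor y (bnd_to_cyc phi K L n y V) = bnd_to_cyc phi K' L' n y (bnd_prod_mor y V).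
  exact: (pmor_app bnd_to_cyc_mor).
exact: (pmor_app tot_cl_mor).
Qed.

End Naturality.

Lemma kunneth (k : fieldType) (d : Order.disp_t) (P : porderType d)
    (phi : {omorphism (P *p P)%type -> P}) n :
  exists S : kunneth_ses k phi n, splits_when_injective S.
Proof.
exists (KunnethSES (ses_in := fun K hK L => kunneth_in phi L n hK)
  (ses_out := fun K _ L => kunneth_out phi K L n)
  (fun K hK L => kunneth_exact phi L n hK)
  (fun K hK K' hK' L L' f g => kunneth_in_nat phi n f g hK hK')
  (fun K _ K' _ L L' f g => kunneth_out_nat phi n f g)) => K hK L.
exact: kunneth_split.
Qed.

(** * Extension of linear maps *)

Section LinearExtension.
Context (k : fieldType) (U V W : lmodType k) (m : {linear U -> V}) (f : {linear U -> W}).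
Context (m_inj : injective m).

Definition linear_graph (A : set (V * W)) : Prop :=
  (forall a v w v' w', A (v, w) -> A (v', w') -> A (a *: v + v', a *: w + w')) /\
  (forall w, A (0, w) -> w = 0).

(** Containment of the graph to be extended is asked only of nonempty sets: Zorn's
    lemma also considers the empty chain, whose union is empty. *)
Definition extends_graph (A : set (V * W)) : Prop :=
  linear_graph A /\ forall x u, A x -> A (m u, f u).

Lemma linear_extension : exists g : {linear V -> W}, forall u, g (m u) = f u.
Proof.
have [|A [[[Alin Afun] Aext] Amax]] := @Zorn_bigcup _ extends_graph.
  move=> F FP Ftot; split; last by move=> x u [X FX Xx]; exists X => //; exact: (FP X FX).2 Xx.
  split=> [a v w v' w' [X FX Xv] [Y FY Yv]|w [X FX]]; last exact: (FP X FX).1.2.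
  have [XY|YX] := Ftot X Y FX FY.
    by exists Y => //; apply: (FP Y FY).1.1 => //; exact: XY.
  by exists X => //; apply: (FP X FX).1.1 => //; exact: YX.
have [x Ax] : exists x, A x.
  apply: contrapT => nA; apply: (Amax (fun x => exists u, x = (m u, f u))).
    split=> [x Ax|/(_ (m 0, f 0))]; first by case: nA; exists x.
    by move=> A0; apply: nA; exists (m 0, f 0); apply: A0; exists 0.
  split; last by move=> _ u _; exists u.
  split=> [a v w v' w' [u [-> ->]] [u' [-> ->]]|w [u [mu ->]]].
    by exists (a *: u + u'); rewrite !linearP.
  by have -> : u = 0; [apply: m_inj; rewrite linear0|rewrite linear0].
have A0 : A (0, 0) by have := Aext x 0 Ax; rewrite !linear0.
have Adom v : exists w, A (v, w).
  apply: contrapT => nv.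
  (* extend the graph to the span of its domain and [v], with value 0 at [v] *)
  pose B : set (V * W) := fun x => exists c v', x.1 = v' + c *: v /\ A (v', x.2).
  apply: (Amax B).
    split=> [[v1 w1] Av|/(_ (v, 0)) BA].
      by exists 0, v1; rewrite scale0r addr0.
    by apply: nv; exists 0; apply: BA; exists 1, 0; rewrite scale1r add0r.
  split; last first.
    by move=> _ u _; exists 0, (m u); rewrite scale0r addr0; split=> //; exact: Aext Ax.
  split=> [a v1 w1 v2 w2 [c1 [u1 /= [-> Au1]]] [c2 [u2 /= [-> Au2]]]|w [c [u /= [uE Au]]]].
    exists (a * c1 + c2), (a *: u1 + u2); split; last exact: Alin.
    by rewrite /= scalerDr scalerDl scalerA addrACA.
  have [c0|c0] := eqVneq c 0.
    by apply: Afun; move: uE Au; rewrite c0 scale0r addr0 => <-.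
  case: nv; exists (- c^-1 *: w + 0).
  have <- : - c^-1 *: u + 0 = v; last exact: Alin.
  have -> : u = - (c *: v) by apply/eqP; rewrite -addr_eq0 -uE.
  by rewrite addr0 scalerN scaleNr opprK scalerA mulVf // scale1r.
pose g v := sval (cid (Adom v)).
have gE v : A (v, g v) := svalP (cid (Adom v)).
have Auniq v w w' : A (v, w) -> A (v, w') -> w = w'.
  move=> Aw Aw'; apply/esym/eqP; rewrite -subr_eq0; apply/eqP/Afun.
  by have := Alin (-1) _ _ _ _ Aw Aw'; rewrite !scaleN1r addNr addrC.
have glin : linear g.
  by move=> a v v'; apply: Auniq (gE _) _; exact: Alin (gE v) (gE v').
by exists (mklin glin) => u; apply: Auniq (gE _) _; exact: Aext Ax.
Qed.

End LinearExtension.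

(** * The effect of a natural splitting *)

Section ZeroModules.
Context (k : fieldType) (d : Order.disp_t) (P : porderType d).
Implicit Types M N A B : pmod k P.

Definition pm_zero M := forall p (x : M p), x = 0.

Lemma pzero_zero : pm_zero (pzero k P).
Proof. by move=> p x; apply: functional_extensionality_dep => -[]. Qed.

Lemma pim0_zero A B : pm_zero (pim (0 : pmor A B)).
Proof.
move=> p x; have [a xE] := pim_inP x.
by apply: (@pim_in_mono _ _ _ _ _ (0 : pmor A B)); rewrite -xE linear0.
Qed.

Lemma zero_projective M : pm_zero M -> projective_pm M.
Proof.
move=> M0 A B e f _; exists 0; rewrite pmcompf0.
by apply: pmorP => p x; rewrite (M0 p x) !linear0.
Qed.

Lemma zero_injective M : pm_zero M -> injective_pm M.
Proof.
move=> M0 A B e f _; exists 0; rewrite pmcomp0f.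
by apply: pmorP => p x; rewrite (M0 p (f p x)).
Qed.

Lemma pim_mono_projective A B (f : pmor A B) :
  pmono f -> projective_pm A -> projective_pm (pim f).
Proof.
move=> fm; have [|i iE] := @pepi_descend _ _ _ _ _ _ (pim_co f) (pid A) (@pim_co_epi _ _ _ _ _ f).
  move=> p a fa; apply: (fm p); rewrite linear0 -(pim_in_co f) pmcompE fa.
  exact: linear0.
apply: (@retract_projective _ _ _ _ _ i (pim_co f)).
apply: (pepi_cancel (@pim_co_epi _ _ _ _ _ f)).
by rewrite -pmcompA iE pmcompf1 pmcomp1f.
Qed.

Lemma pim_epi_injective A B (f : pmor A B) :
  pepi f -> injective_pm B -> injective_pm (pim f).
Proof.
move=> fe; have [|r rE] := @pmono_factor _ _ _ _ _ _ (pim_in f) (pid B) (@pim_in_mono _ _ _ _ _ f).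
  move=> p b; have [a <-] := fe p b; exists (pim_co f p a).
  exact: (pmor_app (pim_in_co f)).
apply: (@retract_injective _ _ _ _ _ (pim_in f) r).
apply: (pmono_cancel (@pim_in_mono _ _ _ _ _ f)).
by rewrite pmcompA rE pmcompf1 pmcomp1f.
Qed.

End ZeroModules.

(** The standard resolution does not send the zero map to zero, only to a map homotopic
    to zero. By [connecting_nat] the zero maps on the first syzygy and on the cover
    compute the same map. *)
Lemma Ext_mor0 (k : fieldType) (d : Order.disp_t) (P : porderType d)
    (phi : {omorphism (P *p P)%type -> P}) (M M' N N' : pmod k P) (g : pmor N N') :
  Ext_mor phi 1 (0 : pmor M' M) g = 0.
Proof.
have [a [b ab]] := res_lift_ex (syz_short_exact M).
have [a' [b' ab']] := res_lift_ex (syz_short_exact M').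
apply: (pepi_cancel (connecting_epi (phi := phi) (syz_short_exact M) ab (@pfree_projective _ _ _ M) (N := N))).
rewrite (connecting_nat phi (syz_short_exact M) ab (syz_short_exact M') ab' g (fB := 0) (fZ := 0)).
- by rewrite ihom_mor0f pmcompf0 pmcomp0f.
- by rewrite pmcomp0f pmcompf0.
- by rewrite pmcomp0f pmcompf0.
Qed.

(** The middle term is the sum of the images of [ses_in] and of the section. A chain
    map that is zero on homology is zero on the outer terms, so by naturality it
    kills both images. *)
Lemma natural_splitting_kills (k : fieldType) (d : Order.disp_t) (P : porderType d)
    (phi : {omorphism (P *p P)%type -> P}) n (S : kunneth_ses k phi n)
    (K K' : chain k P) (L : cochain k P) (f : chain_map K' K) (g : cochain_map L L) :
  proj_with_bnd K -> proj_with_bnd K' -> inj_with_bnd L ->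
  (forall i, hlgy_mor f i = 0) -> splits_naturally S ->
  mid_term_mor phi n f g = 0.
Proof.
move=> hK hK' hL f0 [s [sK snat]].
have ext0 : ext_term_mor phi n f g = 0.
  apply: pprod_ext => i; rewrite pmcompf0; apply: pmorP => p x.
  rewrite -[LHS]/(Ext_mor phi 1 (hlgy_mor f (sval i).1) (cohlgy_mor g (sval i).2) p (x i)).
  by rewrite f0 Ext_mor0.
have hom0 : hom_term_mor phi n f g = 0.
  apply: pprod_ext => i; rewrite pmcompf0; apply: pmorP => p x.
  rewrite -[LHS]/(ihom_mor phi (hlgy_mor f (sval i).1) (cohlgy_mor g (sval i).2) p (x i)).
  by rewrite f0 ihom_mor0f.
apply: pmorP => p c; set o := ses_out S hK L.
have [_ ex _] := ses_exact S hK L.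
have [e eE] : exists e, ses_in S hK L p e = c - s K hK L hL p (o p c).
  apply/ex; rewrite linearB /= -/o.
  have -> : o p (s K hK L hL p (o p c)) = o p c by exact: (pmor_app (sK K hK L hL)).
  exact: subrr.
have -> : c = ses_in S hK L p e + s K hK L hL p (o p c) by rewrite eE subrK.
rewrite linearD /=.
have -> : mid_term_mor phi n f g p (ses_in S hK L p e) = 0.
  have := @pmor_app _ _ _ _ _ _ _ (ses_in_nat S hK hK' f g) p e.
  by rewrite ext0 pmcompf0.
have -> : mid_term_mor phi n f g p (s K hK L hL p (o p c)) = 0.
  have := @pmor_app _ _ _ _ _ _ _ (snat K hK K' hK' L hL L hL f g) p (o p c).
  by rewrite hom0 pmcompf0.
exact: addr0.
Qed.

(** * A sequence without natural splitting *)

Section Arrow.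
Context (k : fieldType).

Fact zero_lin_subproof (V W : lmodType k) : linear (fun _ : V => 0 : W).
Proof. by move=> a x y; rewrite scaler0 addr0. Qed.
Definition zero_lin (V W : lmodType k) : {linear V -> W} := mklin (@zero_lin_subproof V W).

Section Obj.
Context (V W : lmodType k) (f : {linear V -> W}).
Definition arrow_obj (p : bool) : lmodType k := if p then W else V.
Definition arrow_map (p q : bool) (h : (p <= q)%O) : {linear arrow_obj p -> arrow_obj q} :=
  match p, q return {linear arrow_obj p -> arrow_obj q} with
  | false, false => idlin V
  | false, true => f
  | true, false => zero_lin W V
  | true, true => idlin W
  end.
Fact arrow_id p (h : (p <= p)%O) x : arrow_map h x = x.
Proof. by case: p h x. Qed.
Fact arrow_comp p q r (h1 : (p <= q)%O) (h2 : (q <= r)%O) (h3 : (p <= r)%O) x :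
  arrow_map h2 (arrow_map h1 x) = arrow_map h3 x.
Proof. by case: p q r h1 h2 h3 x => -[] []. Qed.
(** Over [false < true] a persistence module is a linear map. *)
Definition arrow : pmod k bool := Pmod arrow_id arrow_comp.
End Obj.

Lemma le01 : (false <= true :> bool)%O. Proof. by []. Qed.

Section ToFrom.
Context (A B : pmod k bool) (a : {linear A false -> B false}) (b : {linear A true -> B true}).
Context (sq : forall x, b (pm_map A le01 x) = pm_map B le01 (a x)).
Definition bool_fun (p : bool) : {linear A p -> B p} :=
  match p return {linear A p -> B p} with true => b | false => a end.
Fact bool_fun_nat p q (h : (p <= q)%O) x :
  bool_fun q (pm_map A h x) = pm_map B h (bool_fun p x).
Proof.
case: p q h x => -[] h x //=; try by rewrite !pm_id.
by rewrite (bool_irrelevance h le01) sq.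
Qed.
Definition bool_mor : pmor A B := mkpmor bool_fun_nat.
End ToFrom.

Lemma bool_pmorP (A B : pmod k bool) (f g : pmor A B) :
  (forall x, f false x = g false x) -> (forall x, f true x = g true x) -> f = g.
Proof. by move=> ff ft; apply: pmorP => -[]. Qed.

Fact line_subproof (V : lmodType k) (v : V) : linear (fun c : k^o => c *: v).
Proof. by move=> a x y; rewrite scalerDl scalerA. Qed.
Definition line (V : lmodType k) (v : V) : {linear k^o -> V} := mklin (line_subproof v).

Notation V0 := ('rV[k]_0 : lmodType k).

(** [full_mod] is free on a generator in degree [false] and also injective;
    [top_mod], the simple module at [true], is free; [bot_mod], the simple module at
    [false], is injective. *)
Definition full_mod := arrow (idlin k^o).
Definition top_mod := arrow (zero_lin V0 k^o).
Definition bot_mod := arrow (zero_lin k^o V0).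

Definition top_full : pmor top_mod full_mod.
Proof.
apply: (@bool_mor top_mod full_mod (zero_lin V0 k^o) (idlin k^o)).
by move=> x; rewrite /= .
Defined.

Definition full_bot : pmor full_mod bot_mod.
Proof.
apply: (@bool_mor full_mod bot_mod (idlin k^o) (zero_lin k^o V0)).
by move=> x.
Defined.

Lemma top_full_mono : pmono top_full.
Proof. by case=> x y // _; rewrite (thinmx0 x) (thinmx0 y). Qed.

Lemma full_bot_epi : pepi full_bot.
Proof. by case=> x; [exists 0; rewrite (thinmx0 x)|exists x]. Qed.

Lemma full_projective : projective_pm full_mod.
Proof.
move=> A B e f ee; have [a aE] := ee false (f false (1 : k^o)).
have sq : forall c, line (pm_map A le01 a) (pm_map full_mod le01 c) =
    pm_map A le01 (line a c) by move=> c /=; rewrite linearZ.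
exists (bool_mor sq).
have fE (c : k^o) : e false (c *: a) = f false c.
  by rewrite linearZ /= aE -linearZ /=; congr (f _ _); exact: mulr1.
apply: bool_pmorP => c; first exact: fE.
rewrite -[LHS]/(e true (c *: pm_map A le01 a)) -linearZ pmor_nat fE.
by rewrite -pmor_nat.
Qed.

Lemma top_projective : projective_pm top_mod.
Proof.
move=> A B e f ee; have [a aE] := ee true (f true (1 : k^o)).
have sq : forall c, line a (pm_map top_mod le01 c) =
    pm_map A le01 (zero_lin V0 (A false) c) by move=> c /=; rewrite linear0 scale0r.
exists (bool_mor sq); apply: bool_pmorP => c.
  by rewrite (thinmx0 c : c = 0) !linear0.
rewrite -[LHS]/(e true (c *: a)) linearZ /= aE -linearZ /=; congr (f _ _); exact: mulr1.
Qed.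

Lemma full_injective : injective_pm full_mod.
Proof.
move=> A B m f mm.
have [g gE] := @linear_extension k _ _ _ (pmor_fun m (p := true)) (pmor_fun f (p := true) : {linear _ -> _}) (mm true).
have sq : forall x, g (pm_map B le01 x) =
  pm_map full_mod le01 ((g \o pm_map B le01 : {linear _ -> _}) x) by [].
exists (bool_mor sq); apply: bool_pmorP => x; last exact: gE.
rewrite -[LHS]/(g (pm_map B le01 (m false x))) -pmor_nat gE.
exact: (pmor_nat f le01 x).
Qed.

Lemma bot_injective : injective_pm bot_mod.
Proof.
move=> A B m f mm.
have [g gE] := @linear_extension k _ _ _ (pmor_fun m (p := false)) (pmor_fun f (p := false) : {linear _ -> _}) (mm false).
have sq : forall x, zero_lin (B true) V0 (pm_map B le01 x) = pm_map bot_mod le01 (g x) by [].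
exists (@bool_mor B bot_mod g (zero_lin (B true) V0) sq); apply: bool_pmorP => x; first exact: gE.
by rewrite -[LHS]/(0 : V0) (thinmx0 (f true x)).
Qed.

Section Complexes.

Definition res_bot_obj n : pmod k bool :=
  match n with 0 => full_mod | 1 => top_mod | _ => pzero k bool end.
Definition res_bot_d n : pmor (res_bot_obj n.+1) (res_bot_obj n) :=
  match n return pmor (res_bot_obj n.+1) (res_bot_obj n) with 0 => top_full | _ => 0 end.
Fact res_bot_dd n : pmcomp (res_bot_d n) (res_bot_d n.+1) = 0.
Proof. by case: n => [|n] /=; rewrite pmcompf0. Qed.
(** The projective resolution of the simple module at [false]. *)
Definition res_bot := Chain res_bot_dd.

Definition top_shift_obj n : pmod k bool :=
  match n with 1 => top_mod | _ => pzero k bool end.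
Definition top_shift := @Chain _ _ _ top_shift_obj (fun n => 0) (fun n => pmcompf0 _ _).

Definition inj_top_obj n : pmod k bool :=
  match n with 0 => full_mod | 1 => bot_mod | _ => pzero k bool end.
Definition inj_top_d n : pmor (inj_top_obj n) (inj_top_obj n.+1) :=
  match n return pmor (inj_top_obj n) (inj_top_obj n.+1) with 0 => full_bot | _ => 0 end.
Fact inj_top_dd n : pmcomp (inj_top_d n.+1) (inj_top_d n) = 0.
Proof. by case: n => [|n] /=; rewrite pmcomp0f. Qed.
(** The injective resolution of the simple module at [true]. *)
Definition inj_top := Cochain inj_top_dd.

Definition ext_class_fun n : pmor (res_bot n) (top_shift n) :=
  match n return pmor (res_bot_obj n) (top_shift_obj n) with 1 => pid top_mod | _ => 0 end.
Fact ext_class_comm n :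
  pmcomp (ch_d top_shift n) (ext_class_fun n.+1) = pmcomp (ext_class_fun n) (ch_d res_bot n).
Proof.
rewrite [LHS]pmcomp0f; case: n => [|[|n]] /=; [|by rewrite pmcompf0|]; by rewrite pmcomp0f.
Qed.
(** The identity of [top_mod] in degree one: in the derived category, the class of
    the extension [0 -> top_mod -> full_mod -> bot_mod -> 0]. *)
Definition ext_class : chain_map res_bot top_shift := ChainMap ext_class_comm.

Lemma res_bot_projective : proj_with_bnd res_bot.
Proof.
split=> -[|[|n]].
- exact: full_projective.
- exact: top_projective.
- exact/zero_projective/pzero_zero.
- exact: pim_mono_projective top_full_mono top_projective.
- exact/zero_projective/pim0_zero.
- exact/zero_projective/pim0_zero.
Qed.

Lemma top_shift_projective : proj_with_bnd top_shift.
Proof.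
split=> n; last exact/zero_projective/pim0_zero.
case: n => [|[|n]]; [|exact: top_projective|]; exact/zero_projective/pzero_zero.
Qed.

Lemma inj_top_injective : inj_with_bnd inj_top.
Proof.
split=> -[|[|n]].
- exact: full_injective.
- exact: bot_injective.
- exact/zero_injective/pzero_zero.
- exact/zero_injective/pim0_zero.
- exact: pim_epi_injective full_bot_epi bot_injective.
- by apply: zero_injective; case: n => [|n]; exact: pim0_zero.
Qed.

Lemma hlgy_ext_class n : hlgy_mor ext_class n = 0.
Proof.
apply: (pepi_cancel (@hclass_epi _ _ _ _ _ _ _ _)); rewrite -/(ch_cl res_bot n) ch_cl_mor pmcomp0f.
have -> : ch_cyc_mor ext_class n = 0; last by rewrite pmcompf0.
apply: (pmono_cancel (@pker_in_mono _ _ _ _ _ (ch_out top_shift n))).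
rewrite -/(ch_cyc_in top_shift n) ch_cyc_in_mor pmcompf0.
case: n => [|[|n]]; [exact: pmcomp0f| |exact: pmcomp0f].
rewrite [LHS]pmcomp1f; apply: (pmono_cancel top_full_mono).
by rewrite pmcompf0; exact: (ch_d_cyc_in res_bot 0).
Qed.

Local Notation p1 := (@pi1 _ bool : {omorphism (bool *p bool)%type -> bool}).

Definition co_map_id (L : cochain k bool) : cochain_map L L :=
  CochainMap (fun n => etrans (pmcompf1 (co_d L n)) (esym (pmcomp1f _))).

Section Slice.
Context (M N : pmod k bool) (f : pmor M N) (y : bool).
Fact to_slice_nat p q (h : (p <= q)%O) x :
  f q (pm_map M h x) = pm_map (pullback (slice p1 y) N) h (f p x).
Proof. by rewrite pmor_nat; congr (pm_map N _ _); exact: bool_irrelevance. Qed.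
Definition to_slice : pmor M (pullback (slice p1 y) N) :=
  @mkpmor _ _ _ M (pullback (slice p1 y) N) (fun p => mklin (pmor_linear f (p := p))) to_slice_nat.
End Slice.

(** The inclusion of [top_mod] in [full_mod] is a cocycle on [top_shift]. If it became a
    coboundary on [res_bot], it would extend, up to sign, to an endomorphism [w] of
    [full_mod] that vanishes in [bot_mod]. Such a [w] is zero at [false], hence at
    [true], where the inclusion is not. *)
Lemma mid_ext_class_neq0 : mid_term_mor p1 1 ext_class (co_map_id inj_top) <> 0.
Proof.
set g := co_map_id _ => E.
pose u : ihom p1 top_mod full_mod false := ihom_mk (to_slice top_full false).
pose U : @fam _ _ _ p1 top_shift inj_top false := fun p q =>
  match p, q return ihom p1 (top_shift_obj p) (inj_top_obj q) false with 1, 0 => u | _, _ => 0 end.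
have [|z zU] := @fam_tot_cyc _ _ _ p1 top_shift inj_top 1 false U.
  move=> [|[|[|p]]] [|[|[|q]]] // _; rewrite /fam_d /U /= ?linear0 ?scaler0 ?addr0 ?add0r //.
    apply: ihom_ev_inj; by rewrite ihom_ev_mor ihom_mkK; apply: pmorP => -[].
  by rewrite ihom0l scaler0.
have := congr1 (fun h => pmor_fun h (tot_cl p1 top_shift inj_top 1 false z)) E.
rewrite -pmcompE tot_cl_mor pmcompE => /hclass_eq0.
rewrite -/(tot_cyc_in p1 res_bot inj_top 1).
rewrite -[tot_cyc_in _ _ _ _ _ _]/(pmcomp (tot_cyc_in p1 res_bot inj_top 1) (tot_cyc_mor p1 1 ext_class g) false z).
rewrite tot_cyc_in_mor pmcompE zU.
rewrite -[tot_mor _ _ _ _ _ _]/(tot_of 1 (fun p q => ihom_mor p1 (ext_class p) (g q) false (U p q))).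
move/tot_bnd => [Y YE].
have := YE 0 1 erefl; rewrite linear0 /fam_d /= add0r => Y01.
have := YE 1 0 erefl; rewrite /fam_d /= addr0 => Y10.
pose w : ihom p1 full_mod full_mod false := Y 0 0.
have w0 (x : k^o) : ihom_ev w false x = 0.
  have E0 : ihom_ev (ihom_mor p1 (pid full_mod) full_bot false w) = 0.
    by rewrite -Y01; exact: pmorP.
  by rewrite ihom_ev_mor in E0; exact: (@pmor_app _ _ _ _ _ _ _ E0 false x).
have w1 (x : k^o) : ihom_ev w true x = 0.
  by have := pmor_nat (ihom_ev w) le01 x; rewrite w0 linear0.
have E1 : to_slice top_full false = (-1) ^+ (0 + 0 + 1) *: pmcomp (ihom_ev w) top_full.
  have <- : ihom_ev (ihom_mor p1 (pid top_mod) (pid full_mod) false u) = to_slice top_full false.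
    by rewrite ihom_ev_mor ihom_mkK; exact: pmorP.
  rewrite Y10.
  by rewrite ihom_evZ ihom_ev_mor; congr (_ *: _); exact: pmorP.
have := @pmor_app _ _ _ _ _ _ _ E1 true (1 : k^o).
rewrite pmorZE pmcompE w1 scaler0 => /eqP.
by rewrite -[_ == _]/((1 : k) == 0) oner_eq0.
Qed.
End Complexes.

End Arrow.

Theorem theorem5p4 (k : fieldType) :
  (forall (d : Order.disp_t) (P : porderType d)
          (phi : {omorphism (P *p P)%type -> P}) (n : nat),
     exists S : kunneth_ses k phi n, splits_when_injective S) /\
  (exists (d : Order.disp_t) (P : porderType d)
          (phi : {omorphism (P *p P)%type -> P}) (n : nat),
     forall S : kunneth_ses k phi n, ~ splits_naturally S).
Proof.
split=> [d P phi n|]; first exact: kunneth.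
exists _, (bool : porderType _), (@pi1 _ bool), 1%N => S Snat.
apply: (@mid_ext_class_neq0 k).
exact: natural_splitting_kills (top_shift_projective k) (res_bot_projective k) (inj_top_injective k) (hlgy_ext_class k) Snat.
Qed.
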